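(* Let $\Lambda$ be a basic Artin algebra such that $\mathcal{P}^{<\infty}(\Lambda\text{-mod})$ is contravariantly finite in $\Lambda\text{-mod}$. Let ${}_\Lambda T$ be the basic strong tilting module in $\Lambda\text{-mod}$ and $\widetilde{\Lambda}=\operatorname{End}_\Lambda(T)^{\mathrm{op}}$. Suppose that $\mathcal{P}^{<\infty}(\text{mod-}\widetilde{\Lambda})$ is contravariantly finite in $\text{mod-}\widetilde{\Lambda}$, let $\widetilde{T}_{\widetilde{\Lambda}}$ be the basic strong tilting module in $\text{mod-}\widetilde{\Lambda}$, and $\widetilde{\widetilde{\Lambda}}=\operatorname{End}_{\widetilde{\Lambda}}(\widetilde{T})$. Then the pairs of functors $\bigl(\operatorname{Hom}_\Lambda(-,T),\operatorname{Hom}_{\widetilde{\Lambda}}(-,T)\bigr)$ and $\bigl(\operatorname{Hom}_{\widetilde{\Lambda}}(-,\widetilde{T}),\operatorname{Hom}_{\widetilde{\widetilde{\Lambda}}}(-,\widetilde{T})\bigr)$ induce dualities $$\mathcal{P}^{<\infty}(\Lambda\text{-mod})\longleftrightarrow\mathcal{P}^{<\infty}(\text{mod-}\widetilde{\Lambda})\cap{}^\perp(T_{\widetilde{\Lambda}})\ \subseteq\ \mathcal{P}^{<\infty}(\text{mod-}\widetilde{\Lambda})\longleftrightarrow\mathcal{P}^{<\infty}(\widetilde{\widetilde{\Lambda}}\text{-mod}),$$ where ${}^\perp(T_{\widetilde{\Lambda}})$ is the full subcategory of $\text{mod-}\widetilde{\Lambda}$ whose objects are the modules $\widetilde{M}$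 with $\operatorname{Ext}^i_{\widetilde{\Lambda}}(\widetilde{M},T)=0$ for $i\ge1$. Moreover, ${}^\perp(T_{\widetilde{\Lambda}})$ contains $\mathcal{P}^{<\infty}(\text{mod-}\widetilde{\Lambda})$ if and only if ${}_\Lambda T_{\widetilde{\Lambda}}$ is two-sided strong, i.e., precisely when $T\cong\widetilde{T}$.
   Context: For an Artin algebra $A$, $A\text{-mod}$ (resp. $\text{mod-}A$) is the category of finitely generated left (resp. right) $A$-modules, and $\mathcal{P}^{<\infty}(A\text{-mod})$ (resp. $\mathcal{P}^{<\infty}(\text{mod-}A)$) its full subcategory of modules of finite projective dimension. $A$ is basic if $A/J(A)$ is a product of division rings; a module is basic if it has no indecomposable direct summand of multiplicity $>1$. $\mathcal{P}^{<\infty}(A\text{-mod})$ is contravariantly finite in $A\text{-mod}$ if for each $M\in A\text{-mod}$ there is a map $\phi:X\to M$ with $X\in\mathcal{P}^{<\infty}(A\text{-mod})$ through which every homomorphism from an object of $\mathcal{P}^{<\infty}(A\text{-mod})$ to $M$ factors. Similarly for right modules. A module $T\in A\text{-mod}$ is a tilting module if (1) $T\in\mathcal{P}^{<\infty}(A\text{-mod})$, (2) $\operatorname{Ext}^i_A(T,T)=0$ for $i\ge1$, (3) there is an exact sequence $0\to A\to T_0\to\cdots\to T_m\to0$ with all $T_j\in\operatorname{add}(T)$. It is strong if, in addition, $\operatorname{Ext}^i_A(M,T)=0$ for all $M\in\mathcal{P}^{<\infty}(A\text{-mod})$ and $i\ge1$. Similarly for right modules. A strong tilting module exists in $A\text{-mod}$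 if and only if $\mathcal{P}^{<\infty}(A\text{-mod})$ is contravariantly finite, and the basic strong tilting module is then unique up to isomorphism. If $T\in A\text{-mod}$ is tilting and $\widetilde A=\operatorname{End}_A(T)^{\mathrm{op}}$, then $T_{\widetilde A}$ is a tilting module with $\operatorname{End}_{\widetilde A}(T)\cong A$. The bimodule ${}_\Lambda T_{\widetilde\Lambda}$ is two-sided strong if $T$ is strong both in $\Lambda\text{-mod}$ and in $\text{mod-}\widetilde\Lambda$; the isomorphism $T\cong\widetilde T$ is one of right $\widetilde\Lambda$-modules. A duality is a contravariant equivalence of categories. *)

(* Defs.v *)
From HB Require Import structures.
From mathcomp Require Import all_boot all_order all_algebra.
From mathcomp Require Import boolp.

Set Implicit Arguments.
Unset Strict Implicit.
Unset Printing Implicit Defensive.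

Import GRing.Theory.
Local Open Scope ring_scope.

(* Modules are left modules, [lmodType R].  A right module over the ring A is a
   left module over the opposite ring of A; in particular, right modules over
   End_R(T)^op are the left modules over the ring [Endo T] of R-linear
   endomorphisms of T (with composition as product), and all notions below are
   applied to mod-End_R(T)^op in this form. *)

Definition left_ideal (R : pzRingType) (I : R -> Prop) : Prop :=
  [/\ I 0, forall x y, I x -> I y -> I (x + y)
    & forall a x, I x -> I (a * x)].

Definition maximal_left_ideal (R : pzRingType) (I : R -> Prop) : Prop :=
  [/\ left_ideal I, ~ I 1
    & forall J : R -> Prop, left_ideal J -> ~ J 1 ->
        (forall x, I x -> J x) -> forall x, J x -> I x].

Definition jacobson (R : pzRingType) (x : R) : Prop :=
  forall I : R -> Prop, maximal_left_ideal I -> I x.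

Definition artinian (R : pzRingType) : Prop :=
  forall I : nat -> R -> Prop,
    (forall n, left_ideal (I n)) ->
    (forall n x, I n.+1 x -> I n x) ->
    exists n, forall m, (n <= m)%N -> forall x, I n x -> I m x.

Definition division_ring (D : nzRingType) : Prop :=
  forall x : D, x != 0 -> exists y, y * x = 1 /\ x * y = 1.

(* A/J(A) is isomorphic to a finite product of division rings D_i: the
   isomorphism is given as a surjective ring morphism from A to the product of
   the D_i, with components [p i], whose kernel is J(A). *)
Definition basic_ring (A : pzRingType) : Prop :=
  exists (n : nat) (D : 'I_n -> nzRingType) (p : forall i, {rmorphism A -> D i}),
    [/\ forall i, division_ring (D i),
        forall d : (forall i, D i), exists a, forall i, p i a = d i
      & forall a, (forall i, p i a = 0) <-> jacobson a].

Definition finitely_generated (R : pzRingType) (M : lmodType R) : Prop :=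
  exists (n : nat) (g : 'I_n -> M),
    forall x, exists c : 'I_n -> R, x = \sum_(i < n) c i *: g i.

Definition artin_algebra (k : comNzRingType) (A : algType k) : Prop :=
  artinian k /\ finitely_generated A.

Definition isomorphic (R : pzRingType) (M N : lmodType R) : Prop :=
  exists f : {linear M -> N}, bijective f.

Definition zero_module (R : pzRingType) (M : lmodType R) : Prop :=
  forall x : M, x = 0.

Definition direct_summand (R : pzRingType) (X M : lmodType R) : Prop :=
  exists Y : lmodType R, isomorphic (X * Y)%type M.

Definition indecomposable (R : pzRingType) (X : lmodType R) : Prop :=
  ~ zero_module X /\
  forall Y Z : lmodType R, isomorphic (Y * Z)%type X ->
    zero_module Y \/ zero_module Z.

Definition basic_module (R : pzRingType) (M : lmodType R) : Prop :=
  forall X : lmodType R, indecomposable X -> ~ direct_summand (X * X)%type M.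

Definition in_add (R : pzRingType) (T X : lmodType R) : Prop :=
  exists n : nat, direct_summand X {ffun 'I_n -> T}.

Definition projective (R : pzRingType) (P : lmodType R) : Prop :=
  forall (M N : lmodType R) (g : {linear M -> N}) (f : {linear P -> N}),
    (forall y, exists x, g x = y) ->
    exists h : {linear P -> M}, forall x, g (h x) = f x.

Record proj_resolution (R : pzRingType) (M : lmodType R) := ProjResolution {
  res_obj : nat -> lmodType R;
  res_diff : forall i, {linear res_obj i.+1 -> res_obj i};
  res_aug : {linear res_obj 0%N -> M};
  res_proj : forall i, projective (res_obj i);
  res_aug_surj : forall x, exists y, res_aug y = x;
  res_exact0 : forall y, res_aug y = 0 <-> exists z, res_diff 0%N z = y;
  res_exact : forall i y,
    res_diff i y = 0 <-> exists z, res_diff i.+1 z = y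
}.

Definition finite_pd (R : pzRingType) (M : lmodType R) : Prop :=
  exists (n : nat) (P : proj_resolution M),
    forall i, (n < i)%N -> zero_module (res_obj P i).

(* Vanishing of the i-th cohomology group of the complex Hom_R(P, N). *)
Definition cohomology_eq0 (R : pzRingType) (M : lmodType R)
    (P : proj_resolution M) (N : lmodType R) (i : nat) : Prop :=
  match i with
  | 0 => forall f : {linear res_obj P 0%N -> N},
      (forall x, f (res_diff P 0%N x) = 0) -> forall x, f x = 0
  | j.+1 => forall f : {linear res_obj P j.+1 -> N},
      (forall x, f (res_diff P j.+1 x) = 0) ->
      exists g : {linear res_obj P j -> N}, forall x, f x = g (res_diff P j x)
  end.

(* Ext^i_R(M, N) = 0.  Ext does not depend on the projective resolution, so it
   is enough to ask for one that computes it to be zero. *)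
Definition Ext_eq0 (R : pzRingType) (i : nat) (M N : lmodType R) : Prop :=
  exists P : proj_resolution M, cohomology_eq0 P N i.

(* Objects of P^{<oo}(R-mod). *)
Definition Pfin (R : pzRingType) (M : lmodType R) : Prop :=
  finitely_generated M /\ finite_pd M.

Definition perp (R : pzRingType) (T M : lmodType R) : Prop :=
  finitely_generated M /\ forall i, (1 <= i)%N -> Ext_eq0 i M T.

Definition Pfin_contravariantly_finite (R : pzRingType) : Prop :=
  forall M : lmodType R, finitely_generated M ->
    exists (X : lmodType R) (phi : {linear X -> M}),
      Pfin X /\
      forall (Y : lmodType R) (f : {linear Y -> M}), Pfin Y ->
        exists g : {linear Y -> X}, forall y, f y = phi (g y).

(* An exact sequence 0 -> R -> T_0 -> ... -> T_m -> 0 with T_j in add(T),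
   extended by T_j = 0 for j > m. *)
Definition coresolved_by_add (R : pzRingType) (T : lmodType R) : Prop :=
  exists (m : nat) (X : nat -> lmodType R) (e : {linear R^o -> X 0%N})
         (d : forall j, {linear X j -> X j.+1}),
    [/\ forall j, (j <= m)%N -> in_add T (X j),
        forall j, (m < j)%N -> zero_module (X j),
        injective e,
        forall x, d 0%N x = 0 <-> exists a, e a = x
      & forall j x, d j.+1 x = 0 <-> exists y, d j y = x].

Definition tilting (R : pzRingType) (T : lmodType R) : Prop :=
  [/\ Pfin T, forall i, (1 <= i)%N -> Ext_eq0 i T T & coresolved_by_add T].

Definition strong_tilting (R : pzRingType) (T : lmodType R) : Prop :=
  tilting T /\
  forall M : lmodType R, Pfin M -> forall i, (1 <= i)%N -> Ext_eq0 i M T.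

Definition LinHom (R : pzRingType) (M N : lmodType R) : Type := {linear M -> N}.

(* [boolp] provides the equality and choice structures on linear maps, and their
   extensionality. *)
Section HomZmodule.
Context (R : pzRingType) (M N : lmodType R).

HB.instance Definition _ := gen_eqMixin (LinHom M N).
HB.instance Definition _ := gen_choiceMixin (LinHom M N).

Lemma LinHomP (f g : LinHom M N) : f =1 g -> f = g.
Proof.
case: f g => [f [[f1] [f2]]] [g [[g1] [g2]]] /= /funext fg.
by subst g; congr (GRing.Linear.Pack (GRing.Linear.Class _ _));
  congr (_ _); apply: Prop_irrelevance.
Qed.

Fact hom_add_linear (f g : LinHom M N) : linear (fun x : M => f x + g x).
Proof. by move=> a x y; rewrite !linearP scalerDr addrACA. Qed.
Definition hom_add (f g : LinHom M N) : LinHom M N :=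
  HB.pack_for {linear M -> N} (fun x : M => f x + g x)
    (GRing.isLinear.Build R M N *:%R _ (hom_add_linear f g)).

Fact hom_opp_linear (f : LinHom M N) : linear (fun x : M => - f x).
Proof. by move=> a x y; rewrite linearP opprD scalerN. Qed.
Definition hom_opp (f : LinHom M N) : LinHom M N :=
  HB.pack_for {linear M -> N} (fun x : M => - f x)
    (GRing.isLinear.Build R M N *:%R _ (hom_opp_linear f)).

Fact hom_zero_linear : linear (fun _ : M => 0 : N).
Proof. by move=> a x y; rewrite scaler0 addr0. Qed.
Definition hom_zero : LinHom M N :=
  HB.pack_for {linear M -> N} (fun _ : M => 0 : N)
    (GRing.isLinear.Build R M N *:%R _ hom_zero_linear).

Fact hom_addA : associative hom_add.
Proof. by move=> f g h; apply: LinHomP => x /=; rewrite addrA. Qed.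
Fact hom_addC : commutative hom_add.
Proof. by move=> f g; apply: LinHomP => x /=; rewrite addrC. Qed.
Fact hom_add0 : left_id hom_zero hom_add.
Proof. by move=> f; apply: LinHomP => x /=; rewrite add0r. Qed.
Fact hom_addN : left_inverse hom_zero hom_opp hom_add.
Proof. by move=> f; apply: LinHomP => x /=; rewrite addNr. Qed.

HB.instance Definition _ :=
  GRing.isZmodule.Build (LinHom M N) hom_addA hom_addC hom_add0 hom_addN.

End HomZmodule.

Definition hom_comp (R : pzRingType) (L M N : lmodType R)
  (g : LinHom M N) (f : LinHom L M) : LinHom L N := (g \o f : {linear L -> N}).

Definition Endo (R : pzRingType) (T : lmodType R) : Type := LinHom T T.

Section EndoRing.
Context (R : pzRingType) (T : lmodType R).

HB.instance Definition _ := GRing.Zmodule.on (Endo T).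

Definition endo_one : Endo T := (idfun : {linear T -> T}).
Definition endo_mul (f g : Endo T) : Endo T := hom_comp f g.

Fact endo_mulA : associative endo_mul.
Proof. by move=> f g h; apply: LinHomP. Qed.
Fact endo_mul1 : left_id endo_one endo_mul.
Proof. by move=> f; apply: LinHomP. Qed.
Fact endo_1mul : right_id endo_one endo_mul.
Proof. by move=> f; apply: LinHomP. Qed.
Fact endo_mulDl : left_distributive endo_mul +%R.
Proof. by move=> f g h; apply: LinHomP. Qed.
Fact endo_mulDr : right_distributive endo_mul +%R.
Proof. by move=> f g h; apply: LinHomP => x /=; rewrite linearD. Qed.

HB.instance Definition _ := GRing.Zmodule_isPzRing.Build (Endo T)
  endo_mulA endo_mul1 endo_1mul endo_mulDl endo_mulDr.

End EndoRing.

(* T as a left module over its endomorphism ring: f *: t = f t. *)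
Definition end_mod (R : pzRingType) (T : lmodType R) : Type := T.

Section EndModule.
Context (R : pzRingType) (T : lmodType R).

HB.instance Definition _ := GRing.Zmodule.on (end_mod T).

Definition end_scale (f : Endo T) (t : end_mod T) : end_mod T := f t.

Fact end_scaleA f g t : end_scale f (end_scale g t) = end_scale (f * g) t.
Proof. by []. Qed.
Fact end_scale1 : left_id 1 end_scale.
Proof. by []. Qed.
Fact end_scaleDr : right_distributive end_scale +%R.
Proof. by move=> f x y; apply: (linearD f). Qed.
Fact end_scaleDl t : {morph end_scale^~ t : f g / f + g}.
Proof. by []. Qed.

HB.instance Definition _ := GRing.Zmodule_isLmodule.Build (Endo T) (end_mod T)
  end_scaleA end_scale1 end_scaleDr end_scaleDl.

End EndModule.

Record cofunctor (R S : pzRingType) := Cofunctor {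
  cf_obj :> lmodType R -> lmodType S;
  cf_map : forall M N : lmodType R,
    {linear M -> N} -> {linear cf_obj N -> cf_obj M};
  cf_map_id : forall (M : lmodType R) u,
    cf_map (idfun : {linear M -> M}) u = u;
  cf_map_comp : forall (L M N : lmodType R)
      (g : {linear M -> N}) (f : {linear L -> M}) u,
    cf_map (g \o f : {linear L -> N}) u = cf_map f (cf_map g u)
}.

(* The functor Hom_R(-, T), where Endo(T) acts by f *: u = f \o u. *)
Section HomTo.
Context (R : pzRingType) (T : lmodType R).

Definition hom_to (M : lmodType R) : Type := LinHom M T.

Section Module.
Context (M : lmodType R).
HB.instance Definition _ := GRing.Zmodule.on (hom_to M).

Definition hom_to_scale (f : Endo T) (u : hom_to M) : hom_to M := hom_comp f u.

Fact hom_to_scaleA f g u :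
  hom_to_scale f (hom_to_scale g u) = hom_to_scale (f * g) u.
Proof. by apply: LinHomP. Qed.
Fact hom_to_scale1 : left_id 1 hom_to_scale.
Proof. by move=> u; apply: LinHomP. Qed.
Fact hom_to_scaleDr : right_distributive hom_to_scale +%R.
Proof. by move=> f u v; apply: LinHomP => x /=; rewrite linearD. Qed.
Fact hom_to_scaleDl u : {morph hom_to_scale^~ u : f g / f + g}.
Proof. by move=> f g; apply: LinHomP. Qed.

HB.instance Definition _ := GRing.Zmodule_isLmodule.Build (Endo T) (hom_to M)
  hom_to_scaleA hom_to_scale1 hom_to_scaleDr hom_to_scaleDl.
End Module.

Definition hom_to_fun (M N : lmodType R) (f : {linear M -> N}) (u : hom_to N) :
  hom_to M := hom_comp u f.

Fact hom_to_fun_linear (M N : lmodType R) (f : {linear M -> N}) :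
  linear (hom_to_fun f).
Proof. by move=> a u v; apply: LinHomP. Qed.

Definition hom_to_map (M N : lmodType R) (f : {linear M -> N}) :
    {linear hom_to N -> hom_to M} :=
  HB.pack_for {linear hom_to N -> hom_to M} (hom_to_fun f)
    (GRing.isLinear.Build (Endo T) (hom_to N) (hom_to M) *:%R _
       (hom_to_fun_linear f)).

Fact hom_to_map_id (M : lmodType R) u :
  hom_to_map (idfun : {linear M -> M}) u = u.
Proof. by apply: LinHomP. Qed.
Fact hom_to_map_comp (L M N : lmodType R)
    (g : {linear M -> N}) (f : {linear L -> M}) u :
  hom_to_map (g \o f : {linear L -> N}) u = hom_to_map f (hom_to_map g u).
Proof. by apply: LinHomP. Qed.

Definition HomTo : cofunctor R (Endo T) :=
  Cofunctor hom_to_map_id hom_to_map_comp.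

End HomTo.

(* The functor Hom_{Endo(T)}(-, T) back to R-modules, (r *: u) x = r *: u x, with
   the R-module structure of T on the right-hand side. *)
Section HomEndTo.
Context (R : pzRingType) (T : lmodType R).

Definition homE_to (X : lmodType (Endo T)) : Type := LinHom X (end_mod T).

Section Module.
Context (X : lmodType (Endo T)).
HB.instance Definition _ := GRing.Zmodule.on (homE_to X).

Fact homE_to_scale_linear (r : R) (u : homE_to X) :
  linear (fun x : X => (r *: (u x : T) : T) : end_mod T).
Proof.
move=> f x y; rewrite linearP [LHS]scalerDr; congr (_ + _).
by rewrite /GRing.scale/= /end_scale linearZ.
Qed.
Definition homE_to_scale (r : R) (u : homE_to X) : homE_to X :=
  HB.pack_for {linear X -> end_mod T}
    (fun x : X => (r *: (u x : T) : T) : end_mod T)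
    (GRing.isLinear.Build (Endo T) X (end_mod T) *:%R _
       (homE_to_scale_linear r u)).

Fact homE_to_scaleA r s u :
  homE_to_scale r (homE_to_scale s u) = homE_to_scale (r * s) u.
Proof. by apply: LinHomP => x /=; rewrite scalerA. Qed.
Fact homE_to_scale1 : left_id 1 homE_to_scale.
Proof. by move=> u; apply: LinHomP => x /=; rewrite scale1r. Qed.
Fact homE_to_scaleDr : right_distributive homE_to_scale +%R.
Proof.
by move=> r u v; apply: LinHomP => x; exact: (scalerDr r (u x : T) (v x : T)).
Qed.
Fact homE_to_scaleDl u : {morph homE_to_scale^~ u : r s / r + s}.
Proof. by move=> r s; apply: LinHomP => x; exact: (scalerDl (u x : T) r s). Qed.

HB.instance Definition _ := GRing.Zmodule_isLmodule.Build R (homE_to X)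
  homE_to_scaleA homE_to_scale1 homE_to_scaleDr homE_to_scaleDl.
End Module.

Definition homE_to_fun (X Y : lmodType (Endo T)) (f : {linear X -> Y})
  (u : homE_to Y) : homE_to X := hom_comp u f.

Fact homE_to_fun_linear (X Y : lmodType (Endo T)) (f : {linear X -> Y}) :
  linear (homE_to_fun f).
Proof. by move=> a u v; apply: LinHomP. Qed.

Definition homE_to_map (X Y : lmodType (Endo T)) (f : {linear X -> Y}) :
    {linear homE_to Y -> homE_to X} :=
  HB.pack_for {linear homE_to Y -> homE_to X} (homE_to_fun f)
    (GRing.isLinear.Build R (homE_to Y) (homE_to X) *:%R _
       (homE_to_fun_linear f)).

Fact homE_to_map_id (X : lmodType (Endo T)) u :
  homE_to_map (idfun : {linear X -> X}) u = u.
Proof. by apply: LinHomP. Qed.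
Fact homE_to_map_comp (X Y Z : lmodType (Endo T))
    (g : {linear Y -> Z}) (f : {linear X -> Y}) u :
  homE_to_map (g \o f : {linear X -> Z}) u = homE_to_map f (homE_to_map g u).
Proof. by apply: LinHomP. Qed.

Definition HomEndTo : cofunctor (Endo T) R :=
  Cofunctor homE_to_map_id homE_to_map_comp.

End HomEndTo.

(* On the full subcategory with object class C, the identity is naturally
   isomorphic to the composite G F. *)
Definition natural_iso_id (R S : pzRingType) (C : lmodType R -> Prop)
    (F : cofunctor R S) (G : cofunctor S R) : Prop :=
  exists eta : forall M : lmodType R, C M -> {linear M -> G (F M)},
    (forall (M : lmodType R) (CM : C M), bijective (eta M CM)) /\
    (forall (M N : lmodType R) (CM : C M) (CN : C N) (f : {linear M -> N}) x,
       cf_map G (cf_map F f) (eta M CM x) = eta N CN (f x)).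

(* F and G restrict to mutually quasi-inverse contravariant functors between the
   full subcategories with object classes C and D. *)
Definition induce_duality (R S : pzRingType)
    (F : cofunctor R S) (G : cofunctor S R)
    (C : lmodType R -> Prop) (D : lmodType S -> Prop) : Prop :=
  [/\ forall M, C M -> D (F M), forall X, D X -> C (G X),
      natural_iso_id C F G & natural_iso_id D G F].

(* T is strong both over R and, as a right module over End_R(T)^op, over
   End_R(T)^op. *)
Definition two_sided_strong (R : pzRingType) (T : lmodType R) : Prop :=
  strong_tilting T /\ strong_tilting (end_mod T).

(* Main.v *)
From HB Require Import structures.
Require Import Defs.
From mathcomp Require Import all_boot all_order all_algebra.
From mathcomp Require Import boolp.

(* The engine is a reflexivity argument. For the bimodule T, call a module M good
   if Ext^i(M, T) = 0 for i >= 1, if its dual Hom(M, T) is finitely generated, of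
   finite projective dimension and again Ext-orthogonal to T, and if M is its
   own bidual. In a short exact sequence 0 -> A -> B -> C -> 0, good B and C force
   A good, and good A and B force C good once C is Ext-orthogonal to T. The module
   T is good, so the coresolution of Lambda by add(T) makes Lambda good, and then
   finite projective resolutions make good every module of finite projective
   dimension in the orthogonal of T. On the side of the endomorphism ring,
   goodness of the regular module is immediate.

   If T is strong, a finitely generated right module over the endomorphism ring with
   no nonzero map to T is zero: the dual of a free presentation Q1 -> Q0 is a
   monomorphism in add(T) whose cokernel has finite projective dimension, so that
   Q1 -> Q0 is onto. The strong tilting module U over the endomorphism ring inherits
   this property, as T embeds in a power of U. Now let 0 -> N' -> Q -> N -> 0 be exact
   over End(U) with Q free and N of finite projective dimension: the cokernel of
   Q* -> N'*, which is Ext^1(N, U), has no nonzero map to U and thus vanishes, so that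
   U is strong over End(U) as well; this gives the second duality.

   Two strong tilting modules have the same additive closure, since the cokernel of
   an embedding of one in a power of the other has finite projective dimension; if
   both are basic they are isomorphic by the Krull-Schmidt exchange argument. *)

Set Implicit Arguments.
Unset Strict Implicit.
Unset Printing Implicit Defensive.

Import GRing.Theory.
Local Open Scope ring_scope.

(** * Submodules, quotients and pullbacks *)

(** [Ext_eq0] asks for one projective resolution, so Ext groups are never formed and no long exact
    sequence is at hand. Instead, Ext^(n+1)(M, N) = 0 and pd M <= n both become statements on the
    n-th syzygies of M, independent of choices by Schanuel's lemma; the pieces of the long exact
    sequence that are used are proved once, for any class that contains the projectives and is
    closed under extensions and retracts. Goodness must be transferred on both sides of T: R-modules
    start from T, modules over the endomorphism ring from the regular module. Hence the symmetric
    record [dual_pair], whose exchange of sides turns each lemma into its mirror image. The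
    homological part runs over noetherian rings. Descent enters through Fitting's lemma, and through
    the proof that k is noetherian. The exchange argument needs T to be basic over its endomorphism
    ring. As Hom(T, T) over that ring is Lambda, a repeated summand of T would give one of Lambda,
    and a basic Lambda has none. *)

Definition submodule (R : pzRingType) (M : lmodType R) (P : M -> Prop) : Prop :=
  P 0 /\ forall a x y, P x -> P y -> P (a *: x + y).

Section Submodule.
Context (R : pzRingType) (M : lmodType R) (P : M -> Prop).
Hypothesis subP : submodule P.

Lemma submoduleZ a x : P x -> P (a *: x).
Proof. by case: subP => P0 PD Px; rewrite -[_ *: _]addr0; apply: PD. Qed.

Lemma submoduleD x y : P x -> P y -> P (x + y).
Proof. by case: subP => P0 PD Px Py; rewrite -[x]scale1r; apply: PD. Qed.

Lemma submoduleN x : P x -> P (- x).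
Proof. by rewrite -scaleN1r; apply: submoduleZ. Qed.

Lemma submoduleB x y : P x -> P y -> P (x - y).
Proof. by move=> Px Py; apply: submoduleD => //; apply: submoduleN. Qed.

End Submodule.

Definition mk_linear (R : pzRingType) (M N : lmodType R) (f : M -> N)
    (fL : linear f) : {linear M -> N} :=
  HB.pack_for {linear M -> N} f (GRing.isLinear.Build R M N *:%R f fL).

Definition submod_type (R : pzRingType) (M : lmodType R) (P : M -> Prop)
  (subP : submodule P) : Type := {x : M | `[< P x >]}.

Section SubmodType.
Context (R : pzRingType) (M : lmodType R) (P : M -> Prop) (subP : submodule P).
Local Notation S := (submod_type subP).

HB.instance Definition _ := gen_eqMixin S.
HB.instance Definition _ := gen_choiceMixin S.

Definition submod_sub x (Px : P x) : S := exist _ x (asboolT Px).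

Lemma submod_valP (x : S) : P (sval x).
Proof. by case: x => x /= /asboolP. Qed.

Lemma submod_inj (x y : S) : sval x = sval y -> x = y.
Proof.
case: x y => [x Px] [y Py] /= xy; subst y.
by congr exist; apply: bool_irrelevance.
Qed.

Definition submod_zero : S := submod_sub (proj1 subP).
Definition submod_opp (x : S) : S := submod_sub (submoduleN subP (submod_valP x)).
Definition submod_add (x y : S) : S :=
  submod_sub (submoduleD subP (submod_valP x) (submod_valP y)).
Definition submod_scale a (x : S) : S :=
  submod_sub (submoduleZ subP a (submod_valP x)).

Fact submod_addA : associative submod_add.
Proof. by move=> x y z; apply: submod_inj; rewrite /= addrA. Qed.
Fact submod_addC : commutative submod_add.
Proof. by move=> x y; apply: submod_inj; rewrite /= addrC. Qed.
Fact submod_add0 : left_id submod_zero submod_add.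
Proof. by move=> x; apply: submod_inj; rewrite /= add0r. Qed.
Fact submod_addN : left_inverse submod_zero submod_opp submod_add.
Proof. by move=> x; apply: submod_inj; rewrite /= addNr. Qed.
HB.instance Definition _ :=
  GRing.isZmodule.Build S submod_addA submod_addC submod_add0 submod_addN.

Fact submod_scaleA a b x :
  submod_scale a (submod_scale b x) = submod_scale (a * b) x.
Proof. by apply: submod_inj; rewrite /= scalerA. Qed.
Fact submod_scale1 : left_id 1 submod_scale.
Proof. by move=> x; apply: submod_inj; rewrite /= scale1r. Qed.
Fact submod_scaleDr : right_distributive submod_scale +%R.
Proof. by move=> a x y; apply: submod_inj; rewrite /= scalerDr. Qed.
Fact submod_scaleDl x : {morph submod_scale^~ x : a b / a + b}.
Proof. by move=> a b; apply: submod_inj; rewrite /= scalerDl. Qed.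
HB.instance Definition _ := GRing.Zmodule_isLmodule.Build R S
  submod_scaleA submod_scale1 submod_scaleDr submod_scaleDl.

Fact submod_val_linear : linear (sval : S -> M).
Proof. by []. Qed.

End SubmodType.

Lemma submodule_exists (R : pzRingType) (M : lmodType R) (P : M -> Prop) :
  submodule P ->
  exists (N : lmodType R) (i : {linear N -> M}),
    injective i /\ forall x, P x <-> exists y, i y = x.
Proof.
move=> subP; exists (submod_type subP).
exists (mk_linear (@submod_val_linear _ _ _ subP)).
split; first by move=> x y; apply: submod_inj.
move=> x; split=> [Px|[y <-]]; last exact: submod_valP.
by exists (submod_sub subP Px).
Qed.

Section QuotType.
Context (R : pzRingType) (M : lmodType R) (P : M -> Prop) (subP : submodule P).

(** [choose] depends on its predicate only up to extensionality, and congruent elements define the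
    same predicate. Congruence thus becomes equality of representatives, and the quotient is carried
    by the fixed points of [quot_repr]. *)
Definition quot_repr (x : M) : M := choose (fun y => `[< P (y - x) >]) x.

Lemma quot_reprP x : P (quot_repr x - x).
Proof.
have Px : `[< P (x - x) >] by apply/asboolP; rewrite subrr; case: subP.
exact: (asboolW (chooseP (P := fun y => `[< P (y - x) >]) Px)).
Qed.

Lemma quot_reprE x y : quot_repr x = quot_repr y <-> P (x - y).
Proof.
split=> [xy|Pxy].
  have := submoduleB subP (quot_reprP y) (quot_reprP x).
  by rewrite xy opprB addrC addrA addrNK.
have self z : `[< P (z - z) >] by apply/asboolP; rewrite subrr; case: subP.
rewrite /quot_repr.
have eq_pred : (fun z => `[< P (z - x) >]) =1 (fun z => `[< P (z - y) >]).
  move=> z; rewrite -[z - y](subrKA x); apply/asboolP/asboolP => Pz.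
    exact: submoduleD.
  by rewrite -[z - x](addrK (x - y)); apply: submoduleB.
have Pxy' : `[< P (x - y) >] by apply/asboolP.
rewrite -(choose_id (P := fun z => `[< P (z - y) >]) Pxy' (self y)).
exact: eq_choose.
Qed.

Lemma quot_repr_id x : quot_repr (quot_repr x) = quot_repr x.
Proof. by apply/quot_reprE; apply: quot_reprP. Qed.

Definition quot_type : Type := {x : M | quot_repr x == x}.
Local Notation Q := quot_type.

HB.instance Definition _ := gen_eqMixin Q.
HB.instance Definition _ := gen_choiceMixin Q.

Definition quot_proj (x : M) : Q :=
  exist _ (quot_repr x) (introT eqP (quot_repr_id x)).

Lemma quot_projE x y : quot_proj x = quot_proj y <-> P (x - y).
Proof.
rewrite -quot_reprE; split=> [[]//|xy].
exact: eq_exist.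
Qed.

Lemma quot_projK (q : Q) : quot_proj (sval q) = q.
Proof. by case: q => x qx; apply: eq_exist; apply/eqP. Qed.

Definition quot_zero : Q := quot_proj 0.
Definition quot_opp (x : Q) : Q := quot_proj (- sval x).
Definition quot_add (x y : Q) : Q := quot_proj (sval x + sval y).
Definition quot_scale a (x : Q) : Q := quot_proj (a *: sval x).

Lemma quot_oppE x : quot_opp (quot_proj x) = quot_proj (- x).
Proof.
by apply/quot_projE; rewrite -opprD; apply: submoduleN => //; apply: quot_reprP.
Qed.
Lemma quot_addE x y : quot_add (quot_proj x) (quot_proj y) = quot_proj (x + y).
Proof.
apply/quot_projE; rewrite opprD addrACA.
by apply: submoduleD => //; apply: quot_reprP.
Qed.
Lemma quot_scaleE a x : quot_scale a (quot_proj x) = quot_proj (a *: x).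
Proof.
by apply/quot_projE; rewrite -scalerBr; apply: submoduleZ => //; apply: quot_reprP.
Qed.

Fact quot_addA : associative quot_add.
Proof.
move=> x y z; rewrite -(quot_projK x) -(quot_projK y) -(quot_projK z).
by rewrite !quot_addE addrA.
Qed.
Fact quot_addC : commutative quot_add.
Proof.
by move=> x y; rewrite -(quot_projK x) -(quot_projK y) !quot_addE addrC.
Qed.
Fact quot_add0 : left_id quot_zero quot_add.
Proof. by move=> x; rewrite -(quot_projK x) quot_addE add0r. Qed.
Fact quot_addN : left_inverse quot_zero quot_opp quot_add.
Proof. by move=> x; rewrite -(quot_projK x) quot_oppE quot_addE addNr. Qed.
HB.instance Definition _ :=
  GRing.isZmodule.Build Q quot_addA quot_addC quot_add0 quot_addN.

Fact quot_scaleA a b x : quot_scale a (quot_scale b x) = quot_scale (a * b) x.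
Proof. by rewrite -(quot_projK x) !quot_scaleE scalerA. Qed.
Fact quot_scale1 : left_id 1 quot_scale.
Proof. by move=> x; rewrite -(quot_projK x) quot_scaleE scale1r. Qed.
Fact quot_scaleDr : right_distributive quot_scale +%R.
Proof.
move=> a x y; rewrite -(quot_projK x) -(quot_projK y).
by rewrite [LHS](congr1 _ (quot_addE _ _)) !quot_scaleE [RHS]quot_addE scalerDr.
Qed.
Fact quot_scaleDl x : {morph quot_scale^~ x : a b / a + b}.
Proof.
move=> a b; rewrite -(quot_projK x) !quot_scaleE [RHS]quot_addE.
by rewrite scalerDl.
Qed.
HB.instance Definition _ := GRing.Zmodule_isLmodule.Build R Q
  quot_scaleA quot_scale1 quot_scaleDr quot_scaleDl.

Fact quot_proj_linear : linear (quot_proj : M -> Q).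
Proof.
by move=> a x y; rewrite -quot_addE -quot_scaleE.
Qed.

Lemma quotient_exists :
  exists (N : lmodType R) (p : {linear M -> N}),
    (forall y, exists x, p x = y) /\ forall x, p x = 0 <-> P x.
Proof.
exists Q, (mk_linear quot_proj_linear); split.
  by move=> y; exists (sval y); apply: quot_projK.
move=> x; rewrite -{2}[x]subr0; exact: (quot_projE x 0).
Qed.

End QuotType.

Section Factor.
Context (R : pzRingType).
Implicit Types M N L : lmodType R.

Lemma lift_inj M N L (i : {linear N -> M}) (f : {linear L -> M}) :
  injective i -> (forall x, exists y, i y = f x) ->
  exists g : {linear L -> N}, forall x, i (g x) = f x.
Proof.
move=> i_inj fP; pose g x := projT1 (cid (fP x)).
have gE x : i (g x) = f x by rewrite /g; case: cid.
have gL : linear g by move=> a x y; apply: i_inj; rewrite linearP !gE linearP.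
by exists (mk_linear gL).
Qed.

Lemma factor_surj M N L (p : {linear M -> N}) (f : {linear M -> L}) :
  (forall y, exists x, p x = y) -> (forall x, p x = 0 -> f x = 0) ->
  exists g : {linear N -> L}, forall x, g (p x) = f x.
Proof.
move=> pP pf; pose g y := f (projT1 (cid (pP y))).
have fE x y : p x = p y -> f x = f y.
  by move=> /eqP; rewrite -subr_eq0 -linearB => /eqP/pf/eqP;
     rewrite linearB subr_eq0 => /eqP.
have gE x : g (p x) = f x by rewrite /g; case: cid => y /= /fE.
have gL : linear g.
  move=> a y z; have [[x <-] [x' <-]] := (pP y, pP z).
  by rewrite -linearP !gE linearP.
by exists (mk_linear gL).
Qed.

Lemma linear_inverse M N (f : {linear M -> N}) :
  bijective f -> exists g : {linear N -> M}, cancel f g /\ cancel g f.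
Proof.
case=> g fK gK.
have gL : linear g by move=> a x y; apply: (can_inj fK); rewrite linearP !gK.
by exists (mk_linear gL).
Qed.

Lemma inj_surj_bij M N (f : {linear M -> N}) :
  injective f -> (forall y, exists x, f x = y) -> bijective f.
Proof.
move=> f_inj fP.
have gK : cancel (fun y => projT1 (cid (fP y))) f by move=> y; case: cid.
by exists (fun y => projT1 (cid (fP y))) => // x; apply: f_inj.
Qed.

Lemma linear_inj0 M N (f : {linear M -> N}) :
  (forall x, f x = 0 -> x = 0) -> injective f.
Proof.
move=> f0 x y /eqP; rewrite -subr_eq0 -linearB => /eqP/f0/eqP.
by rewrite subr_eq0 => /eqP.
Qed.

Lemma isomorphic_sym M N : isomorphic M N -> isomorphic N M.
Proof.
by case=> f /linear_inverse[g [fK gK]]; exists g; exists f.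
Qed.

Lemma isomorphic_trans M N L :
  isomorphic M N -> isomorphic N L -> isomorphic M L.
Proof.
by case=> f fb [g gb]; exists (g \o f : {linear _ -> _}); apply: bij_comp.
Qed.

Lemma isomorphic_refl M : isomorphic M M.
Proof. by exists (idfun : {linear M -> M}); exists idfun. Qed.

Lemma kernel_exists M N (f : {linear M -> N}) :
  exists (K : lmodType R) (i : {linear K -> M}),
    injective i /\ forall x, f x = 0 <-> exists y, i y = x.
Proof.
suff /submodule_exists[K [i iP]] : submodule (fun x => f x = 0) by exists K, i.
split; first exact: linear0.
by move=> a x y fx fy; rewrite linearP fx fy scaler0 addr0.
Qed.

Lemma cokernel_exists M N (f : {linear M -> N}) :
  exists (C : lmodType R) (p : {linear N -> C}),
    (forall y, exists x, p x = y) /\ forall x, p x = 0 <-> exists y, f y = x.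
Proof.
suff /quotient_exists[C [p pP]] : submodule (fun x => exists y, f y = x).
  by exists C, p.
split.
  by exists 0; rewrite linear0.
by move=> a x y [x' <-] [y' <-]; exists (a *: x' + y'); rewrite linearP.
Qed.

Definition pair_linear M N L (f : {linear L -> M}) (g : {linear L -> N}) :
    {linear L -> (M * N)%type} :=
  mk_linear (f := fun x => (f x, g x))
    (fun a x y => congr2 pair (linearP f a x y) (linearP g a x y)).

Fact copair_is_linear M N L (f : {linear M -> L}) (g : {linear N -> L}) :
  linear (fun x : (M * N)%type => f x.1 + g x.2).
Proof. by move=> a x y; rewrite !linearP scalerDr addrACA. Qed.

Definition copair_linear M N L (f : {linear M -> L}) (g : {linear N -> L}) :
    {linear (M * N)%type -> L} := mk_linear (copair_is_linear f g).

Definition inl_linear M N : {linear M -> (M * N)%type} :=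
  pair_linear (idfun : {linear M -> M}) (\0 : {linear M -> N}).
Definition inr_linear M N : {linear N -> (M * N)%type} :=
  pair_linear (\0 : {linear N -> M}) (idfun : {linear N -> N}).
Definition fst_linear M N : {linear (M * N)%type -> M} := fst.
Definition snd_linear M N : {linear (M * N)%type -> N} := snd.

(** The kernel of [f x - g y] in the product. Joint injectivity, the second clause, is what later
    decides equalities in the pullback. *)
Lemma pullback_exists M N L (f : {linear M -> L}) (g : {linear N -> L}) :
  exists (B : lmodType R) (u : {linear B -> M}) (v : {linear B -> N}),
  [/\ forall b, f (u b) = g (v b),
      forall b, u b = 0 -> v b = 0 -> b = 0,
      forall x y, f x = g y -> exists b, u b = x /\ v b = y
    & forall (A : lmodType R) (s : {linear A -> M}) (t : {linear A -> N}),
        (forall a, f (s a) = g (t a)) ->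
        exists h : {linear A -> B}, forall a, u (h a) = s a /\ v (h a) = t a].
Proof.
pose d : {linear (M * N)%type -> L} := copair_linear f (\- g : {linear N -> L}).
have d0 x : d x = 0 <-> f x.1 = g x.2.
  by rewrite /d /=; split=> [/eqP|->]; rewrite ?subrr // subr_eq0 => /eqP.
have [B [i [i_inj iP]]] := kernel_exists d.
exists B, (fst_linear M N \o i : {linear _ -> _}).
exists (snd_linear M N \o i : {linear _ -> _}); split=> /=.
- by move=> b; apply/d0/iP; exists b.
- move=> b b1 b2; apply: i_inj; rewrite linear0.
  by case: (i b) b1 b2 => x y /= -> ->.
- by move=> x y /(d0 (x, y))/iP[b bE]; exists b; rewrite /= bE.
move=> A s t st; have [|h hE] := lift_inj (f := pair_linear s t) i_inj.
  by move=> a; apply/iP/d0/st.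
by exists h => a; rewrite /= hE.
Qed.

End Factor.

(** * Finitely generated modules and add(T) *)

(** Recursion on the list lets inductions peel off one generator at a time, as the chain conditions
    over k require. *)
Fixpoint span (R : pzRingType) (M : lmodType R) (s : seq M) (x : M) : Prop :=
  if s is g :: s' then exists c y, span s' y /\ x = c *: g + y else x = 0.

Section FinitelyGenerated.
Context (R : pzRingType).
Implicit Types M N T X Y : lmodType R.

Lemma span_submodule M (s : seq M) : submodule (span s).
Proof.
elim: s => [|g s [IH0 IHD]] /=; split=> //.
- by move=> a x y -> ->; rewrite scaler0 addr0.
- by exists 0, 0; rewrite scale0r addr0.
move=> a x y [c [x' [sx ->]]] [d [y' [sy ->]]].
exists (a * c + d), (a *: x' + y'); split; first exact: IHD.
by rewrite scalerDr scalerDl scalerA addrACA.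
Qed.

Lemma span_sub M (P : M -> Prop) s x :
  submodule P -> (forall g, g \in s -> P g) -> span s x -> P x.
Proof.
move=> subP; elim: s x => [|g s IH] x /= sP; first by move=> ->; case: subP.
case=> c [y [sy ->]]; case: (subP) => _; apply; first exact: sP (mem_head _ _).
by apply: IH sy => h hs; apply: sP; rewrite inE hs orbT.
Qed.

Lemma mem_span M (s : seq M) g : g \in s -> span s g.
Proof.
elim: s => //= h s IH; rewrite inE => /orP[/eqP ->|/IH sg].
  by exists 1, 0; rewrite scale1r addr0; split=> //; case: (span_submodule s).
by exists 0, g; rewrite scale0r add0r.
Qed.

Lemma span_sum M n (g : 'I_n -> M) x :
  span (codom g) x <-> exists c : 'I_n -> R, x = \sum_(i < n) c i *: g i.
Proof.
split=> [|[c ->]].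
  apply: (span_sub (P := fun x => exists c : 'I_n -> R, x = \sum_i c i *: g i)).
    split.
      by exists (fun=> 0); rewrite big1 // => i _; rewrite scale0r.
    move=> a y z [c ->] [d ->]; exists (fun i => a * c i + d i).
    rewrite scaler_sumr -big_split; apply: eq_bigr => i _.
    by rewrite scalerDl scalerA.
  move=> _ /codomP[i ->]; exists (fun j => (i == j)%:R).
  rewrite (bigD1 i) //= eqxx scale1r big1 ?addr0 // => j.
  by rewrite eq_sym => /negPf ->; rewrite scale0r.
apply: (big_ind (span (codom g))) => [|y z|i _].
- by case: (span_submodule (codom g)).
- exact: (submoduleD (span_submodule _)).
by apply: (submoduleZ (span_submodule _)); apply/mem_span/codom_f.
Qed.

Lemma fg_span M : finitely_generated M <-> exists s : seq M, forall x, span s x.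
Proof.
split=> [[n [g gP]]|[s sP]].
  by exists (codom g) => x; apply/span_sum/gP.
exists (size s), (fun i => tnth (in_tuple s) i) => x.
by apply/span_sum; have := sP x; rewrite codomE map_tnth_enum.
Qed.

Lemma span_map M N (f : {linear M -> N}) s x : span s x -> span (map f s) (f x).
Proof.
elim: s x => [|g s IH] x /=; first by move=> ->; rewrite linear0.
by case=> c [y [/IH sy ->]]; exists c, (f y); rewrite linearP.
Qed.

Lemma fg_surj M N (f : {linear M -> N}) :
  (forall y, exists x, f x = y) -> finitely_generated M -> finitely_generated N.
Proof.
move=> fP /fg_span[s sP]; apply/fg_span; exists (map f s) => y.
by have [x <-] := fP y; apply: span_map.
Qed.

Lemma fg_iso M N : isomorphic M N -> finitely_generated M -> finitely_generated N.
Proof.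
by case=> f [g fK gK]; apply: (@fg_surj _ _ f) => y; exists (g y); rewrite gK.
Qed.

Lemma span_cat M (s1 s2 : seq M) x y :
  span s1 x -> span s2 y -> span (s1 ++ s2) (x + y).
Proof.
elim: s1 x => [|g s IH] x /=; first by move=> ->; rewrite add0r.
case=> c [z [/IH sz ->]] s2y; exists c, (z + y); split; first exact: sz.
by rewrite addrA.
Qed.

Lemma fg_prod M N :
  finitely_generated M -> finitely_generated N -> finitely_generated (M * N)%type.
Proof.
move=> /fg_span[s sP] /fg_span[t tP]; apply/fg_span.
exists (map (inl_linear M N) s ++ map (inr_linear M N) t) => -[x y].
rewrite -[(x, y)]/(x, y) (_ : (x, y) = inl_linear M N x + inr_linear M N y).
  by apply: span_cat; apply: span_map.
by congr pair; rewrite ?addr0 ?add0r.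
Qed.

Definition free_delta n (i : 'I_n) : {ffun 'I_n -> R^o} := [ffun j => (i == j)%:R].

Lemma free_basis n (c : {ffun 'I_n -> R^o}) :
  c = \sum_i (c i : R) *: free_delta i.
Proof.
apply/ffunP => j; rewrite sum_ffunE (bigD1 j) //= !ffunE eqxx.
rewrite big1 ?addr0 => [|i /negPf ij]; first exact: (esym (mulr1 _)).
by rewrite !ffunE ij; apply: mulr0.
Qed.

Fact free_map_linear n M (g : 'I_n -> M) :
  linear (fun c : {ffun 'I_n -> R^o} => \sum_i (c i : R) *: g i).
Proof.
move=> a x y; rewrite scaler_sumr -big_split; apply: eq_bigr => i _.
by rewrite !ffunE [LHS]scalerDl scalerA.
Qed.

Definition free_map n M (g : 'I_n -> M) : {linear {ffun 'I_n -> R^o} -> M} :=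
  mk_linear (free_map_linear g).

Lemma free_mapE n M (f : {linear {ffun 'I_n -> R^o} -> M}) c :
  f c = free_map (fun i => f (free_delta i)) c.
Proof.
rewrite {1}(free_basis c) linear_sum; apply: eq_bigr => i _; exact: linearZ.
Qed.

Lemma fg_free n : finitely_generated {ffun 'I_n -> R^o}.
Proof.
by exists n, (@free_delta n) => x; exists (fun i => x i); apply: free_basis.
Qed.

Lemma projective_free n : projective {ffun 'I_n -> R^o}.
Proof.
move=> M N g f gP.
have [y yP] : {y | forall i, g (y i) = f (free_delta i)}.
  exists (fun i => projT1 (cid (gP (f (free_delta i))))) => i; by case: cid.
exists (free_map y) => x; rewrite [RHS]free_mapE linear_sum.
by apply: eq_bigr => i _; rewrite linearZ yP.
Qed.

Lemma free_cover M : finitely_generated M ->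
  exists n (p : {linear {ffun 'I_n -> R^o} -> M}), forall y, exists x, p x = y.
Proof.
case=> n [g gP]; exists n, (free_map g) => x; have [c ->] := gP x.
by exists [ffun i => c i]; apply: eq_bigr => i _; rewrite ffunE.
Qed.

(** A direct summand without its complement, so that transitivity is plain composition. The kernel
    of [r] recovers a complement. *)
Definition retract X M : Prop :=
  exists (s : {linear X -> M}) (r : {linear M -> X}), forall x, r (s x) = x.

Lemma direct_summandP X M : direct_summand X M <-> retract X M.
Proof.
split=> [[Y [f /linear_inverse[g [fK gK]]]]|[s [r rs]]].
  exists (f \o inl_linear X Y : {linear _ -> _}).
  by exists (fst_linear X Y \o g : {linear _ -> _}) => x; rewrite /= fK.
have [Y [i [i_inj iP]]] := kernel_exists r; exists Y.
have ri y : r (i y) = 0 by apply/iP; exists y.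
exists (copair_linear s i); apply: inj_surj_bij => [|m].
  apply: linear_inj0 => -[x y] /= e0; have := congr1 r e0.
  rewrite linearD rs ri linear0 addr0 => x0; rewrite x0 linear0 add0r in e0.
  by rewrite x0; congr pair; apply: i_inj; rewrite e0 linear0.
have [|y yE] := (iP (m - s (r m))).1; first by rewrite linearB rs subrr.
by exists (r m, y); rewrite /= yE addrC subrK.
Qed.

Lemma retract_trans X Y M : retract X Y -> retract Y M -> retract X M.
Proof.
case=> s [r rs] [s' [r' rs']]; exists (s' \o s : {linear _ -> _}).
by exists (r \o r' : {linear _ -> _}) => x; rewrite /= rs' rs.
Qed.

Lemma retract_iso X M : isomorphic X M -> retract X M.
Proof. by case=> f /linear_inverse[g [fK gK]]; exists f, g. Qed.

Lemma retract_prodl X Y : retract X (X * Y)%type.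
Proof. by exists (inl_linear X Y), (fst_linear X Y). Qed.

Lemma retract_prodr X Y : retract Y (X * Y)%type.
Proof. by exists (inr_linear X Y), (snd_linear X Y). Qed.

Lemma fg_retract X M : retract X M -> finitely_generated M -> finitely_generated X.
Proof. by case=> s [r rs]; apply: (@fg_surj _ _ r) => y; exists (s y). Qed.

(** Membership in add(T) as a decomposition of the identity into maps through T. An additive functor
    preserves such a formula, with no comparison of finite powers. *)
Definition finite_retract T X : Prop :=
  exists s : seq ({linear X -> T} * {linear T -> X}),
    forall x, x = \sum_(p <- s) p.2 (p.1 x).

Fact ffun_pair_linear n X T (q : 'I_n -> {linear X -> T}) :
  linear (fun x => [ffun i => q i x]).
Proof. by move=> a x y; apply/ffunP => i; rewrite !ffunE linearP. Qed.

Fact ffun_copair_linear n X T (j : 'I_n -> {linear T -> X}) :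
  linear (fun f : {ffun 'I_n -> T} => \sum_i j i (f i)).
Proof.
move=> a x y; rewrite scaler_sumr -big_split; apply: eq_bigr => i _.
by rewrite !ffunE linearP.
Qed.

Fact ffun_delta_linear n T (i : 'I_n) :
  linear (fun t : T => [ffun j => t *+ (i == j)] : {ffun 'I_n -> T}).
Proof.
move=> a x y; apply/ffunP => j; rewrite !ffunE.
by case: eqP => _; rewrite ?mulr1n // scaler0 addr0.
Qed.

Fact ffun_proj_linear n T (i : 'I_n) : linear (fun f : {ffun 'I_n -> T} => f i).
Proof. by move=> a x y; rewrite !ffunE. Qed.

Lemma ffun_decomp n T (f : {ffun 'I_n -> T}) :
  f = \sum_i mk_linear (@ffun_delta_linear n T i) (f i).
Proof.
apply/ffunP => j; rewrite sum_ffunE (bigD1 j) //= !ffunE eqxx mulr1n.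
by rewrite big1 ?addr0 // => i /negPf ij; rewrite !ffunE ij.
Qed.

Lemma finite_retractP T X :
  finite_retract T X <-> exists n, retract X {ffun 'I_n -> T}.
Proof.
split=> [[s sP]|[n [s [r rs]]]].
  exists (size s); pose p := tnth (in_tuple s).
  exists (mk_linear (ffun_pair_linear (fun i => (p i).1))).
  exists (mk_linear (ffun_copair_linear (fun i => (p i).2))) => x /=.
  rewrite [RHS]sP [RHS]big_tnth; apply: eq_bigr => i _.
  by rewrite ffunE.
pose q i : {linear X -> T} := mk_linear (@ffun_proj_linear n T i) \o s.
pose j i : {linear T -> X} := r \o mk_linear (@ffun_delta_linear n T i).
exists [seq (q i, j i) | i <- index_enum 'I_n] => x.
by rewrite big_map -{1}(rs x) (ffun_decomp (s x)) linear_sum.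
Qed.

Lemma in_addP T X : in_add T X <-> finite_retract T X.
Proof.
by rewrite finite_retractP; split=> -[n /direct_summandP XT]; exists n.
Qed.

Lemma finite_retract_refl T : finite_retract T T.
Proof.
exists [:: ((idfun : {linear T -> T}), (idfun : {linear T -> T}))] => x.
by rewrite big_seq1.
Qed.

Lemma finite_retract_retract T X Y :
  retract X Y -> finite_retract T Y -> finite_retract T X.
Proof.
case=> s [r rs] [l lP].
exists [seq ((p.1 \o s : {linear _ -> _}), (r \o p.2 : {linear _ -> _}))
  | p : {linear Y -> T} * {linear T -> Y} <- l].
by move=> x; rewrite big_map /= -linear_sum -lP rs.
Qed.

Lemma finite_retract_base T T' X :
  isomorphic T T' -> finite_retract T X -> finite_retract T' X.
Proof.
case=> f /linear_inverse[g [fK gK]] [l lP].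
exists [seq ((f \o p.1 : {linear _ -> _}), (p.2 \o g : {linear _ -> _}))
  | p : {linear X -> T} * {linear T -> X} <- l].
by move=> x; rewrite big_map /= {1}(lP x); apply: eq_bigr => i _; rewrite fK.
Qed.

Lemma finite_retract_free n : finite_retract R^o {ffun 'I_n -> R^o}.
Proof.
apply/finite_retractP; exists n; exists idfun, idfun; by [].
Qed.

Lemma finite_retract_ind (C : lmodType R -> Prop) T X :
    (forall Z, zero_module Z -> C Z) ->
    (forall Y Z, C Y -> C Z -> C (Y * Z)%type) ->
    (forall Y Z, retract Y Z -> C Z -> C Y) ->
  C T -> finite_retract T X -> C X.
Proof.
move=> C0 CM CR CT /finite_retractP[n] /CR; apply.
elim: n => [|n IH]; first by apply: C0 => f; apply/ffunP => -[].
apply: (CR _ (T * {ffun 'I_n -> T})%type); last exact: CM.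
exists (pair_linear (mk_linear (@ffun_proj_linear n.+1 T ord0))
  (mk_linear (ffun_pair_linear
    (fun i => mk_linear (@ffun_proj_linear n.+1 T (lift ord0 i)))))).
pose g (p : (T * {ffun 'I_n -> T})%type) : {ffun 'I_n.+1 -> T} :=
  [ffun i => if unlift ord0 i is Some j then p.2 j else p.1].
have gL : linear g.
  move=> a x y; apply/ffunP => i; rewrite !ffunE.
  by case: unlift => [j|] //; rewrite !ffunE.
exists (mk_linear gL) => f; apply/ffunP => i; rewrite /= /g ffunE /=.
by case: unliftP => [j ->|->]; rewrite ?ffunE.
Qed.

End FinitelyGenerated.

(** * Short exact sequences and Ext^1 *)

Definition short_exact (R : pzRingType) (A B C : lmodType R)
    (i : {linear A -> B}) (p : {linear B -> C}) : Prop :=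
  [/\ injective i, forall z, exists y, p y = z
    & forall y, p y = 0 <-> exists x, i x = y].

(* Ext^1(C, N) = 0, phrased without a projective presentation of C. *)
Definition ext1_eq0 (R : pzRingType) (N C : lmodType R) : Prop :=
  forall (A B : lmodType R) (i : {linear A -> B}) (p : {linear B -> C}),
    short_exact i p ->
    forall f : {linear A -> N}, exists g : {linear B -> N}, forall x, g (i x) = f x.

Section Ext1.
Context (R : pzRingType).
Implicit Types A B C K L M N P Q X Y Z : lmodType R.

Lemma kernel_short_exact B C (p : {linear B -> C}) :
  (forall z, exists y, p y = z) ->
  exists (A : lmodType R) (i : {linear A -> B}), short_exact i p.
Proof. by move=> pP; have [A [i [i_inj iP]]] := kernel_exists p; exists A, i. Qed.

Lemma cokernel_short_exact A B (i : {linear A -> B}) :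
  injective i -> exists (C : lmodType R) (p : {linear B -> C}), short_exact i p.
Proof. by move=> i_inj; have [C [p [pP pE]]] := cokernel_exists i; exists C, p. Qed.

Lemma prod_short_exact A C : short_exact (inl_linear A C) (snd_linear A C).
Proof.
split=> [x y [] //|z|[x y] /=]; first by exists (0, z).
by split=> [->|[x' [_ <-]]] //; exists x.
Qed.

(** The extension of X is pulled back along [r] to one of M, where [f] extends. Since [r s = id],
    the identity and [s p] together map B back into the pullback. *)
Lemma ext1_retract N X M : retract X M -> ext1_eq0 N M -> ext1_eq0 N X.
Proof.
case=> s [r rs] M0 A B i p [i_inj pP ip] f.
have [B' [u [v [uv B'inj B'P B'U]]]] := pullback_exists p r.
have [|i' i'E] := B'U A i (\0 : {linear A -> M}).
  by move=> a; rewrite linear0; apply/ip; exists a.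
have [|g gE] := M0 A B' i' v _ f.
  split=> [a b ab|m|b].
  - by apply: i_inj; rewrite -(i'E a).1 -(i'E b).1 ab.
  - by have [b /B'P[b' [_ b'E]]] := pP (r m); exists b'.
  split=> [vb|[a <-]]; last by rewrite (i'E a).2.
  have [|a aE] := (ip (u b)).1; first by rewrite uv vb linear0.
  exists a; apply/eqP; rewrite -subr_eq0; apply/eqP; apply: B'inj.
    by rewrite linearB (i'E a).1 aE subrr.
  by rewrite linearB (i'E a).2 vb subrr.
have [|t tE] := B'U B (idfun : {linear B -> B}) (s \o p : {linear _ -> _}).
  by move=> b; rewrite /= rs.
exists (g \o t : {linear _ -> _}) => a; rewrite /= -gE; congr (g _).
apply/eqP; rewrite -subr_eq0; apply/eqP; apply: B'inj; rewrite linearB.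
  by rewrite (tE _).1 (i'E _).1 subrr.
have pia : p (i a) = 0 by apply/ip; exists a.
by rewrite (tE _).2 (i'E _).2 /= pia linear0 subrr.
Qed.

(** A section [s] of [p] makes [id - s p] a retraction of B onto A. *)
Lemma ext1_projective N P : projective P -> ext1_eq0 N P.
Proof.
move=> Pproj A B i p [i_inj pP ip] f.
have [s sE] := Pproj B P p idfun pP.
pose d : {linear B -> B} := idfun \- (s \o p : {linear _ -> _}).
have [|t tE] := lift_inj (f := d) i_inj.
  by move=> b; apply/ip; rewrite /d /= linearB sE subrr.
exists (f \o t : {linear _ -> _}) => x; congr (f _); apply: i_inj.
have pix : p (i x) = 0 by apply/ip; exists x.
by rewrite tE /d /= pix linear0 subr0.
Qed.

(* Given 0 -> X -> Y -> B -> 0, a map on X extends first to the preimage of A in Y,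
   then to Y. *)
Lemma ext1_extension N A B C (i : {linear A -> B}) (p : {linear B -> C}) :
  short_exact i p -> ext1_eq0 N A -> ext1_eq0 N C -> ext1_eq0 N B.
Proof.
move=> [i_inj pP ip] A0 C0 X Y j q [j_inj qP jq] f.
have [Y' [u [v [uv Y'inj Y'P Y'U]]]] := pullback_exists q i.
have u_inj : injective u.
  apply: linear_inj0 => y u0; apply: Y'inj => //.
  by apply: i_inj; rewrite -uv u0 !linear0.
have [|j' j'E] := Y'U X j (\0 : {linear X -> A}).
  by move=> a; rewrite linear0; apply/jq; exists a.
have [|g gE] := A0 X Y' j' v _ f.
  split=> [a b ab|m|y].
  - by apply: j_inj; rewrite -(j'E a).1 -(j'E b).1 ab.
  - by have [y /Y'P[y' [_ y'E]]] := qP (i m); exists y'.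
  split=> [vy|[a <-]]; last by rewrite (j'E a).2.
  have [|a aE] := (jq (u y)).1; first by rewrite uv vy linear0.
  by exists a; apply: u_inj; rewrite (j'E a).1.
have [|h hE] := C0 Y' Y u (p \o q : {linear _ -> _}) _ g.
  split=> // [z|y].
    by have [b <-] := pP z; have [y <-] := qP b; exists y.
  split=> [/ip[a /esym/Y'P[y' [y'E _]]]|[y' <-]]; first by exists y'.
  by rewrite /= uv; apply/ip; exists (v y').
by exists h => x; rewrite -gE -(j'E x).1 hE.
Qed.

(** The part Hom(B, N) -> Hom(A, N) -> Ext^1(C, N) -> Ext^1(B, N) of the long exact sequence. The
    extension Y of C is pulled back to B, [f] is extended there, and the result is corrected so that
    it descends to Y. *)
Lemma ext1_cokernel N A B C (i : {linear A -> B}) (p : {linear B -> C}) :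
    short_exact i p -> ext1_eq0 N B ->
    (forall f : {linear A -> N}, exists g : {linear B -> N}, forall x, g (i x) = f x) ->
  ext1_eq0 N C.
Proof.
move=> [i_inj pP ip] B0 extA X Y j q [j_inj qP jq] f.
have [Y' [u [v [uv Y'inj Y'P Y'U]]]] := pullback_exists q p.
have [|j' j'E] := Y'U X j (\0 : {linear X -> B}).
  by move=> a; rewrite linear0; apply/jq; exists a.
have [|f' f'E] := B0 X Y' j' v _ f.
  split=> [a b ab|m|y].
  - by apply: j_inj; rewrite -(j'E a).1 -(j'E b).1 ab.
  - by have [y /Y'P[y' [_ y'E]]] := qP (p m); exists y'.
  split=> [vy|[a <-]]; last by rewrite (j'E a).2.
  have [|a aE] := (jq (u y)).1; first by rewrite uv vy linear0.
  exists a; apply/eqP; rewrite -subr_eq0; apply/eqP; apply: Y'inj; rewrite linearB.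
    by rewrite (j'E a).1 aE subrr.
  by rewrite (j'E a).2 vy subrr.
(* [k] embeds A as the kernel of the projection [u] onto Y. Extending [f' k] to a map [h] on B gives
   the correction: [f' - h v] vanishes on this kernel and is unchanged on X, where [v] is 0. *)
have [|k kE] := Y'U A (\0 : {linear A -> Y}) i.
  by move=> a; rewrite linear0; apply/esym/ip; exists a.
have [h hE] := extA (f' \o k : {linear _ -> _}).
have uP y : exists y', u y' = y.
  by have [b /esym/Y'P[y' [y'E _]]] := pP (q y); exists y'.
have [|g gE] := factor_surj (f := f' \- (h \o v : {linear _ -> _})) uP.
  move=> y uy; have [|a aE] := (ip (v y)).1; first by rewrite -uv uy linear0.
  have -> : y = k a.
    apply/eqP; rewrite -subr_eq0; apply/eqP; apply: Y'inj; rewrite linearB.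
      by rewrite uy (kE a).1 subrr.
    by rewrite (kE a).2 aE subrr.
  by rewrite /= (kE a).2 hE /= subrr.
exists g => x; rewrite -(j'E x).1 gE /= f'E (j'E x).2.
by rewrite linear0 subr0.
Qed.

Lemma ext1_presentation N K P C (i : {linear K -> P}) (p : {linear P -> C}) :
    projective P -> short_exact i p ->
    (forall f : {linear K -> N}, exists g : {linear P -> N}, forall x, g (i x) = f x) ->
  ext1_eq0 N C.
Proof.
by move=> Pproj ip; apply: ext1_cokernel ip (@ext1_projective _ _ Pproj).
Qed.

Lemma projective_retract X P : retract X P -> projective P -> projective X.
Proof.
case=> s [r rs] Pproj M N g f gP.
have [h hE] := Pproj M N g (f \o r : {linear _ -> _}) gP.
by exists (h \o s : {linear _ -> _}) => x; rewrite /= hE /= rs.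
Qed.

Lemma projective_prod P Q : projective P -> projective Q -> projective (P * Q)%type.
Proof.
move=> Pproj Qproj M N g f gP.
have [h hE] := Pproj M N g (f \o inl_linear P Q : {linear _ -> _}) gP.
have [k kE] := Qproj M N g (f \o inr_linear P Q : {linear _ -> _}) gP.
exists (copair_linear h k) => -[x y] /=; rewrite linearD hE kE /= -linearD.
by congr (f (_, _)); rewrite ?addr0 ?add0r.
Qed.

Lemma projective_split A B P (i : {linear A -> B}) (p : {linear B -> P}) :
  short_exact i p -> projective P ->
  isomorphic (A * P)%type B.
Proof.
move=> [i_inj pP ip] Pproj; have [s sE] := Pproj B P p idfun pP.
exists (copair_linear i s); apply: inj_surj_bij => [|b].
  apply: linear_inj0 => -[x y] /= e0; have := congr1 p e0.
  have pix : p (i x) = 0 by apply/ip; exists x.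
  rewrite linearD sE linear0 pix add0r /= => y0; rewrite y0 linear0 addr0 in e0.
  by rewrite y0; congr pair; apply: i_inj; rewrite e0 linear0.
have [|a aE] := (ip (b - s (p b))).1; first by rewrite linearB sE subrr.
by exists (a, p b); rewrite /= aE subrK.
Qed.

Lemma projective_extension A B C (i : {linear A -> B}) (p : {linear B -> C}) :
  short_exact i p -> projective A -> projective C -> projective B.
Proof.
move=> ip Aproj Cproj.
apply: (projective_retract _ (projective_prod Aproj Cproj)).
by apply/retract_iso/isomorphic_sym/(projective_split ip).
Qed.

(** * Schanuel's lemma and syzygies *)

Definition presents P M K : Prop :=
  projective P /\
  exists (i : {linear K -> P}) (p : {linear P -> M}), short_exact i p.

Definition first_syzygy M K : Prop := exists P, presents P M K.

Definition stably_isomorphic M N : Prop :=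
  exists P Q : lmodType R,
    [/\ projective P, projective Q & isomorphic (M * P)%type (N * Q)%type].

Lemma isomorphic_prod M M' N N' :
  isomorphic M M' -> isomorphic N N' -> isomorphic (M * N)%type (M' * N')%type.
Proof.
case=> f [f' fK f'K] [g [g' gK g'K]].
exists (pair_linear (f \o fst_linear M N : {linear _ -> _})
                    (g \o snd_linear M N : {linear _ -> _})).
by exists (fun x => (f' x.1, g' x.2)) => -[x y] /=; rewrite ?fK ?gK ?f'K ?g'K.
Qed.

Lemma isomorphic_prodC M N : isomorphic (M * N)%type (N * M)%type.
Proof.
exists (pair_linear (snd_linear M N) (fst_linear M N)).
by exists (fun x => (x.2, x.1)) => -[].
Qed.

Lemma isomorphic_prodA M N L :
  isomorphic (M * (N * L))%type ((M * N) * L)%type.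
Proof.
exists (pair_linear
  (pair_linear (fst_linear M (N * L)%type)
     (fst_linear N L \o snd_linear M (N * L)%type : {linear _ -> _}))
  (snd_linear N L \o snd_linear M (N * L)%type : {linear _ -> _})).
by exists (fun x => (x.1.1, (x.1.2, x.2))) => [[x [y z]]|[[x y] z]].
Qed.

Lemma projective_zero Z : zero_module Z -> projective Z.
Proof.
move=> Z0 M N g f gP; exists (\0 : {linear Z -> M}) => x.
by rewrite (Z0 x) !linear0.
Qed.

Lemma zero_module_exists : exists Z : lmodType R, zero_module Z.
Proof. by exists {ffun 'I_0 -> R^o} => f; apply/ffunP => -[]. Qed.

Lemma isomorphic_stably M N : isomorphic M N -> stably_isomorphic M N.
Proof.
move=> MN; have [Z /projective_zero Zp] := zero_module_exists; exists Z, Z.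
by split=> //; apply: isomorphic_prod => //; apply: isomorphic_refl.
Qed.

Lemma short_exact_iso A B C C' (i : {linear A -> B}) (p : {linear B -> C})
    (f : {linear C -> C'}) :
  bijective f -> short_exact i p -> short_exact i (f \o p : {linear _ -> _}).
Proof.
case=> g fK gK [i_inj pP ip]; split=> // [z|y].
  by have [y yE] := pP (g z); exists y; rewrite /= yE gK.
by rewrite -ip /=; split=> [e0|->]; rewrite ?linear0 // -[p y]fK e0 -(linear0 f) fK.
Qed.

Lemma presents_iso P M M' K :
  isomorphic M M' -> presents P M K -> presents P M' K.
Proof.
case=> f fb [Pp [i [p ip]]]; split=> //; exists i, (f \o p : {linear _ -> _}).
exact: short_exact_iso.
Qed.

Lemma presents_prod_projective P Q M K :
  projective Q -> presents P M K -> presents (P * Q)%type (M * Q)%type K.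
Proof.
move=> Qp [Pp [i [p [i_inj pP ip]]]]; split; first exact: projective_prod.
exists (inl_linear P Q \o i : {linear _ -> _}).
exists (pair_linear (p \o fst_linear P Q : {linear _ -> _}) (snd_linear P Q)).
split=> [x y [] /i_inj //|[z y]|[x y] /=].
  by have [x <-] := pP z; exists (x, y).
split=> [[/ip[k <-] <-]|[k [<- <-]]]; first by exists k.
by congr pair; apply/ip; exists k.
Qed.

(** Both projections from the pullback of [p] and [p'] split, with kernels K and K'. [half] treats
    one of them and takes the pullback properties as hypotheses, so that the roles can be
    exchanged. *)
Lemma schanuel P P' M K K' :
  presents P M K -> presents P' M K' -> isomorphic (K * P')%type (K' * P)%type.
Proof.
move=> [Pp [i [p [i_inj pP ip]]]] [P'p [i' [p' [i'_inj p'P ip']]]].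
have half L L' Q Q' (j : {linear L -> Q}) (q : {linear Q -> M})
    (q' : {linear Q' -> M}) B (u : {linear B -> Q}) (v : {linear B -> Q'}) :
    short_exact j q -> (forall z, exists y, q' y = z) -> projective Q' ->
    (forall b, q (u b) = q' (v b)) ->
    (forall b, u b = 0 -> v b = 0 -> b = 0) ->
    (forall x y, q x = q' y -> exists b, u b = x /\ v b = y) ->
    (forall A (s : {linear A -> Q}) (t : {linear A -> Q'}),
        (forall a, q (s a) = q' (t a)) ->
        exists h : {linear A -> B}, forall a, u (h a) = s a /\ v (h a) = t a) ->
    isomorphic (L * Q')%type B.
  move=> [j_inj qP jq] q'P Q'p uv Binj BP BU.
  have [|k kE] := BU L j (\0 : {linear L -> Q'}).
    by move=> a; rewrite linear0; apply/jq; exists a.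
  apply: (@projective_split _ _ _ k v) => //; split=> [a b ab|y|b].
  - by apply: j_inj; rewrite -(kE a).1 -(kE b).1 ab.
  - by have [x /BP[b [_ bE]]] := qP (q' y); exists b.
  split=> [vb|[a <-]]; last by rewrite (kE a).2.
  have [|a aE] := (jq (u b)).1; first by rewrite uv vb linear0.
  exists a; apply/eqP; rewrite -subr_eq0; apply/eqP; apply: Binj; rewrite linearB.
    by rewrite (kE a).1 aE subrr.
  by rewrite (kE a).2 vb subrr.
have [B [u [v [uv Binj BP BU]]]] := pullback_exists p p'.
apply: (@isomorphic_trans _ _ B); first exact: (half _ K' _ _ i p p' _ u v).
apply: isomorphic_sym; apply: (half _ K _ _ i' p' p _ v u) => //.
- by move=> b vb ub; apply: Binj.
- by move=> x y /esym/BP[b [bx by_]]; exists b.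
- move=> A s t st; have [|h hE] := BU A t s; first by move=> a; rewrite st.
  by exists h => a; have [] := hE a.
Qed.

Lemma first_syzygy_stable M M' K K' :
  stably_isomorphic M M' -> first_syzygy M K -> first_syzygy M' K' ->
  stably_isomorphic K K'.
Proof.
move=> [Q [Q' [Qp Q'p MM']]] [P /(presents_prod_projective Qp)].
move=> /(presents_iso MM') K1 [P' /(presents_prod_projective Q'p) K2].
exists (P' * Q')%type, (P * Q)%type; split; first by case: K2.
  by case: K1.
exact: schanuel K1 K2.
Qed.

(** A relation, since a syzygy depends on the presentations chosen; only its stable class is
    determined. The projectives involved may be infinitely generated, as in [proj_resolution]. *)
Fixpoint syzygy n M K : Prop :=
  if n is m.+1 then exists K1, first_syzygy M K1 /\ syzygy m K1 K else isomorphic M K.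

Lemma syzygy_stable n M M' K K' :
  stably_isomorphic M M' -> syzygy n M K -> syzygy n M' K' -> stably_isomorphic K K'.
Proof.
elim: n M M' => [|n IH] M M' /=.
  move=> [Q [Q' [Qp Q'p MM']]] MK M'K'; exists Q, Q'; split=> //.
  apply: (@isomorphic_trans _ _ (M * Q)%type).
    by apply: isomorphic_prod (isomorphic_refl _); apply: isomorphic_sym.
  by apply: isomorphic_trans MM' _; apply: isomorphic_prod (isomorphic_refl _).
by move=> MM' [L [ML LK]] [L' [M'L' L'K']];
   apply: IH LK L'K'; apply: first_syzygy_stable MM' ML M'L'.
Qed.

Lemma syzygyS_last n M K : syzygy n.+1 M K ->
  exists K', syzygy n M K' /\ first_syzygy K' K.
Proof.
elim: n M => [|n IH] M.
  move=> [K1 [[P MK1] K1K]]; exists M; split; first exact: isomorphic_refl.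
  exists P; case: MK1 => Pp [i [p [i_inj pP ip]]]; split=> //.
  have [f fb] := isomorphic_sym K1K; have [g fK gK] := fb.
  exists (i \o f : {linear _ -> _}), p; split=> // [x y /i_inj|y].
    exact: can_inj fK _ _.
  by rewrite ip; split=> -[x <-]; [exists (g x)|exists (f x)]; rewrite /= ?gK.
move=> [K1 [MK1 /IH[K' [K1K' K'K]]]]; exists K'; split=> //.
by exists K1.
Qed.

End Ext1.

(** * Classes of modules defined by their syzygies *)

Definition noetherian (R : pzRingType) : Prop :=
  forall (M N : lmodType R) (i : {linear N -> M}),
    injective i -> finitely_generated M -> finitely_generated N.

(** What the dimension shifts below require of a class. The two instances are the projectives and
    the modules with Ext^1(-, N) = 0. Unlike in the usual notion, kernels of surjections are left
    out, since vanishing of Ext^1 alone does not pass to them. *)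
Record resolving (R : pzRingType) (CC : lmodType R -> Prop) : Prop := Resolving {
  resolving_projective : forall P, projective P -> CC P;
  resolving_extension : forall (A B C : lmodType R) (i : {linear A -> B})
    (p : {linear B -> C}), short_exact i p -> CC A -> CC C -> CC B;
  resolving_retract : forall X M, retract X M -> CC M -> CC X }.

Lemma resolving_ext1 (R : pzRingType) (N : lmodType R) : resolving (ext1_eq0 N).
Proof.
split=> [P|A B C i p|X M]; [exact: ext1_projective|exact: ext1_extension|].
exact: ext1_retract.
Qed.

Lemma resolving_proj (R : pzRingType) : resolving (@projective R).
Proof.
by split=> // [A B C i p|X M]; [exact: projective_extension|exact: projective_retract].
Qed.

(** For the class of projectives this is projective dimension at most n; for [ext1_eq0 N] it is
    Ext^(n+1)(M, N) = 0, whence the shift by one throughout. *)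
Definition syzygies_in (R : pzRingType) n (CC : lmodType R -> Prop) (M : lmodType R) :=
  forall K, syzygy n M K -> CC K.

Section SyzygyClasses.
Context (R : pzRingType) (Rnoeth : noetherian R).
Implicit Types A B C K L M N P Q X Y Z : lmodType R.
Local Notation fg := finitely_generated.

Lemma short_exact_fg A B C (i : {linear A -> B}) (p : {linear B -> C}) :
  short_exact i p -> fg B -> fg A /\ fg C.
Proof.
by case=> i_inj pP _ fgB; split; [apply: Rnoeth i_inj fgB|apply: fg_surj pP fgB].
Qed.

Lemma fg_presents M : fg M ->
  exists n K, [/\ fg K & presents {ffun 'I_n -> R^o} M K].
Proof.
move=> /free_cover[n [p pP]]; have [K [i ip]] := kernel_short_exact pP.
exists n, K; split; first by case: (short_exact_fg ip) => //; apply: fg_free.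
by split; [apply: projective_free|exists i, p].
Qed.

Lemma syzygy_exists n M : fg M -> exists K, fg K /\ syzygy n M K.
Proof.
elim: n M => [|n IH] M fgM; first by exists M; split=> //; apply: isomorphic_refl.
have [m [L [/IH[K [fgK LK]] ML]]] := fg_presents fgM.
by exists K; split=> //; exists L; split=> //; exists {ffun 'I_m -> R^o}.
Qed.

(** The presentation of C lifts through [p] to B; added to that of A, it covers B. *)
Lemma horseshoe A B C (i : {linear A -> B}) (p : {linear B -> C}) PA PC KA KC :
    short_exact i p -> presents PA A KA -> presents PC C KC ->
  exists KB, presents (PA * PC)%type B KB /\
    exists (j : {linear KA -> KB}) (q : {linear KB -> KC}), short_exact j q.
Proof.
move=> [i_inj pP ip] [PAp [a [a' [a_inj a'P aE]]]] [PCp [c [c' [c_inj c'P cE]]]].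
have [l lE] := PCp B C p c' pP.
pose d : {linear (PA * PC)%type -> B} := copair_linear (i \o a' : {linear _ -> _}) l.
have pi0 x : p (i x) = 0 by apply/ip; exists x.
have dP z : exists y, d y = z.
  have [y yE] := c'P (p z).
  have [|x xE] := (ip (z - l y)).1; first by rewrite linearB lE yE subrr.
  have [w wE] := a'P x; exists (w, y).
  by rewrite /d /= wE xE subrK.
have [KB [k [k_inj _ kE]]] := kernel_short_exact dP.
exists KB; split.
  by split; [apply: projective_prod|exists k, d].
have [|j jE] := lift_inj (f := inl_linear PA PC \o a : {linear _ -> _}) k_inj.
  move=> x; apply/kE; rewrite /d /= linear0 addr0 (_ : a' (a x) = 0) ?linear0 //.
  by apply/aE; exists x.
have [|q qE] := lift_inj (f := snd_linear PA PC \o k : {linear _ -> _}) c_inj.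
  move=> x; apply/cE; have /kE : exists y, k y = k x by exists x.
  by rewrite /d /= => /(congr1 p); rewrite linearD pi0 add0r lE linear0.
exists j, q; split=> [x y xy|z|y].
- by apply: a_inj; have := jE y; rewrite -xy jE => -[].
- have [|x xE] := (ip (l (c z))).1; first by rewrite lE; apply/cE; exists z.
  have [w wE] := a'P x.
  have [|y yE] := (kE (- w, c z)).1; first by rewrite /d /= !linearN wE xE addNr.
  by exists y; apply: c_inj; rewrite qE /= yE.
split=> [qy|[x <-]]; last by apply: c_inj; rewrite qE /= jE /= linear0.
have k2 : (k y).2 = 0 by have := qE y; rewrite qy linear0 /=.
have : d (k y) = 0 by apply/kE; exists y.
rewrite /d /= k2 linear0 addr0 => /eqP; rewrite -(linear0 i) => /eqP/i_inj/aE[x xE].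
by exists x; apply: k_inj; rewrite jE /= xE; case: (k y) k2 => u v /= ->.
Qed.

(** With a lift [l] of P -> C to B, the map [i + l] covers B and has kernel K. This rotation makes A
    a factor of the middle term of an extension. *)
Lemma kernel_extension A B C (i : {linear A -> B}) (p : {linear B -> C}) P K :
    short_exact i p -> presents P C K ->
  exists (j : {linear K -> (A * P)%type}) (q : {linear (A * P)%type -> B}),
    short_exact j q.
Proof.
move=> [i_inj pP ip] [Pp [k [c [k_inj cP kE]]]].
have [l lE] := Pp B C p c pP.
have pi0 x : p (i x) = 0 by apply/ip; exists x.
pose q : {linear (A * P)%type -> B} := copair_linear i l.
have [|m mE] := lift_inj (f := \- (l \o k : {linear _ -> _})) i_inj.
  move=> x; apply/ip; rewrite /= linearN lE (_ : c _ = 0) ?oppr0 //.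
  by apply/kE; exists x.
exists (pair_linear m k), q; split=> [x y []|z|[x y]].
- by move=> _ /k_inj.
- have [y yE] := cP (p z).
  have [|x xE] := (ip (z - l y)).1; first by rewrite linearB lE yE subrr.
  by exists (x, y); rewrite /q /= xE subrK.
rewrite /q /=; split=> [e0|[w [<- <-]]]; last by rewrite mE /= addNr.
have /kE[w wE] : c y = 0 by have := congr1 p e0; rewrite linearD pi0 add0r lE linear0.
exists w; rewrite wE; congr pair; apply: i_inj; rewrite mE /= wE.
by apply/eqP; rewrite eq_sym -addr_eq0 e0.
Qed.

(** The other rotation: the kernel K of P -> B -> C maps onto A with kernel L, so a syzygy of the
    cokernel C is an extension of A by L. *)
Lemma cokernel_extension A B C (i : {linear A -> B}) (p : {linear B -> C}) P L :
    short_exact i p -> presents P B L ->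
  exists K, presents P C K /\
    exists (j : {linear L -> K}) (q : {linear K -> A}), short_exact j q.
Proof.
move=> [i_inj pP ip] [Pp [l [b [l_inj bP lE]]]].
have cP z : exists y, (p \o b : {linear _ -> _}) y = z.
  by have [y <-] := pP z; have [x <-] := bP y; exists x.
have [K [k [k_inj _ kE]]] := kernel_short_exact cP.
exists K; split; first by split=> //; exists k, (p \o b : {linear _ -> _}).
have [|j jE] := lift_inj (f := l) k_inj.
  by move=> x; apply/kE; rewrite /= (_ : b _ = 0) ?linear0 //; apply/lE; exists x.
have [|q qE] := lift_inj (f := b \o k : {linear _ -> _}) i_inj.
  by move=> x; apply/ip/(kE (k x)); exists x.
exists j, q; split=> [x y xy|z|y].
- by apply: l_inj; rewrite -!jE xy.
- have [w wE] := bP (i z).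
  have [|y yE] := (kE w).1; first by rewrite /= wE; apply/ip; exists z.
  by exists y; apply: i_inj; rewrite qE /= yE.
split=> [qy|[x <-]].
  have /lE[x xE] : b (k y) = 0 by have := qE y; rewrite qy linear0 /=.
  by exists x; apply: k_inj; rewrite jE.
by apply: i_inj; rewrite qE /= jE linear0; apply/lE; exists x.
Qed.

Section Class.
Context (CC : lmodType R -> Prop) (resCC : resolving CC).

Lemma resolving_prod M N : CC M -> CC N -> CC (M * N)%type.
Proof. exact: (resolving_extension resCC (prod_short_exact M N)). Qed.

Lemma resolving_stable M M' : stably_isomorphic M M' -> CC M -> CC M'.
Proof.
move=> [P [Q [Pp _ MM']]] CM.
apply: (resolving_retract resCC (retract_prodl M' Q)).
apply: (resolving_retract resCC (retract_iso (isomorphic_sym MM'))).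
by apply: resolving_prod => //; apply: (resolving_projective resCC).
Qed.

Lemma syzygies_in0 M : syzygies_in 0 CC M <-> CC M.
Proof.
split=> [|CM K /isomorphic_sym/retract_iso KM]; first by apply; apply: isomorphic_refl.
exact: (resolving_retract resCC KM).
Qed.

(** By Schanuel's lemma, one syzygy in the class brings in all the others. *)
Lemma syzygies_in_any n M K : fg M -> syzygy n M K -> CC K -> syzygies_in n CC M.
Proof.
move=> fgM MK CK K' MK'; apply: (resolving_stable _ CK).
by apply: syzygy_stable MK MK'; apply/isomorphic_stably/isomorphic_refl.
Qed.

Lemma syzygies_in_stable n M M' :
  fg M -> stably_isomorphic M M' -> syzygies_in n CC M -> syzygies_in n CC M'.
Proof.
move=> fgM MM' CM K' M'K'; have [K [_ MK]] := syzygy_exists n fgM.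
exact: resolving_stable (syzygy_stable MM' MK M'K') (CM K MK).
Qed.

Lemma syzygies_in_presents n P M K :
  presents P M K -> syzygies_in n.+1 CC M -> syzygies_in n CC K.
Proof. by move=> MK CM L KL; apply: CM; exists K; split=> //; exists P. Qed.

Lemma syzygies_inS n P M K :
  fg K -> presents P M K -> syzygies_in n CC K -> syzygies_in n.+1 CC M.
Proof.
move=> fgK MK CK L [K' [MK' K'L]]; move: L K'L.
apply: (syzygies_in_stable fgK _ CK).
apply: (@first_syzygy_stable _ M M) MK'; last by exists P.
exact/isomorphic_stably/isomorphic_refl.
Qed.

Lemma syzygies_in_extension n A B C (i : {linear A -> B}) (p : {linear B -> C}) :
  short_exact i p -> fg A -> fg C ->
  syzygies_in n CC A -> syzygies_in n CC C -> syzygies_in n CC B.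
Proof.
elim: n A B C i p => [|n IH] A B C i p ip fgA fgC.
  rewrite !syzygies_in0; exact: (resolving_extension resCC ip).
move=> CA CCC.
have [a [KA [fgKA AK]]] := fg_presents fgA; have [c [KC [fgKC CK]]] := fg_presents fgC.
have [KB [BK [j [q jq]]]] := horseshoe ip AK CK.
have fgKB : fg KB.
  case: BK => _ [k [d [k_inj _ _]]]; apply: (Rnoeth k_inj).
  by apply: fg_prod; apply: fg_free.
apply: (syzygies_inS fgKB BK); apply: (IH _ _ _ _ _ jq) => //.
  exact: syzygies_in_presents AK CA.
exact: syzygies_in_presents CK CCC.
Qed.

Lemma syzygies_in_projective n P : fg P -> projective P -> syzygies_in n CC P.
Proof.
elim: n P => [|n IH] P fgP Pp.
  by apply/syzygies_in0; apply: (resolving_projective resCC).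
have [m [K [fgK PK]]] := fg_presents fgP; apply: (syzygies_inS fgK PK).
apply: IH fgK _; case: PK => Fp [i [p ip]].
apply: (projective_retract _ Fp).
apply: (retract_trans (retract_prodl K P)).
exact: retract_iso (projective_split ip Pp).
Qed.

Lemma syzygies_in_iso n M M' :
  fg M -> isomorphic M M' -> syzygies_in n CC M -> syzygies_in n CC M'.
Proof. by move=> fgM /isomorphic_stably; apply: syzygies_in_stable. Qed.

(** A product of syzygies is a syzygy of the product, so the factor is carried down to n = 0, where
    closure under retracts applies. *)
Lemma syzygies_in_factor n M N : fg M -> fg N ->
  syzygies_in n CC (M * N)%type -> syzygies_in n CC M.
Proof.
elim: n M N => [|n IH] M N fgM fgN.
  by rewrite !syzygies_in0; apply: (resolving_retract resCC (retract_prodl M N)).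
have [m [K [fgK MK]]] := fg_presents fgM; have [l [L [fgL NL]]] := fg_presents fgN.
move=> CMN; apply: (syzygies_inS fgK MK); apply: (IH K L) => //.
have [KL [MNKL [j [q jq]]]] := horseshoe (prod_short_exact M N) MK NL.
apply: (@syzygies_in_presents n ({ffun 'I_m -> R^o} * {ffun 'I_l -> R^o})%type
          (M * N)%type) => //.
case: MK NL => Fp [i [p [i_inj pP ip]]] [Gp [i' [p' [i'_inj p'P ip']]]].
split; first exact: projective_prod.
exists (pair_linear (i \o fst_linear K L : {linear _ -> _})
                    (i' \o snd_linear K L : {linear _ -> _})).
exists (pair_linear (p \o fst_linear _ _ : {linear _ -> _})
                    (p' \o snd_linear _ _ : {linear _ -> _})).
split=> [[x y] [z w] [/i_inj -> /i'_inj ->] //|[x y]|[x y] /=].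
  by have [z <-] := pP x; have [w <-] := p'P y; exists (z, w).
split=> [[/ip[z <-] /ip'[w <-]]|[[z w] [<- <-]]]; first by exists (z, w).
by congr pair; [apply/ip; exists z|apply/ip'; exists w].
Qed.

Lemma syzygies_in_retract n X M :
  retract X M -> fg M -> syzygies_in n CC M -> syzygies_in n CC X.
Proof.
move=> XM fgM CM; have fgX := fg_retract XM fgM.
have [Y XYM] := (direct_summandP X M).2 XM.
have fgY : fg Y.
  exact: fg_retract (retract_prodr X Y) (fg_iso (isomorphic_sym XYM) fgM).
apply: (syzygies_in_factor fgX fgY).
exact: syzygies_in_iso fgM (isomorphic_sym XYM) CM.
Qed.

(** For Ext: Ext^(n+1)(B) = 0 and Ext^(n+2)(C) = 0 give Ext^(n+1)(A) = 0, since A is a factor of an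
    extension of B by a syzygy of C. *)
Lemma syzygies_in_kernel n A B C (i : {linear A -> B}) (p : {linear B -> C}) :
  short_exact i p -> fg B ->
  syzygies_in n CC B -> syzygies_in n.+1 CC C -> syzygies_in n CC A.
Proof.
move=> ip fgB CB CCC; have [fgA fgC] := short_exact_fg ip fgB.
have [m [K [fgK CK]]] := fg_presents fgC.
have [j [q jq]] := kernel_extension ip CK.
apply: (syzygies_in_factor fgA (fg_free R m)).
apply: (syzygies_in_extension jq) => //.
exact: syzygies_in_presents CK CCC.
Qed.

(** For Ext: Ext^(n+1)(A) = 0 and Ext^(n+2)(B) = 0 give Ext^(n+2)(C) = 0, since a syzygy of C is an
    extension of A by a syzygy of B. *)
Lemma syzygies_in_cokernel n A B C (i : {linear A -> B}) (p : {linear B -> C}) :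
  short_exact i p -> fg B ->
  syzygies_in n CC A -> syzygies_in n.+1 CC B -> syzygies_in n.+1 CC C.
Proof.
move=> ip fgB CA CB; have [fgA fgC] := short_exact_fg ip fgB.
have [m [L [fgL BL]]] := fg_presents fgB.
have [K [CK [j [q jq]]]] := cokernel_extension ip BL.
have fgK : fg K.
  by case: CK => _ [k [c [k_inj _ _]]]; apply: (Rnoeth k_inj (fg_free R m)).
apply: (syzygies_inS fgK CK); apply: (syzygies_in_extension jq) => //.
exact: syzygies_in_presents BL CB.
Qed.

End Class.

End SyzygyClasses.

(** * Projective dimension and Ext-orthogonality *)

Section Resolutions.
Context (R : pzRingType).
Implicit Types A B C K L M N P Q X Y Z : lmodType R.

Section Tail.
Context (M : lmodType R) (P : proj_resolution M) (K : lmodType R).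
Context (i : {linear K -> res_obj P 0%N}) (e : {linear res_obj P 1%N -> K}).
Hypothesis ip : short_exact i (res_aug P).
Hypothesis ie : forall x, i (e x) = res_diff P 0%N x.

Fact tail_aug_surj x : exists y, e y = x.
Proof.
case: ip => i_inj _ iE; have /iE/res_exact0[y yE] : exists y, i y = i x by exists x.
by exists y; apply: i_inj; rewrite ie.
Qed.

Fact tail_exact0 y : e y = 0 <-> exists z, res_diff P 1%N z = y.
Proof.
case: ip => i_inj _ _; rewrite -res_exact -ie.
by split=> [->|]; rewrite ?linear0 // -[in X in _ = X -> _](linear0 i) => /i_inj.
Qed.

Definition tail_resolution : proj_resolution K :=
  @ProjResolution R K (fun j => res_obj P j.+1) (fun j => res_diff P j.+1) e
    (fun j => @res_proj _ _ P j.+1) tail_aug_surj tail_exact0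
    (fun j => @res_exact _ _ P j.+1).

End Tail.

Lemma tail_resolution_exists M (P : proj_resolution M) :
  exists (K : lmodType R) (i : {linear K -> res_obj P 0%N})
    (e : {linear res_obj P 1%N -> K}),
    short_exact i (res_aug P) /\ forall x, i (e x) = res_diff P 0%N x.
Proof.
have [K [i ip]] := kernel_short_exact (@res_aug_surj _ _ P).
have [i_inj _ iE] := ip.
have [|e eE] := lift_inj (f := res_diff P 0%N) i_inj.
  by move=> x; apply/iE/res_exact0; exists x.
by exists K, i, e.
Qed.

Lemma resolution_presents M (P : proj_resolution M) K
    (i : {linear K -> res_obj P 0%N}) :
  short_exact i (res_aug P) -> presents (res_obj P 0%N) M K.
Proof. by move=> ip; split; [apply: res_proj|exists i, (res_aug P)]. Qed.

(** For n = 0, a cocycle on the term of degree 1 is a map from the kernel K of the augmentation, and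
    it is a coboundary when that map extends to the term of degree 0: this is Ext^1(M, N) = 0. The
    induction cuts off the first term of P. *)
Lemma cohomology_syzygy M N n (P : proj_resolution M) :
  exists K, syzygy n M K /\ (cohomology_eq0 P N n.+1 <-> ext1_eq0 N K).
Proof.
elim: n M P => [|n IH] M P; have [K [i [e [ip ie]]]] := tail_resolution_exists P.
  exists M; split; first exact: isomorphic_refl.
  have eP := tail_aug_surj ip ie.
  have eE := tail_exact0 ip ie.
  split=> [/= coh|ext f fd].
    apply: (ext1_presentation (@res_proj _ _ P 0%N) ip) => f.
    have [|g gE] := coh (f \o e : {linear _ -> _}).
      by move=> x; rewrite /= (_ : e _ = 0) ?linear0 //; apply/eE; exists x.
    by exists g => x; have [y <-] := eP x; rewrite ie -gE.
  have [|f' f'E] := factor_surj (f := f) eP.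
    by move=> x /eE[y <-].
  by have [g gE] := ext _ _ _ _ ip f'; exists g => x; rewrite -ie gE f'E.
have [L [KL LE]] := IH K (tail_resolution ip ie).
exists L; split=> //; exists K; split=> //.
by exists (res_obj P 0%N); apply: resolution_presents ip.
Qed.

Lemma finite_resolution_syzygy M n (P : proj_resolution M) :
    (forall j, (n < j)%N -> zero_module (res_obj P j)) ->
  exists K, syzygy n M K /\ projective K.
Proof.
elim: n M P => [|n IH] M P P0.
  exists (res_obj P 0%N); split; last exact: res_proj.
  apply: isomorphic_sym; exists (res_aug P).
  apply: inj_surj_bij; last exact: res_aug_surj.
  apply: linear_inj0 => x /res_exact0[y <-].
  by rewrite (P0 1%N isT y) linear0.
have [K [i [e [ip ie]]]] := tail_resolution_exists P.
have [|L [KL Lp]] := IH K (tail_resolution ip ie).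
  by move=> j j_gt; apply: (P0 j.+1).
exists L; split=> //; exists K; split=> //.
by exists (res_obj P 0%N); apply: resolution_presents ip.
Qed.

Section Cons.
Context (M : lmodType R) (P : lmodType R) (K : lmodType R).
Context (i : {linear K -> P}) (p : {linear P -> M}) (Q : proj_resolution K).
Hypothesis Pp : projective P.
Hypothesis ip : short_exact i p.

Definition cons_obj j : lmodType R := if j is j'.+1 then res_obj Q j' else P.

Definition cons_diff j : {linear cons_obj j.+1 -> cons_obj j} :=
  match j with
  | 0%N => i \o res_aug Q : {linear res_obj Q 0%N -> P}
  | j'.+1 => res_diff Q j'
  end.

Fact cons_proj j : projective (cons_obj j).
Proof. by case: j => //= j; apply: res_proj. Qed.

Fact cons_exact0 y : p y = 0 <-> exists z, cons_diff 0 z = y.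
Proof.
case: ip => i_inj _ ->; split=> -[x <-]; last by exists (res_aug Q x).
by have [z <-] := res_aug_surj Q x; exists z.
Qed.

Fact cons_exact j y : cons_diff j y = 0 <-> exists z, cons_diff j.+1 z = y.
Proof.
case: j y => [|j] y /=; last exact: res_exact.
rewrite -res_exact0; case: ip => i_inj _ _.
by split=> [|->]; rewrite ?linear0 // -(linear0 i) => /i_inj.
Qed.

Definition cons_resolution : proj_resolution M :=
  @ProjResolution R M cons_obj cons_diff p cons_proj (let: And3 _ pP _ := ip in pP)
    cons_exact0 cons_exact.

End Cons.

Lemma zero_resolution Z : zero_module Z ->
  exists P : proj_resolution Z, forall j, zero_module (res_obj P j).
Proof.
move=> Z0; have Zp := projective_zero Z0.
have surj (x : Z) : exists y, (\0 : {linear Z -> Z}) y = x.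
  by exists 0; rewrite linear0 (Z0 x).
have ex (y : Z) :
    (\0 : {linear Z -> Z}) y = 0 <-> exists z, (\0 : {linear Z -> Z}) z = y.
  by split=> // _; apply: surj.
by exists (@ProjResolution R Z (fun=> Z) (fun=> \0) \0 (fun=> Zp) surj ex (fun=> ex)).
Qed.

End Resolutions.

Definition fin_pd (R : pzRingType) (M : lmodType R) : Prop :=
  exists n, syzygies_in n (@projective R) M.

(** Index n stands for Ext^(n+1), so n = 0 already is the first positive degree. *)
Definition ext_perp (R : pzRingType) (N M : lmodType R) : Prop :=
  forall n, syzygies_in n (ext1_eq0 N) M.

Section FinitePd.
Context (R : pzRingType) (Rnoeth : noetherian R).
Implicit Types A B C K L M N P Q X Y Z : lmodType R.
Local Notation fg := finitely_generated.
Let resP := resolving_proj R.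

Lemma syzygies_projective_leq n m M :
  fg M -> (n <= m)%N ->
  syzygies_in n (@projective R) M -> syzygies_in m (@projective R) M.
Proof.
move=> fgM; elim: m => [|m IH]; first by rewrite leqn0 => /eqP ->.
rewrite leq_eqVlt ltnS => /orP[/eqP ->//|/IH nm /nm Mm K /syzygyS_last[L [/Mm Lp]]].
case=> P [Pp [i [p ip]]]; apply: (projective_retract _ Pp).
apply: (retract_trans (retract_prodl K L)).
exact: retract_iso (projective_split ip Lp).
Qed.

Lemma finite_pdE M : fg M -> finite_pd M <-> fin_pd M.
Proof.
move=> fgM; split=> [[n [P /finite_resolution_syzygy[K [MK Kp]]]]|[n]].
  by exists n; apply: syzygies_in_any MK Kp.
elim: n M fgM => [|n IH] M fgM Mn.
  have {}Mn : projective M by apply/(syzygies_in0 resP).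
  have [Z Z0] := zero_module_exists R; have [Q Q0] := zero_resolution Z0.
  have ip : short_exact (\0 : {linear Z -> M}) (idfun : {linear M -> M}).
    split=> [x y _|y|y]; first by rewrite (Z0 x) (Z0 y).
      by exists y.
    by split=> [/= ->|[x <-]] //; exists 0.
  by exists 0%N, (cons_resolution Q Mn ip) => -[//|j] _; apply: Q0.
have [m [K [fgK MK]]] := fg_presents Rnoeth fgM.
have [|l [Q Ql]] := IH K fgK; first exact: syzygies_in_presents MK Mn.
have [Pp [i [p ip]]] := MK.
exists l.+1, (cons_resolution Q Pp ip) => -[//|j]; exact: Ql.
Qed.

Lemma PfinE M : Pfin M <-> fg M /\ fin_pd M.
Proof. by split=> -[fgM Mpd]; split=> //; apply/(finite_pdE fgM). Qed.

(** Each degree may come with its own resolution; passing to all syzygies removes the dependence. *)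
Lemma ext_perpP N M : fg M ->
  (forall i, (1 <= i)%N -> Ext_eq0 i M N) -> ext_perp N M.
Proof.
move=> fgM ext n; have [P] := ext n.+1 isT.
have [K [MK [+ _]]] := cohomology_syzygy N n P => /[apply] K0.
exact: (syzygies_in_any (resolving_ext1 N) fgM MK).
Qed.

(** [finite_pd] supplies the resolution that [Ext_eq0] asks for. *)
Lemma ext_perp_Ext_eq0 N M : finite_pd M -> ext_perp N M ->
  forall i, (1 <= i)%N -> Ext_eq0 i M N.
Proof.
move=> [m [P _]] MN [//|i] _; exists P.
by have [K [/MN K0 ->]] := cohomology_syzygy N i P.
Qed.

Lemma fin_pd_projective P : fg P -> projective P -> fin_pd P.
Proof. by move=> fgP Pp; exists 0%N; apply: syzygies_in_projective. Qed.

Lemma fin_pd_extension A B C (i : {linear A -> B}) (p : {linear B -> C}) :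
  short_exact i p -> fg A -> fg C -> fin_pd A -> fin_pd C -> fin_pd B.
Proof.
move=> ip fgA fgC [n An] [m Cm]; exists (maxn n m).
apply: (syzygies_in_extension Rnoeth resP ip) => //.
  exact: syzygies_projective_leq (leq_maxl n m) An.
exact: syzygies_projective_leq (leq_maxr n m) Cm.
Qed.

Lemma fin_pd_kernel A B C (i : {linear A -> B}) (p : {linear B -> C}) :
  short_exact i p -> fg B -> fin_pd B -> fin_pd C -> fin_pd A.
Proof.
move=> ip fgB [n Bn] [m Cm]; have [fgA fgC] := short_exact_fg Rnoeth ip fgB.
exists (maxn n m); apply: (syzygies_in_kernel Rnoeth resP ip) => //.
  exact: syzygies_projective_leq (leq_maxl n m) Bn.
exact: syzygies_projective_leq (leqW (leq_maxr n m)) Cm.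
Qed.

Lemma fin_pd_cokernel A B C (i : {linear A -> B}) (p : {linear B -> C}) :
  short_exact i p -> fg B -> fin_pd A -> fin_pd B -> fin_pd C.
Proof.
move=> ip fgB [n An] [m Bm]; have [fgA fgC] := short_exact_fg Rnoeth ip fgB.
exists (maxn n m).+1; apply: (syzygies_in_cokernel Rnoeth resP ip) => //.
  exact: syzygies_projective_leq (leq_maxl n m) An.
exact: syzygies_projective_leq (leqW (leq_maxr n m)) Bm.
Qed.

Lemma fin_pd_retract X M : retract X M -> fg M -> fin_pd M -> fin_pd X.
Proof. by move=> XM fgM [n Mn]; exists n; apply: syzygies_in_retract XM fgM Mn. Qed.

Lemma ext_perp1 N M : ext_perp N M -> ext1_eq0 N M.
Proof. by move=> MN; apply/(syzygies_in0 (resolving_ext1 N))/MN. Qed.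

Lemma ext_perp_presents N P M K : presents P M K -> ext_perp N M -> ext_perp N K.
Proof. by move=> MK MN n; apply: syzygies_in_presents MK (MN n.+1). Qed.

Lemma ext_perp_presentsP N P M K : fg K -> presents P M K ->
  ext1_eq0 N M -> ext_perp N K -> ext_perp N M.
Proof.
move=> fgK MK M1 KN [|n]; first by apply/(syzygies_in0 (resolving_ext1 N)).
exact: (syzygies_inS Rnoeth (resolving_ext1 N) fgK MK).
Qed.

Lemma ext_perp_projective N P : fg P -> projective P -> ext_perp N P.
Proof.
by move=> fgP Pp n; apply: syzygies_in_projective => //; apply: resolving_ext1.
Qed.

Lemma ext_perp_extension N A B C (i : {linear A -> B}) (p : {linear B -> C}) :
  short_exact i p -> fg A -> fg C -> ext_perp N A -> ext_perp N C -> ext_perp N B.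
Proof.
move=> ip fgA fgC AN CN n.
exact: (syzygies_in_extension Rnoeth (resolving_ext1 N) ip).
Qed.

Lemma ext_perp_kernel N A B C (i : {linear A -> B}) (p : {linear B -> C}) :
  short_exact i p -> fg B -> ext_perp N B -> ext_perp N C -> ext_perp N A.
Proof.
move=> ip fgB BN CN n.
exact: (syzygies_in_kernel Rnoeth (resolving_ext1 N) ip).
Qed.

Lemma ext_perp_cokernel N A B C (i : {linear A -> B}) (p : {linear B -> C}) :
    short_exact i p -> fg B -> ext_perp N A -> ext_perp N B ->
    (forall f : {linear A -> N}, exists g : {linear B -> N}, forall x, g (i x) = f x) ->
  ext_perp N C.
Proof.
move=> ip fgB AN BN extA [|n].
  apply/(syzygies_in0 (resolving_ext1 N)).
  exact: ext1_cokernel ip (ext_perp1 BN) extA.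
exact: (syzygies_in_cokernel Rnoeth (resolving_ext1 N) ip).
Qed.

Lemma ext_perp_retract N X M : retract X M -> fg M -> ext_perp N M -> ext_perp N X.
Proof.
by move=> XM fgM MN n; apply: syzygies_in_retract XM fgM (MN n) => //;
   apply: resolving_ext1.
Qed.

Lemma ext_perp_iso N N' M : isomorphic N N' -> ext_perp N M -> ext_perp N' M.
Proof.
case=> f /linear_inverse[g [fK gK]] MN n K /MN K0 A B i p ip h.
have [k kE] := K0 _ _ _ _ ip (g \o h : {linear _ -> _}).
by exists (f \o k : {linear _ -> _}) => x; rewrite /= kE /= gK.
Qed.

(** The objects of P^{<oo} in the left orthogonal of N, in terms of syzygies: the class on which
    Hom(-, N) is to be a duality. *)
Definition nice N M : Prop := [/\ fg M, fin_pd M & ext_perp N M].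

Lemma nice_projective N P : fg P -> projective P -> nice N P.
Proof.
by move=> fgP Pp; split; [|apply: fin_pd_projective|apply: ext_perp_projective].
Qed.

Lemma nice_retract N X M : retract X M -> nice N M -> nice N X.
Proof.
move=> XM [fgM Mpd MN]; split; first exact: fg_retract XM fgM.
  exact: fin_pd_retract XM fgM Mpd.
exact: ext_perp_retract XM fgM MN.
Qed.

Lemma nice_finite_retract N T X : finite_retract T X -> nice N T -> nice N X.
Proof.
move=> TX NT; apply: (finite_retract_ind (C := nice N) _ _ _ NT TX).
- move=> Z Z0; apply: nice_projective; last exact: projective_zero.
  by exists 0%N, (fun=> 0) => x; exists (fun=> 0); rewrite (Z0 x) big_ord0.
- move=> Y Z [fgY Ypd YN] [fgZ Zpd ZN]; split; first exact: fg_prod.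
    exact: fin_pd_extension (prod_short_exact Y Z) _ _ _ _.
  exact: ext_perp_extension (prod_short_exact Y Z) _ _ _ _.
by move=> Y Z YZ; apply: nice_retract.
Qed.

Lemma nice_cokernel N A B C (i : {linear A -> B}) (p : {linear B -> C}) :
    short_exact i p -> nice N A -> nice N B ->
    (forall f : {linear A -> N}, exists g : {linear B -> N}, forall x, g (i x) = f x) ->
  nice N C.
Proof.
move=> ip [fgA Apd AN] [fgB Bpd BN] extA; split.
- by case: (short_exact_fg Rnoeth ip fgB).
- exact: fin_pd_cokernel ip _ _ _.
exact: ext_perp_cokernel ip _ _ _ extA.
Qed.

Lemma nice_kernel N A B C (i : {linear A -> B}) (p : {linear B -> C}) :
  short_exact i p -> nice N B -> nice N C -> nice N A.
Proof.
move=> ip [fgB Bpd BN] [fgC Cpd CN]; split.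
- by case: (short_exact_fg Rnoeth ip fgB).
- exact: fin_pd_kernel ip _ _ _.
exact: ext_perp_kernel ip _ _ _.
Qed.

Lemma nice_iso N N' M : isomorphic N N' -> nice N M -> nice N' M.
Proof. by move=> NN' [fgM Mpd MN]; split=> //; apply: ext_perp_iso MN. Qed.

Lemma niceE N M : nice N M <-> Pfin M /\ perp N M.
Proof.
split=> [[fgM Mpd MN]|[[fgM /finite_pdE Mpd] [_ /ext_perpP MN]]].
  have Mpd' : finite_pd M by apply/finite_pdE.
  by split; split=> //; apply: ext_perp_Ext_eq0.
by split; auto.
Qed.

Lemma strong_tiltingE T :
  strong_tilting T <-> [/\ nice T T, coresolved_by_add T
    & forall M, fg M -> fin_pd M -> ext_perp T M].
Proof.
split=> [[[PT TT corT] TP]|[/niceE[PT [_ TT]] corT TP]].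
  split=> // [|M fgM /finite_pdE Mpd]; first by apply/niceE; split=> //; case: PT.
  by apply: ext_perpP => // i i1; apply: TP => //; split=> //; apply: Mpd.
split=> // M /PfinE[fgM Mpd]; apply: ext_perp_Ext_eq0; last exact: TP.
exact/finite_pdE.
Qed.

End FinitePd.

(** * Dualities given by a bimodule *)

(* Two functors H = Hom_R(-, N) and K = Hom_S(-, N'), where N and N' are the two
   sides of an R-S-bimodule, identified by [dp_th]; the axioms are symmetric under
   the exchange of the two sides. *)
Record dual_pair (R S : pzRingType) (H : cofunctor R S) (K : cofunctor S R)
    (N : lmodType R) (N' : lmodType S) := DualPair {
  dp_th : N -> N';
  dp_th' : N' -> N;
  dp_thK : cancel dp_th dp_th';
  dp_th'K : cancel dp_th' dp_th;
  dp_thD : {morph dp_th : x y / x + y};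
  dp_app : forall M : lmodType R, H M -> {linear M -> N};
  dp_app' : forall X : lmodType S, K X -> {linear X -> N'};
  dp_appD : forall (M : lmodType R) (u v : H M) x,
    dp_app (u + v) x = dp_app u x + dp_app v x;
  dp_app'D : forall (X : lmodType S) (u v : K X) x,
    dp_app' (u + v) x = dp_app' u x + dp_app' v x;
  dp_appZ : forall (M : lmodType R) s (u : H M) x,
    dp_app (s *: u) x = dp_th' (s *: dp_th (dp_app u x));
  dp_app'Z : forall (X : lmodType S) r (u : K X) x,
    dp_app' (r *: u) x = dp_th (r *: dp_th' (dp_app' u x));
  dp_app_inj : forall (M : lmodType R) (u v : H M), dp_app u =1 dp_app v -> u = v;
  dp_app'_inj : forall (X : lmodType S) (u v : K X),
    dp_app' u =1 dp_app' v -> u = v;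
  dp_app_surj : forall (M : lmodType R) (f : {linear M -> N}),
    exists u : H M, dp_app u =1 f;
  dp_app'_surj : forall (X : lmodType S) (f : {linear X -> N'}),
    exists u : K X, dp_app' u =1 f;
  dp_app_map : forall (M L : lmodType R) (f : {linear M -> L}) (u : H L) x,
    dp_app (cf_map H f u) x = dp_app u (f x);
  dp_app'_map : forall (X Y : lmodType S) (f : {linear X -> Y}) (u : K Y) x,
    dp_app' (cf_map K f u) x = dp_app' u (f x) }.

Lemma dual_pair_th'D (R S : pzRingType) (H : cofunctor R S) (K : cofunctor S R)
    (N : lmodType R) (N' : lmodType S) (dp : dual_pair H K N N') :
  {morph dp_th' dp : x y / x + y}.
Proof. by move=> x y; apply: (can_inj (dp_thK dp)); rewrite dp_thD !dp_th'K. Qed.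

Definition dual_pair_sym (R S : pzRingType) (H : cofunctor R S) (K : cofunctor S R)
    (N : lmodType R) (N' : lmodType S) (dp : dual_pair H K N N') :
  dual_pair K H N' N :=
  @DualPair S R K H N' N (dp_th' dp) (dp_th dp) (dp_th'K dp) (dp_thK dp)
    (@dual_pair_th'D _ _ _ _ _ _ dp) (@dp_app' _ _ _ _ _ _ dp) (@dp_app _ _ _ _ _ _ dp)
    (@dp_app'D _ _ _ _ _ _ dp) (@dp_appD _ _ _ _ _ _ dp)
    (@dp_app'Z _ _ _ _ _ _ dp) (@dp_appZ _ _ _ _ _ _ dp)
    (@dp_app'_inj _ _ _ _ _ _ dp) (@dp_app_inj _ _ _ _ _ _ dp)
    (@dp_app'_surj _ _ _ _ _ _ dp) (@dp_app_surj _ _ _ _ _ _ dp)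
    (@dp_app'_map _ _ _ _ _ _ dp) (@dp_app_map _ _ _ _ _ _ dp).

Section DualPair.
Context (R S : pzRingType) (H : cofunctor R S) (K : cofunctor S R).
Context (N : lmodType R) (N' : lmodType S) (dp : dual_pair H K N N').
Implicit Types A B C M L T X Y Z : lmodType R.
Local Notation fg := finitely_generated.
Local Notation app := (dp_app dp).
Local Notation app' := (dp_app' dp).
Local Notation th := (dp_th dp).
Local Notation th' := (dp_th' dp).

Lemma app0 M x : app (0 : H M) x = 0.
Proof.
by apply: (addrI (app (0 : H M) x)); rewrite -dp_appD !addr0.
Qed.

Lemma app_sum M (I : Type) (s : seq I) (u : I -> H M) x :
  app (\sum_(i <- s) u i) x = \sum_(i <- s) app (u i) x.
Proof.
elim: s => [|i s IH]; first by rewrite !big_nil app0.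
by rewrite !big_cons dp_appD IH.
Qed.

Lemma cf_map_surj_inj B C (p : {linear B -> C}) :
  (forall z, exists y, p y = z) -> injective (cf_map H p).
Proof.
move=> pP u v uv; apply: (dp_app_inj (d := dp)) => z; have [y <-] := pP z.
by rewrite -!dp_app_map uv.
Qed.

Lemma cf_map_extends A B (i : {linear A -> B}) :
  (forall v, exists u, cf_map H i u = v) <->
  (forall f : {linear A -> N}, exists g : {linear B -> N}, forall x, g (i x) = f x).
Proof.
split=> [iP f|iP v].
  have [v vE] := dp_app_surj dp f; have [u uE] := iP v.
  by exists (app u) => x; rewrite -vE -uE dp_app_map.
have [g gE] := iP (app v); have [u uE] := dp_app_surj dp g.
by exists u; apply: (dp_app_inj (d := dp)) => x; rewrite dp_app_map uE gE.
Qed.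

Lemma cf_map_left_exact A B C (i : {linear A -> B}) (p : {linear B -> C}) v :
  short_exact i p -> cf_map H i v = 0 <-> exists u, cf_map H p u = v.
Proof.
move=> [i_inj pP ip]; split=> [v0|[u <-]].
  have [|g gE] := factor_surj (f := app v) pP.
    by move=> y /ip[x <-]; rewrite -dp_app_map v0 app0.
  have [u uE] := dp_app_surj dp g; exists u.
  by apply: (dp_app_inj (d := dp)) => y; rewrite dp_app_map uE gE.
apply: (dp_app_inj (d := dp)) => x; rewrite !dp_app_map app0.
by rewrite (_ : p (i x) = 0) ?linear0 //; apply/ip; exists x.
Qed.

Lemma cf_map_short_exact A B C (i : {linear A -> B}) (p : {linear B -> C}) :
  short_exact i p -> ext1_eq0 N C -> short_exact (cf_map H p) (cf_map H i).
Proof.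
move=> ip C0; have [_ pP _] := ip; split; first exact: cf_map_surj_inj.
  by apply/cf_map_extends => f; apply: C0 ip f.
by move=> v; apply: cf_map_left_exact.
Qed.

Lemma cf_map_decomp T X (s : seq ({linear X -> T} * {linear T -> X})) :
    (forall x, x = \sum_(p <- s) p.2 (p.1 x)) ->
  forall u : H X, u = \sum_(p <- s) cf_map H p.1 (cf_map H p.2 u).
Proof.
move=> sP u; apply: (dp_app_inj (d := dp)) => x; rewrite app_sum {1}(sP x) linear_sum.
by apply: eq_bigr => p _; rewrite !dp_app_map.
Qed.

Lemma cf_finite_retract T X : finite_retract T X -> finite_retract (H T) (H X).
Proof.
move=> [s sP]; exists [seq (cf_map H p.2, cf_map H p.1) | p <- s] => u.
by rewrite big_map /= {1}(cf_map_decomp sP u).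
Qed.

(** The isomorphism is evaluation at 1. *)
Lemma cf_regular : isomorphic (H R^o) N'.
Proof.
have fL : linear (fun u : H R^o => th (app u (1 : R))).
  by move=> s u v; rewrite dp_appD dp_appZ dp_thD dp_th'K.
exists (mk_linear fL); apply: inj_surj_bij => [u v|n] /=.
  move=> /(can_inj (dp_thK dp)) uv; apply: (dp_app_inj (d := dp)) => r.
  have -> : r = r *: (1 : R^o) by exact: (esym (mulr1 r)).
  by rewrite !linearZ; congr (_ *: _).
have gL : linear (fun r : R^o => (r : R) *: th' n).
  by move=> a x y; rewrite scalerDl scalerA.
have [u uE] := dp_app_surj dp (mk_linear gL).
by exists u; rewrite uE /= scale1r dp_th'K.
Qed.

Fact pairing_linear M (m : M) : linear (fun u : H M => th (app u m)).
Proof. by move=> s u v; rewrite dp_appD dp_appZ dp_thD dp_th'K. Qed.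

Definition bidual_fun M (m : M) : K (H M) :=
  projT1 (cid (dp_app'_surj dp (mk_linear (pairing_linear m)))).

Lemma bidual_funE M (m : M) u : app' (bidual_fun m) u = th (app u m).
Proof. by rewrite /bidual_fun; case: cid => v /= ->. Qed.

Fact bidual_linear M : linear (@bidual_fun M).
Proof.
move=> a x y; apply: (dp_app'_inj (d := dp)) => u.
by rewrite dp_app'D dp_app'Z !bidual_funE linearP dp_thD dp_thK.
Qed.

Definition bidual M : {linear M -> K (H M)} := mk_linear (@bidual_linear M).

Lemma bidualE M (m : M) u : app' (bidual M m) u = th (app u m).
Proof. exact: bidual_funE. Qed.

Lemma bidual_natural M L (f : {linear M -> L}) x :
  cf_map K (cf_map H f) (bidual M x) = bidual L (f x).
Proof.
by apply: (dp_app'_inj (d := dp)) => u; rewrite dp_app'_map !bidualE dp_app_map.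
Qed.

Definition reflexive_module M : Prop := bijective (bidual M).

End DualPair.

(** * Transfer of goodness along short exact sequences *)

Section Good.
Context (R S : pzRingType) (Rnoeth : noetherian R) (Snoeth : noetherian S).
Context (H : cofunctor R S) (K : cofunctor S R).
Context (N : lmodType R) (N' : lmodType S) (dp : dual_pair H K N N').
Implicit Types A B C M L T X Y Z : lmodType R.
Local Notation fg := finitely_generated.
Local Notation dp' := (dual_pair_sym dp).
Local Notation ev := (bidual dp).

Lemma bij_inj_surj M (f : {linear M -> K (H M)}) :
  bijective f -> injective f /\ forall y, exists x, f x = y.
Proof. by case=> g fK gK; split; [apply: can_inj fK|move=> y; exists (g y)]. Qed.

(** [bidual] is natural, and the decomposition of the identity of X passes through both functors, so
    each summand is settled on T. *)
Lemma reflexive_finite_retract T X :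
  finite_retract T X -> reflexive_module dp T -> reflexive_module dp X.
Proof.
move=> [s sP] /bij_inj_surj[T_inj T_surj]; apply: inj_surj_bij => [|phi].
  apply: linear_inj0 => x x0; rewrite (sP x) big1 // => p _.
  suff -> : p.1 x = 0 by rewrite linear0.
  by apply: T_inj; rewrite -bidual_natural x0 !linear0.
pose b p := projT1 (cid (T_surj (cf_map K (cf_map H p) phi))).
have bE (p : {linear X -> T}) : ev T (b p) = cf_map K (cf_map H p) phi.
  by rewrite /b; case: cid.
exists (\sum_(p <- s) p.2 (b p.1)); rewrite linear_sum.
pose s' := [seq (cf_map H p.2, cf_map H p.1) | p <- s].
have s'P u : u = \sum_(p <- s') p.2 (p.1 u).
  by rewrite big_map /= {1}(cf_map_decomp dp sP u).
rewrite [RHS](cf_map_decomp dp' s'P) big_map; apply: eq_bigr => p _.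
by rewrite -bidual_natural bE.
Qed.

Definition good M : Prop :=
  [/\ fg M, ext_perp N M, nice N' (H M) & reflexive_module dp M].

(** As Ext^1(C, N) = 0, the dual sequence is exact. Reflexivity of A is then a diagram chase in
    which the bidual of [i] is injective. *)
Lemma good_kernel A B C (i : {linear A -> B}) (p : {linear B -> C}) :
  short_exact i p -> good B -> good C -> good A.
Proof.
move=> ip [fgB BN HB rB] [fgC CN HC rC].
have [fgA _] := short_exact_fg Rnoeth ip fgB.
have Hip := cf_map_short_exact dp ip (ext_perp1 CN).
have [i_inj pP iE] := ip.
have [B_inj B_surj] := bij_inj_surj rB; have [C_inj C_surj] := bij_inj_surj rC.
split=> //.
- exact: ext_perp_kernel ip _ _ _.
- apply: (nice_cokernel Snoeth Hip) => //.
  (* A map from the dual of C to [N'] is evaluation at some c, and evaluation at a preimage of c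
     extends it to the dual of B. This is what makes Ext^1 of the dual of A against [N'] vanish. *)
  apply/(cf_map_extends dp') => phi; have [c <-] := C_surj phi.
  by have [b <-] := pP c; exists (ev B b); rewrite bidual_natural.
have [_ Hi_surj _] := Hip.
have KHi_inj := cf_map_surj_inj dp' Hi_surj.
apply: inj_surj_bij => [|phi].
  apply: linear_inj0 => a a0; apply: i_inj; apply: B_inj.
  by rewrite -bidual_natural a0 !linear0.
have [b bE] := B_surj (cf_map K (cf_map H i) phi).
have /iE[a aE] : p b = 0.
  apply: C_inj; rewrite -bidual_natural bE linear0.
  by apply/(cf_map_left_exact dp' _ Hip); exists phi.
by exists a; apply: KHi_inj; rewrite bidual_natural aE bE.
Qed.

(** The dual of C is now a kernel, and the second dualisation is exact because the dual of A is
    orthogonal to [N']. Orthogonality of C does not follow from that of A and B, hence the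
    hypothesis. *)
Lemma good_cokernel A B C (i : {linear A -> B}) (p : {linear B -> C}) :
  short_exact i p -> good A -> good B -> ext_perp N C -> good C.
Proof.
move=> ip [fgA AN HA rA] [fgB BN HB rB] CN.
have [_ fgC] := short_exact_fg Rnoeth ip fgB.
have Hip := cf_map_short_exact dp ip (ext_perp1 CN).
have [i_inj pP iE] := ip.
have [A_inj A_surj] := bij_inj_surj rA; have [B_inj B_surj] := bij_inj_surj rB.
split=> //; first exact: (nice_kernel Snoeth Hip HB HA).
have HAN' : ext1_eq0 N' (H A) by case: HA => _ _ /ext_perp1.
have KHip := cf_map_short_exact dp' Hip HAN'.
apply: inj_surj_bij => [|phi].
  apply: linear_inj0 => c; have [b <-] := pP c.
  rewrite -bidual_natural => /(cf_map_left_exact dp' _ Hip)[phi].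
  by have [a <-] := A_surj phi; rewrite bidual_natural => /B_inj <-; apply/iE; exists a.
have [_ KHp_surj _] := KHip; have [psi <-] := KHp_surj phi.
by have [b <-] := B_surj psi; exists (p b); rewrite bidual_natural.
Qed.

Lemma good_finite_retract T X :
  finite_retract T X -> good T -> good X.
Proof.
move=> TX [fgT TN HT rT].
have [n XT] := (finite_retractP T X).1 TX.
have niceX : fg X /\ ext_perp N X.
  apply: (finite_retract_ind (C := fun X => fg X /\ ext_perp N X) _ _ _ _ TX) => //.
  - move=> Z Z0.
    have fgZ : fg Z.
      by exists 0%N, (fun=> 0) => x; exists (fun=> 0); rewrite (Z0 x) big_ord0.
    by split=> //; apply: ext_perp_projective => //; apply: projective_zero.
  - move=> Y Z [fgY YN] [fgZ ZN]; split; first exact: fg_prod.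
    exact: ext_perp_extension (prod_short_exact Y Z) _ _ _ _.
  move=> Y Z YZ [fgZ ZN]; split; first exact: fg_retract YZ fgZ.
  exact: ext_perp_retract YZ fgZ ZN.
case: niceX => fgX XN; split=> //; last exact: reflexive_finite_retract TX rT.
exact: nice_finite_retract (cf_finite_retract dp TX) HT.
Qed.

Lemma fg_projective_finite_retract M : fg M -> projective M -> finite_retract R^o M.
Proof.
move=> /free_cover[n [p pP]] Mp; have [s sE] := Mp _ _ p idfun pP.
by apply/finite_retractP; exists n, s, p.
Qed.

Section Regular.
Hypothesis goodR : good R^o.

Lemma good_perp n M :
  fg M -> syzygies_in n (@projective R) M -> ext_perp N M -> good M.
Proof.
elim: n M => [|n IH] M fgM.
  move=> /(syzygies_in0 (resolving_proj R)) Mp _.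
  exact: good_finite_retract (fg_projective_finite_retract fgM Mp) goodR.
move=> Mn MN; have [m [L [fgL ML]]] := fg_presents Rnoeth fgM.
have [Fp [i [p ip]]] := ML; apply: (good_cokernel ip) => //.
  apply: IH fgL _ _; first exact: syzygies_in_presents ML Mn.
  exact: ext_perp_presents ML MN.
exact: good_finite_retract (finite_retract_free R m) goodR.
Qed.

Lemma good_nice M : nice N M -> good M.
Proof. by case=> fgM [n Mn] MN; apply: good_perp Mn MN. Qed.

Lemma nice_bimodule : nice N' N'.
Proof.
case: goodR => _ _ HR _; apply: (nice_retract _ _ HR) => //.
exact/retract_iso/isomorphic_sym/(cf_regular dp).
Qed.

End Regular.

End Good.

(** * Reflexivity of a balanced bimodule and of its ring *)

Section Balanced.
Context (R S : pzRingType) (H : cofunctor R S) (K : cofunctor S R).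
Context (N : lmodType R) (N' : lmodType S) (dp : dual_pair H K N N').

(* S is the endomorphism ring of the R-module N. *)
Definition balanced : Prop :=
  (forall f : {linear N -> N},
    exists s : S, forall x, dp_th dp (f x) = s *: dp_th dp x) /\
  forall s s' : S, (forall x : N', s *: x = s' *: x) -> s = s'.

Hypothesis bal : balanced.

Lemma balanced_unit : exists u : H N, dp_app dp u =1 idfun.
Proof. exact: (dp_app_surj dp (idfun : {linear N -> N})). Qed.

(** The dual of N is its endomorphism ring: [s] corresponds to the multiple [s *: u1] of the
    identity. *)
Lemma balanced_dual : isomorphic S^o (H N).
Proof.
have [u1 u1E] := balanced_unit; case: bal => balP balI.
have fL : linear (fun s : S^o => (s : S) *: u1).
  by move=> a x y; rewrite scalerDl scalerA.
exists (mk_linear fL); apply: inj_surj_bij => [s s' /= ss'|u].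
  apply: balI => x; have := congr1 (fun u => dp_app dp u (dp_th' dp x)) ss'.
  by rewrite /= !dp_appZ !u1E dp_th'K => /(can_inj (dp_th'K dp)).
have [s sE] := balP (dp_app dp u); exists s; apply: (dp_app_inj (d := dp)) => x /=.
by rewrite dp_appZ u1E -sE dp_thK.
Qed.

(** The identity generates the dual of N over S, so an element of the bidual is determined by its
    value there. *)
Lemma balanced_reflexive : reflexive_module dp N.
Proof.
have [u1 u1E] := balanced_unit; case: bal => balP balI.
have th0 : dp_th dp 0 = 0.
  by apply: (addrI (dp_th dp 0)); rewrite -dp_thD !addr0.
apply: inj_surj_bij => [x y xy|phi].
  have := bidualE dp x u1; rewrite xy bidualE !u1E.
  by move=> /(can_inj (dp_thK dp)).
exists (dp_th' dp (dp_app' dp phi u1)); apply: (dp_app'_inj (d := dp)) => u.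
have [s sE] := balP (dp_app dp u).
have -> : u = s *: u1.
  apply: (dp_app_inj (d := dp)) => x; rewrite dp_appZ u1E -sE.
  by rewrite dp_thK.
by rewrite bidualE dp_appZ u1E linearZ !dp_th'K.
Qed.

(** The dual of the regular module is N, through the orbit maps [g x]. An element of its bidual is
    therefore an endomorphism of N, that is, an element of S. *)
Lemma balanced_reflexive_regular : reflexive_module (dual_pair_sym dp) S^o.
Proof.
case: bal => balP balI.
have gP (x : N) : exists v : K S^o, forall s, dp_app' dp v s = (s : S) *: dp_th dp x.
  have gL : linear (fun s : S^o => (s : S) *: dp_th dp x).
    by move=> a y z; rewrite scalerDl scalerA.
  by have [v vE] := dp_app'_surj dp (mk_linear gL); exists v.
pose g x := projT1 (cid (gP x)).
have gE x s : dp_app' dp (g x) s = (s : S) *: dp_th dp x by rewrite /g; case: cid.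
have evE s v :
    dp_app dp (bidual (dual_pair_sym dp) S^o s) v = dp_th' dp (dp_app' dp v s).
  exact: (bidualE (dual_pair_sym dp) s v).
apply: inj_surj_bij => [s s' ss'|phi].
  apply: balI => x; rewrite -[x](dp_th'K dp) -!gE.
  apply: (can_inj (dp_th'K dp)).
  by rewrite -!evE ss'.
have fL : linear (fun x => dp_app dp phi (g x)).
  move=> a x y; rewrite -linearP; congr (dp_app dp phi _).
  apply: (dp_app'_inj (d := dp)) => s; rewrite dp_app'D dp_app'Z !gE dp_thD scalerDr.
  congr (_ + _); apply: (can_inj (dp_th'K dp)); rewrite dp_thK.
  have [u1 u1E] := balanced_unit.
  have act z : dp_th' dp ((s : S) *: dp_th dp z) = dp_app dp ((s : S) *: u1) z.
    by rewrite dp_appZ u1E.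
  by rewrite !act linearZ.
have [s sE] := balP (mk_linear fL); exists s.
apply: (dp_app_inj (d := dp)) => v; rewrite evE /=.
have -> : v = g (dp_th' dp (dp_app' dp v (1 : S))).
  apply: (dp_app'_inj (d := dp)) => t; rewrite gE dp_th'K -linearZ.
  by congr (dp_app' dp v _); rewrite /GRing.scale /= mulr1.
by rewrite gE -sE /= dp_thK.
Qed.

End Balanced.

(** * Artinian commutative rings *)

(** If minimality fails everywhere, dependent choice builds an infinite descending sequence. As [lt]
    is arbitrary, a reversed inclusion gives maximal elements. *)
Lemma minimal_exists (T : Type) (F : T -> Prop) (lt : T -> T -> Prop) t0 :
    F t0 ->
    (forall u : nat -> T, (forall n, F (u n)) -> ~ forall n, lt (u n.+1) (u n)) ->
  exists t, F t /\ forall t', F t' -> ~ lt t' t.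
Proof.
move=> Ft0 noch; apply: contrapT => nomin.
have next (x : {t | F t}) : {y : {t | F t} | lt (sval y) (sval x)}.
  apply: cid; apply: contrapT => noy; apply: nomin; exists (sval x).
  split; first exact: svalP.
  by move=> t' Ft' lt'; apply: noy; exists (exist _ t' Ft').
pose u n := iter n (fun x => sval (next x)) (exist _ t0 Ft0).
apply: (noch (fun n => sval (u n))) => n; first exact: svalP.
exact: (svalP (next (u n))).
Qed.

Definition generated (R : pzRingType) (M : lmodType R) (P : M -> Prop) : Prop :=
  exists s : seq M, (forall g, g \in s -> P g) /\ forall x, P x -> span s x.

Section Span.
Context (R : pzRingType).
Implicit Types M N : lmodType R.

Lemma span_map_preimage M N (f : {linear M -> N}) s y :
  span (map f s) y -> exists x, span s x /\ f x = y.
Proof.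
elim: s y => [|g s IH] y /=; first by move=> ->; exists 0; rewrite linear0.
case=> c [z [/IH[x [sx <-]] ->]]; exists (c *: g + x); rewrite linearP.
by split=> //; exists c, x.
Qed.

Lemma seq_preimage (A B : eqType) (f : A -> B) (P : A -> Prop) (s : seq B) :
    (forall y, y \in s -> exists x, P x /\ f x = y) ->
  exists t : seq A, (forall x, x \in t -> P x) /\ map f t = s.
Proof.
elim: s => [|y s IH] sP; first by exists [::].
have [|t [tP ft]] := IH; first by move=> z zs; apply: sP; rewrite inE zs orbT.
have [x [Px fx]] := sP y (mem_head _ _); exists (x :: t); rewrite /= fx ft.
by split=> // z; rewrite inE => /orP[/eqP ->//|/tP].
Qed.

Lemma span_subset M (s t : seq M) x : {subset s <= t} -> span s x -> span t x.
Proof.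
move=> st; apply: span_sub; first exact: span_submodule.
by move=> g /st; apply: mem_span.
Qed.

End Span.

Section Artinian.
Context (k : comNzRingType) (k_art : artinian k).

Lemma artinian_chain (I : nat -> k^o -> Prop) :
  (forall n, submodule (I n)) -> (forall n x, I n.+1 x -> I n x) ->
  exists n, forall m, (n <= m)%N -> forall x, I n x -> I m x.
Proof.
move=> subI; apply: k_art => n; split; first by case: (subI n).
  exact: (submoduleD (subI n)).
exact: (submoduleZ (subI n)).
Qed.

(* A minimal non-finitely generated ideal I satisfies cI = 0 or cI = I for each
   scalar c, and is thus a vector space over k / ann(I), in which every proper
   subspace has finite dimension: this is absurd in infinite dimension. *)
Lemma artinian_ideal_generated (I : k^o -> Prop) : submodule I -> generated I.
Proof.
move: I; suff nomin : ~ exists I : k^o -> Prop, submodule I /\ ~ generated I.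
  by move=> I subI; apply: contrapT => ngI; apply: nomin; exists I.
case=> I0 I0P.
pose lt (J I : k^o -> Prop) := (forall x, J x -> I x) /\ exists x, I x /\ ~ J x.
have [|I [[subI ngI] Imin]] :=
  @minimal_exists _ (fun J : k^o -> Prop => submodule J /\ ~ generated J) lt I0 I0P.
  move=> u uP ult; have [|n nP] := artinian_chain (fun n => (uP n).1).
    by move=> n x; apply: (ult n).1.
  by have [_ [x [ux []]]] := ult n; apply: nP.
have proper J : submodule J -> (forall x, J x -> I x) -> (exists x, I x /\ ~ J x) ->
    generated J.
  move=> subJ JI Jx; apply: contrapT => ngJ; exact: (Imin J (conj subJ ngJ)).
(* If neither holds, the annihilator of c in I and the image cI are proper submodules of I, hence
   finitely generated. Generators of the first and preimages of generators of the second then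
   generate I. *)
have scale c : (forall x, I x -> c * x = 0) \/
    (forall x, I x -> exists y, I y /\ x = c * y).
  apply: contrapT => /not_orP[/existsNP[x0 /not_implyP[Ix0 cx0]]].
  move=> /existsNP[y0 /not_implyP[Iy0 cy0]]; apply: ngI.
  have [|x [] //||s [sP sE]] := proper (fun x => I x /\ c * x = 0).
  - split; first by rewrite mulr0; case: subI.
    move=> a x y [Ix cx] [Iy cy]; split; first by case: subI => _; apply.
    by rewrite mulrDr cy addr0 [_ *: _]/(_ * _) mulrCA cx mulr0.
  - by exists x0; split=> // -[].
  have [|x [y [Iy ->]]||t [tP tE]] := proper (fun x => exists y, I y /\ x = c * y).
  - split; first by exists 0; rewrite mulr0; case: subI.
    move=> a _ _ [x [Ix ->]] [y [Iy ->]]; exists (a *: x + y).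
    by rewrite mulrDr -[in RHS]scalerAr; split=> //; case: subI => _; apply.
  - exact: (submoduleZ subI).
  - by exists y0; split.
  have [|t' [t'P tt']] := @seq_preimage k^o k^o (fun y => c * y) I t.
    by move=> y /tP[x [Ix ->]]; exists x.
  exists (s ++ t'); split=> [g|x Ix].
    by rewrite mem_cat => /orP[/sP[]|/t'P].
  have mulL : linear (fun y : k^o => c * y : k^o).
    by move=> a y z; rewrite mulrDr [_ *: _]/(_ * _) mulrCA.
  have /tE : exists y, I y /\ c * x = c * y by exists x.
  rewrite -tt' => /(span_map_preimage (f := mk_linear mulL))[y [t'y /= cy]].
  rewrite -[x](subrK y); apply: span_cat => //; apply: sE.
  split; last by rewrite mulrBr cy subrr.
  by apply: (submoduleB subI) => //; apply: span_sub t'y.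
(* If cI = I, the chain of ideals generated by the powers of c yields c^n = c^(n+1) d; every element
   of I is a multiple of c^n, so d inverts c on I. *)
have inv c : (forall x, I x -> c * x = 0) \/
    exists d, forall x, I x -> d * (c * x) = x.
  case: (scale c) => [|cI]; [by left|right].
  have [||n nP] := artinian_chain (I := fun n x => exists d, x = c ^+ n * d).
  - move=> n; split; first by exists 0; rewrite mulr0.
    move=> a _ _ [x ->] [y ->]; exists (a * x + y).
    by rewrite mulrDr mulrCA.
  - by move=> n _ [d ->]; exists (c * d); rewrite exprSr mulrA.
  have [|d dE] := nP n.+1 (leqnSn n) (c ^+ n); first by exists 1; rewrite mulr1.
  exists d => x Ix.
  have [y ->] : exists y, x = c ^+ n * y.
    elim: (n) x Ix => [|m IH] x Ix; first by exists x; rewrite mul1r.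
    by have [x' [/IH[y ->] ->]] := cI x Ix; exists y; rewrite exprS mulrA.
  by rewrite [in RHS]dE exprS !mulrA; congr (_ * y); rewrite -mulrA mulrC.
have next (s : seq k^o) : {x | (forall g, g \in s -> I g) -> I x /\ ~ span s x}.
  apply: cid; case: (pselect (forall g, g \in s -> I g)) => sI; last by exists 0.
  apply: contrapT => nox; apply: ngI; exists s; split=> // x Ix.
  by apply: contrapT => nsx; apply: nox; exists x.
(* [s n] lists x_(n-1), ..., x_0, each outside the span of its predecessors. [t n] lists x_n, ...,
   x_1: the omission of x_0 is to make the union J of their spans a proper subspace. *)
pose s n := iter n (fun s => sval (next s) :: s) [::].
pose x n := sval (next (s n)).
pose t n := iteri n (fun n t => x n.+1 :: t) [::].
have sS n : s n.+1 = x n :: s n by [].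
have tS n : t n.+1 = x n.+1 :: t n by [].
have sI n g : g \in s n -> I g.
  elim: n g => [|n IH] g //; rewrite sS inE => /orP[/eqP ->|/IH//].
  exact: (svalP (next (s n)) IH).1.
have xI n : I (x n) := (svalP (next (s n)) (@sI n)).1.
have xs n : ~ span (s n) (x n) := (svalP (next (s n)) (@sI n)).2.
have ts n g : g \in t n -> g \in s n.+1.
  elim: n g => [|n IH] g //; rewrite tS inE sS inE => /orP[->//|/IH ->].
  by rewrite orbT.
have x0s n : x 0%N \in s n.+1.
  by elim: n => [|n IH]; rewrite sS inE ?eqxx // IH orbT.
have tmono n m : (n <= m)%N -> {subset t n <= t m}.
  move=> /subnK <-; elim: (m - n)%N => [//|j IH] g /IH.
  by rewrite addSn tS inE => ->; rewrite orbT.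
pose J y := exists n, span (t n) y.
(* If x_0 = c x_(n+1) + y with y in the span of [t n], then either c kills I and x_0 was in that
   span already, or c can be inverted and x_(n+1) lies in the span of its predecessors. *)
have x0J n : ~ span (t n) (x 0%N).
  elim: n => [/= x0|n IH]; first by apply: (xs 0%N); rewrite /= -x0.
  rewrite tS => -[c [y [ty x0E]]]; case: (inv c) => [c0|[d dE]].
    by apply: IH; rewrite x0E [_ *: _]c0 ?add0r.
  have dx : d * (x 0%N - y) = x n.+1.
    by rewrite x0E addrK; apply: dE.
  apply: (xs n.+1); rewrite -dx; apply: (submoduleZ (span_submodule _)).
  apply: (submoduleB (span_submodule _)); first exact/mem_span/x0s.
  exact: span_subset (@ts n) ty.
have [|y [n]||l [lJ lE]] := proper J.
- split; first by exists 0%N.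
  move=> a y z [n ny] [m mz]; exists (maxn n m).
  have [_] := span_submodule (t (maxn n m)); apply.
    by apply: span_subset ny; apply: tmono (leq_maxl _ _).
  by apply: span_subset mz; apply: tmono (leq_maxr _ _).
- by apply: span_sub => // g /ts/sI.
- by exists (x 0%N); split=> // -[n]; apply: x0J.
(* The finitely many generators of J lie in the span of one [t n], which would then contain
   x_(n+1). *)
have [n ln] : exists n, forall g, g \in l -> span (t n) g.
  elim: l lJ {lE} => [|g l IH] lJ; first by exists 0%N.
  have [|n ln] := IH; first by move=> h hl; apply: lJ; rewrite inE hl orbT.
  have [m mg] := lJ g (mem_head _ _); exists (maxn n m) => h; rewrite inE.
  case/orP=> [/eqP ->|/ln hn]; [move: mg|move: hn];
    apply: span_subset => y; apply: tmono.
    exact: leq_maxr.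
  exact: leq_maxl.
apply: (xs n.+1); apply: (span_subset (@ts n)).
apply: (span_sub (span_submodule _) ln); apply: lE; exists n.+1.
by rewrite tS; apply/mem_span/mem_head.
Qed.

(** As in Hilbert's basis theorem, the coefficients at [g] of elements of P form an ideal A. Lifts
    of its generators, together with generators of the part of P inside the span of [s], generate
    P. *)
Lemma span_generated (M : lmodType k) (s : seq M) (P : M -> Prop) :
  submodule P -> (forall x, P x -> span s x) -> generated P.
Proof.
elim: s P => [|g s IH] P subP Ps.
  by exists [::]; split.
pose A (c : k^o) := exists y, span s y /\ P ((c : k) *: g + y).
have [la [laP laE]] : generated A.
  apply: artinian_ideal_generated; split.
    exists 0; rewrite scale0r addr0; split; [by case: (span_submodule s)|by case: subP].
  move=> a c d [y [sy Py]] [z [sz Pz]]; exists (a *: y + z).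
  split; first by case: (span_submodule s) => _; apply.
  by rewrite scalerDl -scalerA addrACA -scalerDr; case: subP => _; apply.
have [|t [tP tE]] := IH (fun x => P x /\ span s x) _ (fun x => @proj2 _ _).
  split; first by split; [case: subP|case: (span_submodule s)].
  move=> a x y [Px sx] [Py sy]; split; first by case: subP => _; apply.
  by case: (span_submodule s) => _; apply.
have [f fP] : {f : k^o -> M | forall c, A c -> span s (f c) /\ P ((c : k) *: g + f c)}.
  exists (fun c => if pselect (A c) is left Ac then projT1 (cid Ac) else 0) => c Ac.
  by case: pselect => // Ac'; case: cid.
exists ([seq (c : k) *: g + f c | c <- la] ++ t); split=> [h|x Px].
  by rewrite mem_cat => /orP[/mapP[c /laP/fP[_ Pc] ->]|/tP[]].
have [c [y [sy xE]]] := Ps x Px.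
have /laE lac : A c by exists y; rewrite -xE.
have [z [zl sz]] : exists z, span [seq (c : k) *: g + f c | c <- la] z /\
    span s (z - c *: g).
  apply: (span_sub (P := fun c : k^o => exists z,
    span [seq (c : k) *: g + f c | c <- la] z /\ span s (z - (c : k) *: g)) _ _ lac).
    have subl := span_submodule [seq (c : k) *: g + f c | c <- la].
    split.
      by exists 0; rewrite scale0r subr0; case: (span_submodule s); case: subl.
    move=> a b d [z [lz sz]] [w [lw sw]]; exists (a *: z + w).
    split; first by case: subl => _; apply.
    rewrite scalerDl opprD addrACA -scalerA -scalerBr.
    by case: (span_submodule s) => _; apply.
  move=> a la_a; exists (a *: g + f a); split; first exact/mem_span/map_f.
  by rewrite addrC addKr; case: (fP a (laP a la_a)).
rewrite -[x](subrK z) addrC; apply: span_cat => //; apply: tE; split.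
  apply: (submoduleB subP) => //.
  by apply: span_sub zl => // h /mapP[a /laP/fP[_ Pa] ->].
rewrite xE -[_ - z](_ : y - (z - c *: g) = _); last by rewrite opprB addrCA addrA.
exact: (submoduleB (span_submodule s)).
Qed.

(** The coefficient ideals at [g] and the intersections with the span of [s] both become stationary,
    and together they detect equality in a descending chain. *)
Lemma span_chain (M : lmodType k) (s : seq M) (I : nat -> M -> Prop) :
    (forall n, submodule (I n)) -> (forall n x, I n.+1 x -> I n x) ->
    (forall n x, I n x -> span s x) ->
  exists n, forall m, (n <= m)%N -> forall x, I n x -> I m x.
Proof.
elim: s I => [|g s IH] I subI decI Is.
  by exists 0%N => m _ x /Is /= ->; case: (subI m).
have mono n m x : (n <= m)%N -> I m x -> I n x.
  by move=> /subnK <-; elim: (m - n)%N => [//|j IHj] /decI.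
have [||n1 n1P] := artinian_chain
  (I := fun n c => exists y, span s y /\ I n ((c : k) *: g + y)).
- move=> n; split.
    exists 0; rewrite scale0r addr0.
    by split; [case: (span_submodule s)|case: (subI n)].
  move=> a c d [y [sy Py]] [z [sz Pz]]; exists (a *: y + z).
  split; first by case: (span_submodule s) => _; apply.
  by rewrite scalerDl -scalerA addrACA -scalerDr; case: (subI n) => _; apply.
- by move=> n c [y [sy /decI Iy]]; exists y.
have [|||n2 n2P] := IH (fun n x => I n x /\ span s x).
- move=> n; split; first by split; [case: (subI n)|case: (span_submodule s)].
  move=> a x y [Px sx] [Py sy]; split; first by case: (subI n) => _; apply.
  by case: (span_submodule s) => _; apply.
- by move=> n x [/decI Ix].
- by move=> n x [].
exists (maxn n1 n2) => m; rewrite geq_max => /andP[n1m n2m] x Ix.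
have [c [y [sy xE]]] := Is _ _ Ix.
have [|z [sz Iz]] := n1P m n1m c.
  by exists y; rewrite -xE; split=> //; apply: mono Ix; apply: leq_maxl.
have xzE : x - (c *: g + z) = y - z by rewrite xE opprD addrACA subrr add0r.
rewrite -[x](subrK (c *: g + z)); apply: (submoduleD (subI m)) => //.
apply: (n2P m n2m _ _).1; split.
  apply: (submoduleB (subI n2)); first by apply: mono Ix; apply: leq_maxr.
  exact: mono Iz.
by rewrite xzE; apply: (submoduleB (span_submodule s)).
Qed.

End Artinian.

(** * Module-finite rings *)

Definition restrict (k R : pzRingType) (phi : {rmorphism k -> R}) (M : lmodType R) :
  Type := M.

Section Restrict.
Context (k R : pzRingType) (phi : {rmorphism k -> R}) (M : lmodType R).
Local Notation kM := (restrict phi M).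

HB.instance Definition _ := GRing.Zmodule.on kM.

Definition restrict_scale (c : k) (x : kM) : kM := phi c *: (x : M).

Fact restrict_scaleA a b x :
  restrict_scale a (restrict_scale b x) = restrict_scale (a * b) x.
Proof. by rewrite /restrict_scale scalerA rmorphM. Qed.
Fact restrict_scale1 : left_id 1 restrict_scale.
Proof. by move=> x; rewrite /restrict_scale rmorph1 scale1r. Qed.
Fact restrict_scaleDr : right_distributive restrict_scale +%R.
Proof. by move=> a x y; exact: (scalerDr (phi a) (x : M) (y : M)). Qed.
Fact restrict_scaleDl x : {morph restrict_scale^~ x : a b / a + b}.
Proof. by move=> a b; rewrite /restrict_scale rmorphD; exact: (scalerDl (x : M)). Qed.
HB.instance Definition _ := GRing.Zmodule_isLmodule.Build k kM
  restrict_scaleA restrict_scale1 restrict_scaleDr restrict_scaleDl.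

Lemma restrictE (c : k) (x : kM) : c *: x = phi c *: (x : M) :> M.
Proof. by []. Qed.

Lemma submodule_restrict (P : M -> Prop) : submodule P -> submodule (P : kM -> Prop).
Proof. by case=> P0 PD; split=> // a x y; apply: PD. Qed.

End Restrict.

Fact restrict_map_linear (k R : pzRingType) (phi : {rmorphism k -> R})
    (M N : lmodType R) (f : {linear M -> N}) :
  linear (f : restrict phi M -> restrict phi N).
Proof. by move=> a x y; rewrite !restrictE; exact: (linearP f (phi a) x y). Qed.

Section ModuleFinite.
Context (k : comNzRingType) (k_art : artinian k) (R : pzRingType).
Context (phi : {rmorphism k -> R}) (phi_fg : finitely_generated (restrict phi R^o)).
Implicit Types M N T X : lmodType R.
Local Notation fg := finitely_generated.

Lemma fg_restrict M : fg M <-> fg (restrict phi M).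
Proof.
split=> [/fg_span[s sP]|/fg_span[s sP]]; apply/fg_span; last first.
  exists s => x; elim: (s) x (sP x) => [|g t IH] x //= [c [y [/IH ty ->]]].
  by exists (phi c), y.
have [t tP] := (fg_span _).1 phi_fg.
have mulL g : linear (fun r : restrict phi R^o => (r : R) *: (g : M) : restrict phi M).
  by move=> a x y; rewrite scalerDl -scalerA.
pose l := flatten [seq map (mk_linear (mulL g)) t | g <- s].
have lP g r : g \in s -> span l (r *: (g : M) : restrict phi M).
  move=> gs; have := span_map (mk_linear (mulL g)) (tP r).
  apply: span_subset => x xt; apply/flattenP; exists (map (mk_linear (mulL g)) t) => //.
  exact: map_f.
suff gen s' x : {subset s' <= s} -> span s' x -> span l (x : restrict phi M).
  by exists l => x; apply: (gen s).
elim: s' x => [|g s' IH] x ss /=; first by move=> ->; case: (span_submodule l).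
move=> [c [y [s'y ->]]]; apply: (submoduleD (span_submodule l)).
  by apply: lP; apply: ss; apply: mem_head.
by apply: IH s'y => h hs; apply: ss; rewrite inE hs orbT.
Qed.

Lemma module_finite_noetherian : noetherian R.
Proof.
move=> M N i i_inj /fg_restrict/fg_span[s sP].
have [|x _|l [lP lE]] := span_generated (M := restrict phi M) (s := s) k_art
    (P := fun x => exists y, i y = x).
- apply: submodule_restrict; split; first by exists 0; rewrite linear0.
  by move=> a _ _ [x <-] [y <-]; exists (a *: x + y); rewrite linearP.
- exact: sP.
have [|t [_ tl]] := @seq_preimage N (restrict phi M) i (fun=> True) l.
  by move=> x /lP[y <-]; exists y.
apply/fg_restrict/fg_span; exists t => x.
have /lE : exists y, i y = i x by exists x.
pose ki := mk_linear (@restrict_map_linear _ _ phi _ _ i).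
by rewrite -tl => /(span_map_preimage (f := ki))[y [ty /i_inj <-]].
Qed.

Lemma submodule_minimal M (F : (M -> Prop) -> Prop) P0 :
    fg M -> (forall P, F P -> submodule P) -> F P0 ->
  exists P, F P /\ forall Q, F Q -> (forall x, Q x -> P x) -> forall x, P x -> Q x.
Proof.
move=> /fg_restrict/fg_span[s sP] subF FP0.
pose lt (J I : M -> Prop) := (forall x, J x -> I x) /\ exists x, I x /\ ~ J x.
have [|P [FP Pmin]] := @minimal_exists _ F lt P0 FP0.
  move=> u uF ult.
  have [n|n x|n x _|n nP] := span_chain (M := restrict phi M) (s := s) k_art (I := u).
  - exact/submodule_restrict/subF/uF.
  - exact: (ult n).1.
  - exact: sP.
  by have [_ [x [ux []]]] := ult n; apply: nP.
exists P; split=> // Q FQ QP x Px; apply: contrapT => nQx.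
by apply: (Pmin Q FQ); split=> //; exists x.
Qed.

End ModuleFinite.

Section EndoFinite.
Context (k : comNzRingType) (k_art : artinian k) (R : pzRingType).
Context (phi : {rmorphism k -> R}) (phi_fg : finitely_generated (restrict phi R^o)).
Hypothesis phi_central : forall c r, phi c * r = r * phi c.
Context (T : lmodType R) (T_fg : finitely_generated T).
Local Notation fg := finitely_generated.

Fact central_linear c : linear (fun t : T => phi c *: t).
Proof. by move=> a x y; rewrite scalerDr !scalerA phi_central. Qed.

Definition endo_morphism_fun (c : k) : Endo T := mk_linear (central_linear c).

Fact endo_morphism_zmod : zmod_morphism endo_morphism_fun.
Proof.
by move=> a b; apply: LinHomP => t; rewrite /= rmorphB scalerBl.
Qed.

Fact endo_morphism_monoid : monoid_morphism endo_morphism_fun.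
Proof.
split=> [|a b]; apply: LinHomP => t /=; first by rewrite rmorph1 scale1r.
by rewrite rmorphM -scalerA.
Qed.

Definition endo_morphism : {rmorphism k -> Endo T} :=
  HB.pack_for {rmorphism k -> Endo T} endo_morphism_fun
    (GRing.isZmodMorphism.Build k (Endo T) _ endo_morphism_zmod)
    (GRing.isMonoidMorphism.Build k (Endo T) _ endo_morphism_monoid).

Lemma endo_morphism_central c f : endo_morphism c * f = f * endo_morphism c.
Proof. by apply: LinHomP => t /=; rewrite linearZ. Qed.

Lemma base_noetherian : noetherian k.
Proof.
apply: (@module_finite_noetherian k k_art k (idfun : {rmorphism k -> k})).
apply/fg_span; exists [:: 1 : k] => x; exists x, 0; split=> //.
by rewrite addr0; exact: (esym (mulr1 x)).
Qed.

Lemma fg_ffun n : fg {ffun 'I_n -> restrict phi T}.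
Proof.
have fgT : fg (restrict phi T) by apply/(fg_restrict phi_fg).
have TX : finite_retract (restrict phi T) {ffun 'I_n -> restrict phi T}.
  by apply/finite_retractP; exists n, idfun, idfun.
apply: (finite_retract_ind (C := @finitely_generated k) _ _ _ fgT TX).
- by move=> Z Z0; exists 0%N, (fun=> 0) => x; exists (fun=> 0); rewrite (Z0 x) big_ord0.
- exact: fg_prod.
exact: fg_retract.
Qed.

(** Values on generators of M embed Hom(M, T) in a finite power of T over k. *)
Lemma fg_hom_to_base M : fg M -> fg (restrict endo_morphism (hom_to T M)).
Proof.
case=> n [g gP].
have fL : linear (fun u : restrict endo_morphism (hom_to T M) =>
    [ffun i => (u : {linear M -> T}) (g i)] : {ffun 'I_n -> restrict phi T}).
  by move=> a u v; apply/ffunP => i; rewrite !ffunE.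
apply: (base_noetherian (i := mk_linear fL)); last exact: fg_ffun.
apply: linear_inj0 => u /ffunP u0; apply: LinHomP => x.
have [c ->] := gP x; rewrite linear_sum big1 //= => i _.
by rewrite linearZ; have := u0 i; rewrite !ffunE /= => ->; rewrite scaler0.
Qed.

Lemma endo_morphism_fg : fg (restrict endo_morphism (Endo T)^o).
Proof. exact: (fg_hom_to_base T_fg). Qed.

End EndoFinite.

(** * Tilting modules *)

Definition module_finite (k : comNzRingType) (R : pzRingType) : Prop :=
  exists phi : {rmorphism k -> R},
    (forall c r, phi c * r = r * phi c) /\ finitely_generated (restrict phi R^o).

Section AddCoresolution.
Context (R : pzRingType) (T : lmodType R).
Implicit Types A B C : lmodType R.

(** [coresolved_by_add] with an arbitrary module in place of the regular one, so that the first term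
    can be cut off. *)
Definition add_coresolved A : Prop :=
  exists (m : nat) (X : nat -> lmodType R) (e : {linear A -> X 0%N})
         (d : forall j, {linear X j -> X j.+1}),
    [/\ forall j, (j <= m)%N -> in_add T (X j),
        forall j, (m < j)%N -> zero_module (X j),
        injective e,
        forall x, d 0%N x = 0 <-> exists a, e a = x
      & forall j x, d j.+1 x = 0 <-> exists y, d j y = x].

Lemma add_coresolved_base A : in_add T A -> add_coresolved A.
Proof.
move=> TA; have [Z Z0] := zero_module_exists R.
pose X j := if j is _.+1 then Z else A.
exists 0%N, X, (idfun : {linear A -> A}), (fun j => \0 : {linear X j -> X j.+1}).
split=> [[]//|[]//|//|x|j x]; first by split=> // _; exists x.
by split=> // _; exists 0; rewrite linear0 (Z0 x).
Qed.

Lemma add_coresolved_step A B C (i : {linear A -> B}) (p : {linear B -> C}) :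
  short_exact i p -> in_add T B -> add_coresolved C -> add_coresolved A.
Proof.
move=> [i_inj pP ip] TB [m [X [e [d [TX X0 e_inj eE dE]]]]].
pose Y j := if j is j'.+1 then X j' else B.
pose d' j : {linear Y j -> Y j.+1} :=
  match j with
  | 0%N => e \o p : {linear B -> X 0%N}
  | j'.+1 => d j'
  end.
exists m.+1, Y, i, d'; split=> [[//|j] /TX//|[//|j] /X0//|//|x|[|j] x] /=.
- by rewrite -ip; split=> [|->]; rewrite ?linear0 // -(linear0 e) => /e_inj.
- rewrite eE; split=> -[y <-]; last by exists (p y).
  by have [z <-] := pP y; exists z.
exact: dE.
Qed.

Lemma add_coresolved_iso A B : isomorphic A B -> add_coresolved A -> add_coresolved B.
Proof.
move=> /isomorphic_sym[f fb] [m [X [e [d [TX X0 e_inj eE dE]]]]].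
have [g fK gK] := fb.
exists m, X, (e \o f : {linear _ -> _}), d; split=> // [x y /e_inj|x].
  exact: can_inj fK _ _.
by rewrite eE; split=> -[a <-]; [exists (g a)|exists (f a)]; rewrite /= ?gK.
Qed.

(** The cokernel of [e] is the kernel of [d 1], coresolved by the remaining terms. For m = 0 the
    vanishing of [X 1] makes [e] onto. *)
Lemma add_coresolved_ind (CC : lmodType R -> Prop) A :
    (forall B, finite_retract T B -> CC B) ->
    (forall A B C (i : {linear A -> B}) (p : {linear B -> C}),
      short_exact i p -> CC B -> CC C -> CC A) ->
  add_coresolved A -> CC A.
Proof.
move=> addC kerC [m]; elim: m A => [|m IH] A [X [e [d [TX X0 e_inj eE dE]]]].
  apply: addC; apply: (finite_retract_retract (Y := X 0%N)); last exact/in_addP/TX.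
  apply: retract_iso; exists e; apply: inj_surj_bij => // x; apply/eE.
  exact: (X0 1%N isT).
have [K [i [i_inj iE]]] := kernel_exists (d 1%N).
have [|p pE] := lift_inj (f := d 0%N) i_inj; first by move=> x; apply/iE/dE; exists x.
apply: (kerC _ (X 0%N) K e p); last first.
- apply: IH; exists (fun j => X j.+1), i, (fun j => d j.+1); split=> //.
    by move=> j; apply: (TX j.+1).
  by move=> j; apply: (X0 j.+1).
- exact/addC/in_addP/TX.
split=> // [z|x].
  have /iE/dE[y yE] : exists y, i y = i z by exists z.
  by exists y; apply: i_inj; rewrite pE.
rewrite -eE -pE; split=> [->|]; rewrite ?linear0 // -(linear0 i); exact: i_inj.
Qed.

End AddCoresolution.

(** * The pair of functors Hom(-, T) *)

Section HomPair.
Context (R : pzRingType) (T : lmodType R).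

Fact hom_app_inj (M : lmodType R) (u v : HomTo T M) :
  (u : {linear M -> T}) =1 (v : {linear M -> T}) -> u = v.
Proof. exact: LinHomP. Qed.
Fact homE_app_inj (X : lmodType (Endo T)) (u v : HomEndTo T X) :
  (u : {linear X -> end_mod T}) =1 (v : {linear X -> end_mod T}) -> u = v.
Proof. exact: LinHomP. Qed.

Definition hom_pair : dual_pair (HomTo T) (HomEndTo T) T (end_mod T) :=
  @DualPair R (Endo T) (HomTo T) (HomEndTo T) T (end_mod T) id id
    (fun=> erefl) (fun=> erefl) (fun _ _ => erefl)
    (fun M u => u : {linear M -> T}) (fun X u => u : {linear X -> end_mod T})
    (fun _ _ _ _ => erefl) (fun _ _ _ _ => erefl)
    (fun _ _ _ _ => erefl) (fun _ _ _ _ => erefl)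
    hom_app_inj homE_app_inj
    (fun M f => ex_intro _ (f : HomTo T M) (fun=> erefl))
    (fun X f => ex_intro _ (f : HomEndTo T X) (fun=> erefl))
    (fun _ _ _ _ _ => erefl) (fun _ _ _ _ _ => erefl).

Lemma hom_pair_balanced : balanced hom_pair.
Proof.
split=> [f|f g fg]; first by exists (f : Endo T).
by apply: LinHomP => x; apply: fg.
Qed.

End HomPair.

Lemma isomorphic_dual (R S : pzRingType) (H : cofunctor R S) (M N : lmodType R) :
  isomorphic M N -> isomorphic (H M) (H N).
Proof.
case=> f /linear_inverse[g [fK gK]]; exists (cf_map H g); exists (cf_map H f) => u.
  rewrite -cf_map_comp (_ : (g \o f : {linear M -> M}) = idfun) ?cf_map_id //.
  by apply: LinHomP.
rewrite -cf_map_comp (_ : (f \o g : {linear N -> N}) = idfun) ?cf_map_id //.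
by apply: LinHomP.
Qed.

Section Tilting.
Context (R : pzRingType) (T : lmodType R).
Local Notation E := (Endo T).
Context (Rnoeth : noetherian R) (Enoeth : noetherian E).
Hypothesis (niceT : nice T T).
Local Notation fg := finitely_generated.
Local Notation dp := (hom_pair T).
Local Notation dp' := (dual_pair_sym (hom_pair T)).
Local Notation bal := (hom_pair_balanced T).

Lemma fg_regular (S : pzRingType) : fg S^o.
Proof.
apply/fg_span; exists [:: 1] => x; exists x, 0; split=> //.
by rewrite addr0; exact: (esym (mulr1 x)).
Qed.

Lemma projective_regular (S : pzRingType) : projective S^o.
Proof.
move=> M N g f gP; have [y yE] := gP (f (1 : S)).
have hL : linear (fun s : S^o => (s : S) *: y).
  by move=> a u v; rewrite scalerDl scalerA.
exists (mk_linear hL) => x; rewrite /= linearZ yE -linearZ; congr (f _).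
exact: mulr1.
Qed.

Lemma good_regularE : good dp' E^o.
Proof.
split; [exact: fg_regular|exact/ext_perp_projective/projective_regular/fg_regular| |].
  apply: (nice_retract Rnoeth _ niceT); apply/retract_iso.
  exact: cf_regular dp'.
exact: balanced_reflexive_regular bal.
Qed.

Lemma good_module : good dp T.
Proof.
case: (niceT) => fgT _ TT; split=> //; last exact: balanced_reflexive bal.
apply: (nice_retract Enoeth (retract_iso (isomorphic_sym (balanced_dual bal)))).
by apply: (nice_projective Enoeth); [apply: fg_regular|apply: projective_regular].
Qed.

Hypothesis (corT : coresolved_by_add T).

Lemma good_regular : good dp R^o.
Proof.
apply: (add_coresolved_ind (T := T) (CC := good dp)) corT => [B TB|A B C i p].
  exact: (good_finite_retract Rnoeth Enoeth TB good_module).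
exact: (good_kernel Rnoeth Enoeth).
Qed.

Lemma nice_good M : nice T M -> good dp M.
Proof. exact: (good_nice Rnoeth Enoeth good_regular). Qed.

Lemma nice_goodE X : nice (end_mod T) X -> good dp' X.
Proof. exact: (good_nice Enoeth Rnoeth good_regularE). Qed.

Lemma tilting_duality :
  induce_duality (HomTo T) (HomEndTo T) (nice T) (nice (end_mod T)).
Proof.
split=> [M /nice_good[]//|X /nice_goodE[]//||].
  exists (fun M _ => bidual dp M); split=> [M /nice_good[]//|M N _ _ f x].
  exact: bidual_natural.
exists (fun X _ => bidual dp' X); split=> [M /nice_goodE[]//|M N _ _ f x].
exact: bidual_natural.
Qed.

Lemma nice_end_mod : nice (end_mod T) (end_mod T).
Proof. exact: (nice_bimodule Enoeth good_regular). Qed.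

(** A finite projective resolution of M dualises to an exact sequence, because the syzygies stay
    orthogonal to T, and its terms lie in add(T), because the dual of R is T. For M = T this
    coresolves the endomorphism ring. *)
Lemma coresolved_dual n M : nice T M -> syzygies_in n (@projective R) M ->
  add_coresolved (end_mod T) (HomTo T M).
Proof.
have addP P : fg P -> projective P -> in_add (end_mod T) (HomTo T P).
  move=> fgP Pp; apply/in_addP; apply: (finite_retract_base (cf_regular dp)).
  exact: (cf_finite_retract dp (fg_projective_finite_retract fgP Pp)).
elim: n M => [|n IH] M [fgM Mpd MN].
  move=> /(syzygies_in0 (resolving_proj R)) Mp.
  exact/add_coresolved_base/addP.
move=> Mn; have [m [K [fgK MK]]] := fg_presents Rnoeth fgM.
have [Fp [i [p ip]]] := MK.
have Kn := syzygies_in_presents MK Mn.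
apply: (add_coresolved_step (cf_map_short_exact dp ip (ext_perp1 MN))).
  by apply: addP => //; apply: fg_free.
apply: IH => //; split=> //; first by exists n.
exact: ext_perp_presents MK MN.
Qed.

Lemma coresolved_end_mod : coresolved_by_add (end_mod T).
Proof.
have [_ [n Tn] _] := niceT.
apply: (add_coresolved_iso (isomorphic_sym (balanced_dual bal))).
exact: coresolved_dual niceT Tn.
Qed.

Hypothesis strongT : forall M, fg M -> fin_pd M -> ext_perp T M.

Lemma hom_eq0_zero (X : lmodType E) : fg X ->
  (forall (u : {linear X -> end_mod T}) x, u x = 0) -> zero_module X.
Proof.
move=> fgX X0; have [n [K [fgK [_ [i [p ip]]]]]] := fg_presents Enoeth fgX.
have [m [q qP]] := free_cover fgK; have [i_inj pP iE] := ip.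
pose d : {linear {ffun 'I_m -> E^o} -> {ffun 'I_n -> E^o}} := i \o q.
have good_free l :=
  good_finite_retract Enoeth Rnoeth (finite_retract_free E l) good_regularE.
(* As [q] is onto, the kernel of the dual of [d] is the dual of X, which is zero. *)
have Gd_inj : injective (cf_map (HomEndTo T) d).
  apply: linear_inj0 => v; rewrite [cf_map _ d v](cf_map_comp i q v).
  rewrite -(linear0 (cf_map (HomEndTo T) q)) => /(cf_map_surj_inj dp' qP).
  move=> /(cf_map_left_exact dp' _ ip)[u <-].
  have -> : u = 0 by apply: LinHomP => x; apply: X0.
  exact: linear0.
have [C [c dc]] := cokernel_short_exact Gd_inj.
have [_ _ [fgG0 G0pd _] r0] := good_free n; have [_ _ [fgG1 G1pd _] r1] := good_free m.
have [_ fgC] := short_exact_fg Rnoeth dc fgG1.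
(* Strength of T gives Ext^1(C, T) = 0, so the bidual of [d] is onto; reflexivity of the free
   modules carries this back to [d]. *)
have C0 := ext_perp1 (strongT fgC (fin_pd_cokernel Rnoeth dc fgG1 G0pd G1pd)).
have [_ Fd _] := cf_map_short_exact dp dc C0.
have [inj0 _] := bij_inj_surj r0; have [_ surj1] := bij_inj_surj r1.
move=> x; have [z <-] := pP x.
have [phi phiE] := Fd (bidual dp' _ z); have [y yE] := surj1 phi.
have -> : z = d y by apply: inj0; rewrite -phiE -yE; apply: bidual_natural.
by apply/iE; exists (q y).
Qed.

Hypothesis cogen : forall X : lmodType R, fg X ->
  (forall (u : {linear X -> T}) x, u x = 0) -> zero_module X.

(** The induction puts the syzygy K in the orthogonal of T and so makes it good; the vanishing of
    Ext^1(M, T) rests on the reflexivity of K. *)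
Lemma cogenerator_strong n (M : lmodType E) :
  fg M -> syzygies_in n (@projective E) M -> ext_perp (end_mod T) M.
Proof.
elim: n M => [|n IH] M fgM Mn.
  by apply: ext_perp_projective => //; apply/(syzygies_in0 (resolving_proj E)).
have [m [K [fgK MK]]] := fg_presents Enoeth fgM.
have Kn := syzygies_in_presents MK Mn.
have KN := IH K fgK Kn.
apply: (ext_perp_presentsP Enoeth fgK MK) => //.
have [Fp [i [p ip]]] := MK; apply: (ext1_presentation Fp ip).
apply/(cf_map_extends dp').
have good_free :=
  good_finite_retract Enoeth Rnoeth (finite_retract_free E m) good_regularE.
have goodK : good dp' K by apply: nice_goodE; split=> //; exists n.
have [C [c [cP cE]]] := cokernel_exists (cf_map (HomEndTo T) i).
have [_ _ [fgGK _ _] rK] := goodK; have [_ _ _ rF] := good_free.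
have [_ surjK] := bij_inj_surj rK; have [injF _] := bij_inj_surj rF.
suff C0 : zero_module C by move=> v; apply/cE/C0.
apply: cogen; first exact: fg_surj cP fgGK.
move=> u z; have [v <-] := cP z.
(* The map [u c] on the dual of K is evaluation at some y in K. It vanishes on the image of the dual
   of the free module, so [i y = 0] by reflexivity there, and y = 0. *)
have [y yE] := surjK (u \o c : {linear _ -> _}).
have y0 : y = 0.
  case: (ip) => i_inj _ _; apply: i_inj; apply: injF; rewrite !linear0.
  rewrite -(bidual_natural dp' i) yE; apply: LinHomP => w /=.
  by rewrite (_ : c _ = 0) ?linear0 //; apply/cE; exists w.
have := congr1 (fun f : {linear HomEndTo T K -> T} => f v) yE.
by rewrite y0 linear0 /= => <-.
Qed.

End Tilting.

(** * Krull-Schmidt *)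

Section Chains.
Context (R : pzRingType) (Rnoeth : noetherian R).
Local Notation fg := finitely_generated.

Lemma noetherian_generated (M : lmodType R) (P : M -> Prop) :
  fg M -> submodule P -> generated P.
Proof.
move=> fgM subP; have [K [i [i_inj iE]]] := submodule_exists subP.
have /fg_span[s sP] := Rnoeth i_inj fgM; exists (map i s); split=> [_ /mapP[x _ ->]|x].
  by apply/iE; exists x.
by move=> /iE[y <-]; apply: span_map.
Qed.

Lemma ascending_chain (M : lmodType R) (u : nat -> M -> Prop) :
    fg M -> (forall n, submodule (u n)) -> (forall n x, u n x -> u n.+1 x) ->
  exists n, forall m x, u m x -> u n x.
Proof.
move=> fgM subu incu.
have mono n m x : (n <= m)%N -> u n x -> u m x.
  by move=> /subnK <- ux; elim: (m - n)%N => [//|j IH]; apply: incu.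
have [|s [sP sE]] := @noetherian_generated M (fun x => exists n, u n x) fgM.
  split; first by exists 0%N; case: (subu 0%N).
  move=> a x y [n nx] [m my]; exists (maxn n m); case: (subu (maxn n m)) => _; apply.
    by apply: mono nx; apply: leq_maxl.
  by apply: mono my; apply: leq_maxr.
have [n sn] : exists n, forall g, g \in s -> u n g.
  elim: s sP {sE} => [|g s IH] sP; first by exists 0%N.
  have [|n sn] := IH; first by move=> h hs; apply: sP; rewrite inE hs orbT.
  have [m mg] := sP g (mem_head _ _); exists (maxn n m) => h; rewrite inE.
  case/orP=> [/eqP ->|/sn]; first by apply: mono mg; apply: leq_maxr.
  by apply: mono; apply: leq_maxl.
exists n => m x mx; apply: (span_sub (subu n) sn).
by apply: sE; exists m.
Qed.

End Chains.

Section KrullSchmidt.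
Context (k : comNzRingType) (k_art : artinian k) (R : pzRingType).
Context (Rfin : module_finite k R).
Implicit Types M N X Y Z U V W : lmodType R.
Local Notation fg := finitely_generated.

Lemma mf_noetherian : noetherian R.
Proof. by case: Rfin => phi [_ phi_fg]; apply: module_finite_noetherian phi_fg. Qed.

Lemma mf_minimal M (F : (M -> Prop) -> Prop) P0 :
    fg M -> (forall P, F P -> submodule P) -> F P0 ->
  exists P, F P /\ forall Q, F Q -> (forall x, Q x -> P x) -> forall x, P x -> Q x.
Proof. case: Rfin => phi [_ phi_fg]; exact: (submodule_minimal k_art phi_fg). Qed.

Lemma endoM X (f g : Endo X) x : ((f * g : Endo X) : {linear X -> X}) x = f (g x).
Proof. by []. Qed.

(** X is the direct sum of the stable kernel and the stable image of the powers of [f], and one of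
    the two is zero. *)
Lemma fitting X (f : Endo X) : fg X -> indecomposable X ->
  bijective (f : {linear X -> X}) \/ exists n, f ^+ n = 0.
Proof.
move=> fgX [_ Xind].
pose im n (x : X) := exists y, (f ^+ n : Endo X) y = x.
have sub_im n : submodule (im n).
  split; first by exists 0; rewrite linear0.
  by move=> a _ _ [x <-] [y <-]; exists (a *: x + y); rewrite linearP.
have [||_ [[n ->] nP]] := @mf_minimal X (fun P => exists n, P = im n) (im 0%N) fgX.
- by move=> _ [n ->].
- by exists 0%N.
have [||l lP] := @ascending_chain R mf_noetherian X
  (fun n x => (f ^+ n : Endo X) x = 0) fgX.
- move=> m; split; first exact: linear0.
  by move=> a x y x0 y0; rewrite linearP x0 y0 scaler0 addr0.
- by move=> m x x0; rewrite exprS endoM x0 linear0.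
(* The successor guarantees a factor [f] in [f ^+ m], so that Ker f lies in Ker f^m and Im f^m in Im
   f. *)
pose m := (maxn n l).+1.
have im_m x : exists y, (f ^+ m : Endo X) x = (f ^+ (m + m) : Endo X) y.
  have [|||y yE] := nP (im (m + m)%N) _ _ ((f ^+ m : Endo X) x).
  - by exists (m + m)%N.
  - move=> _ [y <-]; exists ((f ^+ (m + m - n) : Endo X) y).
    rewrite -endoM -exprD subnKC //; apply: leq_trans (leq_addr _ _).
    by apply: leqW; apply: leq_maxl.
  - exists ((f ^+ (m - n) : Endo X) x); rewrite -endoM -exprD subnKC //.
    by apply: leqW; apply: leq_maxl.
  by exists y.
have ker_m j x : (f ^+ j : Endo X) x = 0 -> (f ^+ m : Endo X) x = 0.
  move=> /lP x0; rewrite (_ : m = (m - l) + l)%N; last first.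
    by rewrite subnK //; apply: leqW; apply: leq_maxr.
  by rewrite exprD endoM x0 linear0.
have [Y [i [i_inj iE]]] := kernel_exists (f ^+ m : {linear X -> X}).
have [Z [j [j_inj jE]]] := submodule_exists (sub_im m).
have iso : isomorphic (Y * Z)%type X.
  exists (copair_linear i j); apply: inj_surj_bij => [|x].
    apply: linear_inj0 => -[y z] /= yz0.
    have y0 : (f ^+ m : Endo X) (i y) = 0 by apply/iE; exists y.
    have jz0 : (f ^+ m : Endo X) (j z) = 0.
      have := congr1 (f ^+ m : {linear X -> X}) yz0.
      by rewrite linearD y0 add0r linear0.
    have [w wE] : im m (j z) by apply/jE; exists z.
    have j0 : j z = 0.
      rewrite -wE; apply: (ker_m (m + m)%N).
      by rewrite exprD endoM wE.
    congr pair; last by apply: j_inj; rewrite j0 linear0.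
    by apply: i_inj; rewrite linear0 -yz0 j0 addr0.
  have [w wE] := im_m x.
  have [|y yE] := (iE (x - (f ^+ m : Endo X) w)).1.
    by rewrite linearB wE exprD endoM subrr.
  have [|z zE] := (jE ((f ^+ m : Endo X) w)).1; first by exists w.
  by exists (y, z); rewrite /= yE zE subrK.
case: (Xind Y Z iso) => [Y0|Z0]; [left|right].
  apply: inj_surj_bij => [|x].
    apply: linear_inj0 => x x0.
    have /iE[y <-] : (f ^+ m : Endo X) x = 0 by rewrite exprSr endoM x0 linear0.
    by rewrite (Y0 y) linear0.
  have [w wE] := im_m x.
  have /iE[y yE] : (f ^+ m : Endo X) (x - (f ^+ m : Endo X) w) = 0.
    by rewrite linearB wE exprD endoM subrr.
  exists ((f ^+ maxn n l : Endo X) w); rewrite -endoM -exprS.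
  by apply/esym/eqP; rewrite -subr_eq0 -yE (Y0 y) linear0.
exists m; apply: LinHomP => x.
have /jE[z <-] : im m ((f ^+ m : Endo X) x) by exists x.
by rewrite (Z0 z) linear0.
Qed.

(** If [f] is nilpotent, then [g = 1 - f] is injective, hence not nilpotent as X is nonzero, and
    [fitting] applies to [g]. *)
Lemma endo_local X (f g : Endo X) : fg X -> indecomposable X -> f + g = 1 ->
  bijective (f : {linear X -> X}) \/ bijective (g : {linear X -> X}).
Proof.
move=> fgX Xind fg1; have fgx x : f x + g x = x.
  by have := congr1 (fun h : {linear X -> X} => h x) fg1.
case: (fitting f fgX Xind) => [|[n fn]]; [by left|right].
have g_inj : injective g.
  apply: linear_inj0 => x gx; have fx : f x = x by rewrite -{2}(fgx x) gx addr0.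
  have : (f ^+ n : Endo X) x = x.
    by elim: n {fn} => [//|n IH]; rewrite exprS endoM IH.
  by rewrite fn.
case: (fitting g fgX Xind) => // -[m gm]; case: Xind => nX _; case: nX => x.
have inj_m : injective (g ^+ m : Endo X).
  elim: m {gm} => [//|m IH] y z; rewrite exprS !endoM => /g_inj; exact: IH.
by apply: inj_m; rewrite gm.
Qed.

(** The identity of X is the sum of its components through Y and Z, one of which is invertible. *)
Lemma indecomposable_prod X Y Z : fg X -> indecomposable X ->
  retract X (Y * Z)%type -> retract X Y \/ retract X Z.
Proof.
move=> fgX Xind [s [r rs]].
pose f : Endo X := (r \o inl_linear Y Z) \o (fst_linear Y Z \o s).
pose g : Endo X := (r \o inr_linear Y Z) \o (snd_linear Y Z \o s).
have fg1 : f + g = 1.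
  apply: LinHomP => x; rewrite -[RHS]rs /= -linearD; congr (r _).
  by case: (s x) => y z; congr pair; rewrite /= ?addr0 ?add0r.
case: (endo_local fgX Xind fg1) => /linear_inverse[h [hK _]]; [left|right].
  exists (fst_linear Y Z \o s : {linear _ -> _}).
  by exists (h \o (r \o inl_linear Y Z) : {linear _ -> _}) => x; apply: hK.
exists (snd_linear Y Z \o s : {linear _ -> _}).
by exists (h \o (r \o inr_linear Y Z) : {linear _ -> _}) => x; apply: hK.
Qed.

Lemma indecomposable_add X V : fg X -> indecomposable X ->
  finite_retract V X -> retract X V.
Proof.
move=> fgX Xind VX.
have refl M : retract M M by exists idfun, idfun.
apply: (finite_retract_ind (C := fun Y => retract X Y -> retract X V) _ _ _ _ VX) => //.
- move=> Z Z0 [s [r rs]]; case: Xind => nX _; case: nX => x.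
  by rewrite -(rs x) (Z0 (s x)) linear0.
- by move=> Y Z CY CZ /(indecomposable_prod fgX Xind)[].
by move=> Y Z YZ CZ XY; apply: CZ; apply: retract_trans XY YZ.
Qed.

(** X is a minimal nonzero split image in Y; a decomposition into two nonzero summands would give a
    smaller one. *)
Lemma indecomposable_retract_exists Y : fg Y -> ~ zero_module Y ->
  exists X, [/\ fg X, indecomposable X & retract X Y].
Proof.
move=> fgY nY.
pose F (P : Y -> Prop) := (exists x, P x /\ x <> 0) /\
  exists X (s : {linear X -> Y}) (r : {linear Y -> X}),
    (forall x, r (s x) = x) /\ forall y, P y <-> exists x, s x = y.
have [||P [[[y0 [Py0 y0N]] [X [s [r [rs sP]]]]] Pmin]] :=
    @mf_minimal Y F (fun=> True) fgY.
- move=> P [_ [X [s [r [_ sP]]]]]; split; first by apply/sP; exists 0; rewrite linear0.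
  by move=> a _ _ /sP[x <-] /sP[y <-]; apply/sP; exists (a *: x + y); rewrite linearP.
- split.
    apply: contrapT => n0; apply: nY => x; apply: contrapT => xN; apply: n0.
    by exists x.
  by exists Y, idfun, idfun; split=> // y; split=> // _; exists y.
have XY : retract X Y by exists s, r.
exists X; split=> //; first exact: fg_retract XY fgY.
split=> [X0|A B [f fb]].
  by have [x xE] := (sP y0).1 Py0; apply: y0N; rewrite -xE (X0 x) linear0.
have [g [fK gK]] := linear_inverse fb.
apply: contrapT => /not_orP[nA nB]; apply: nB => b.
have [|||a aE] := Pmin (fun y => exists a, s (f (a, 0)) = y) _ _ (s (f (0, b))).
- split.
    apply: contrapT => n0; apply: nA => a; apply: contrapT => aN; apply: n0.
    exists (s (f (a, 0))); split; first by exists a.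
    move=> e0; apply: aN; have := congr1 (fun y => (g (r y)).1) e0.
    by rewrite rs fK !linear0.
  exists A, (s \o (f \o inl_linear A B) : {linear _ -> _}).
  exists (fst_linear A B \o (g \o r) : {linear _ -> _}).
  by split=> // x; rewrite /= rs fK.
- by move=> _ [a <-]; apply/sP; exists (f (a, 0)).
- by apply/sP; exists (f (0, b)).
have := congr1 (fun y => (g (r y)).2) aE.
by rewrite !rs !fK.
Qed.

Lemma isomorphic_zero_prod W Z : zero_module Z -> isomorphic (W * Z)%type W.
Proof.
move=> Z0; apply: isomorphic_sym; exists (inl_linear W Z).
by exists fst => // -[w z]; rewrite /= (Z0 z).
Qed.

Lemma retract_prod M N X Y :
  retract M X -> retract N Y -> retract (M * N)%type (X * Y)%type.
Proof.
case=> s [r rs] [s' [r' rs']].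
exists (pair_linear (s \o fst_linear M N : {linear _ -> _})
                    (s' \o snd_linear M N : {linear _ -> _})).
exists (pair_linear (r \o fst_linear X Y : {linear _ -> _})
                    (r' \o snd_linear X Y : {linear _ -> _})).
by case=> x y; rewrite /= rs rs'.
Qed.

(* Split off a common direct summand W of U and V with minimal complement in U. *)
Lemma basic_add_isomorphic U V : fg U -> fg V -> basic_module U -> basic_module V ->
  finite_retract U V -> finite_retract V U -> isomorphic U V.
Proof.
move=> fgU fgV Ubasic Vbasic UV VU.
have [O O0] := zero_module_exists R.
pose F (P : U -> Prop) := exists W U' V' (f : {linear (W * U')%type -> U}),
  [/\ bijective f, isomorphic (W * V')%type V
    & forall y, P y <-> exists u, f (0, u) = y].
have [||P [[W [U' [V' [f [fb WV' fP]]]]] Pmin]] := @mf_minimal U F (fun=> True) fgU.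
- move=> P [W [U' [V' [f [_ _ fP]]]]]; split.
    by apply/fP; exists 0; rewrite -[(0, 0)]/(0 : (W * U')%type) linear0.
  move=> a _ _ /fP[x <-] /fP[y <-]; apply/fP; exists (a *: x + y).
  exact: (linearP (f \o inr_linear W U' : {linear U' -> U})).
- exists O, U, V, (snd_linear O U); split.
  + exists (fun u => (0, u)) => // -[o u]; by rewrite (O0 o).
  + by apply: isomorphic_trans (isomorphic_prodC O V) _; apply: isomorphic_zero_prod.
  + by move=> y; split=> // _; exists y.
have WU' : isomorphic (W * U')%type U by exists f.
have WU := retract_iso WU'; have WV := retract_iso WV'.
have fg_retr M : retract M U -> fg M by move=> MU; apply: fg_retract MU fgU.
have U'U : retract U' U by apply: retract_trans WU; apply: retract_prodr.
have V'V : retract V' V by apply: retract_trans WV; apply: retract_prodr.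
have U'0 : zero_module U'.
  apply: contrapT => nU'.
  have [X [fgX Xind XU']] := indecomposable_retract_exists (fg_retr _ U'U) nU'.
  have XU := retract_trans XU' U'U.
  have XV := indecomposable_add fgX Xind (finite_retract_retract XU VU).
  have XWV' := retract_trans XV (retract_iso (isomorphic_sym WV')).
  (* X is a summand of U'. If it is also one of W, then its square is a summand of U, against
     basicness. Otherwise it occurs in V' too, and moving it into W shrinks the complement. *)
  case: (indecomposable_prod fgX Xind XWV') => [XW|XV'].
    apply: (Ubasic X Xind); apply/direct_summandP.
    by apply: retract_trans WU; apply: retract_prod.
  have [U2 [h hb]] := (direct_summandP X U').2 XU'.
  have [V2 XV2] := (direct_summandP X V').2 XV'.
  have [h' [hK _]] := linear_inverse hb; have [f' [fK _]] := linear_inverse fb.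
  case: (Xind) => nX _; apply: nX => x.
  have h0 (v : U2) : h (0, v) = h (inr_linear X U2 v) by [].
  pose f2 : {linear ((W * X) * U2)%type -> U} :=
    f \o pair_linear (fst_linear W X \o fst_linear (W * X)%type U2)
      (h \o pair_linear (snd_linear W X \o fst_linear (W * X)%type U2)
                        (snd_linear (W * X)%type U2)).
  have [|||u uE] := Pmin (fun y => exists u, f2 (0, u) = y) _ _ (f (0, h (x, 0))).
  - exists (W * X)%type, U2, V2, f2; split=> //.
      apply: inj_surj_bij => [[[w x1] u1] [[w' x1'] u1'] /=|u].
        by move=> /(can_inj fK)[-> /(can_inj hK)[-> ->]].
      case: fb => g _ gK; case: hb => g' _ gK'.
      exists (((g u).1, (g' (g u).2).1), (g' (g u).2).2).
      by rewrite /f2 /= -!surjective_pairing gK' -surjective_pairing gK.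
    apply: isomorphic_trans WV'.
    apply: isomorphic_trans (isomorphic_sym (isomorphic_prodA W X V2)) _.
    by apply: isomorphic_prod (isomorphic_refl W) XV2.
  - by move=> _ [u <-]; apply/fP; exists (h (0, u)).
  - by apply/fP; exists (h (x, 0)).
  by have := congr1 (fun y => (h' (f' y).2).1) uE; rewrite /f2 /= !fK /= !hK.
have UW : isomorphic U W.
  by apply: isomorphic_trans (isomorphic_sym WU') _; apply: isomorphic_zero_prod.
have V'0 : zero_module V'.
  apply: contrapT => nV'.
  have [X [fgX Xind XV']] := indecomposable_retract_exists (fg_retract V'V fgV) nV'.
  have XU := indecomposable_add fgX Xind
    (finite_retract_retract (retract_trans XV' V'V) UV).
  apply: (Vbasic X Xind); apply/direct_summandP.
  apply: retract_trans WV; apply: retract_prod XV'.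
  exact: retract_trans XU (retract_iso UW).
apply: isomorphic_trans UW _; apply: isomorphic_trans WV'.
exact/isomorphic_sym/isomorphic_zero_prod.
Qed.

End KrullSchmidt.

(** * Strong tilting modules *)

Section BasicRing.
Context (R : pzRingType) (Rnoeth : noetherian R).

Lemma left_ideal_submodule (I : R -> Prop) :
  left_ideal I <-> submodule (I : R^o -> Prop).
Proof.
split=> [[I0 ID IM]|subI]; first by split=> // a x y /(IM a) Ix Iy; apply: ID.
split; first by case: subI.
  exact: (submoduleD subI).
exact: (submoduleZ subI).
Qed.

(** The ascending chain condition, through [minimal_exists] for the reversed inclusion, takes the
    place of Zorn's lemma. *)
Lemma maximal_left_ideal_exists (I : R -> Prop) : left_ideal I -> ~ I 1 ->
  exists J, maximal_left_ideal J /\ forall x, I x -> J x.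
Proof.
move=> idI nI1.
pose F (J : R -> Prop) := [/\ left_ideal J, ~ J 1 & forall x, I x -> J x].
pose gt (J' J : R -> Prop) := (forall x, J x -> J' x) /\ exists x, J' x /\ ~ J x.
have [//|u uF ugt|J [[idJ nJ1 IJ] Jmax]] := @minimal_exists _ F gt I.
  have [n|n x|n nP] := @ascending_chain R Rnoeth R^o u (fg_regular R).
  - by apply/left_ideal_submodule; case: (uF n).
  - exact: (ugt n).1.
  by have [_ [x [ux []]]] := ugt n; apply: nP ux.
exists J; split=> //; split=> // J' idJ' nJ'1 JJ' x J'x.
apply: contrapT => nJx; apply: (Jmax J'); last by split=> //; exists x.
by split=> // y /IJ/JJ'.
Qed.

(** If R(1 - e) is proper, a maximal left ideal above it contains 1 - e and e, hence 1. Otherwise 1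
    = y(1 - e), and multiplying by e on the right gives e = 0. *)
Lemma jacobson_idempotent (e : R) : jacobson e -> e * e = e -> e = 0.
Proof.
move=> Je ee; pose I x := exists y, x = y * (1 - e).
have idI : left_ideal I.
  split; first by exists 0; rewrite mul0r.
    by move=> _ _ [x ->] [y ->]; exists (x + y); rewrite mulrDl.
  by move=> a _ [x ->]; exists (a * x); rewrite mulrA.
case: (pselect (I 1)) => [[y yE]|nI1].
  by rewrite -[e]mul1r yE -mulrA mulrBl mul1r ee subrr mulr0.
have [J [Jmax IJ]] := maximal_left_ideal_exists idI nI1.
have [[_ JD _] nJ1 _] := Jmax; case: nJ1.
rewrite -[1](subrK e); apply: JD; last exact: Je.
by apply: IJ; exists 1; rewrite mul1r.
Qed.

(* A summand P + P of the regular module gives matrix units e = hg, f = gh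
   in R; both idempotents vanish in every division ring over R. *)
Lemma basic_ring_square (P : lmodType R) :
  basic_ring R -> retract (P * P)%type R^o -> zero_module P.
Proof.
move=> [n [D [p [Ddiv _ pJ]]]] [s [r rs]].
pose a1 : {linear P -> R^o} := s \o inl_linear P P.
pose a2 : {linear P -> R^o} := s \o inr_linear P P.
pose b1 : {linear R^o -> P} := fst_linear P P \o r.
pose b2 : {linear R^o -> P} := snd_linear P P \o r.
have b1a1 x : b1 (a1 x) = x by rewrite /b1 /a1 /= rs.
have b1a2 x : b1 (a2 x) = 0 by rewrite /b1 /a2 /= rs.
have b2a1 x : b2 (a1 x) = 0 by rewrite /b2 /a1 /= rs.
have b2a2 x : b2 (a2 x) = x by rewrite /b2 /a2 /= rs.
(* Right multiplication by [a (b 1)] is the composite of [b] and [a], so products of the units below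
   are composites in reverse order. *)
have mulE (a : {linear P -> R^o}) (b : {linear R^o -> P}) (x : R) :
    x * a (b (1 : R)) = a (b x).
  by rewrite -[x * _]/((x : R) *: (_ : R^o)) -!linearZ [_ *: _]mulr1.
pose e : R := a1 (b1 (1 : R)); pose f : R := a2 (b2 (1 : R)).
pose g : R := a1 (b2 (1 : R)); pose h : R := a2 (b1 (1 : R)).
have ee : e * e = e by rewrite [LHS]mulE b1a1.
have ef : e * f = 0 by rewrite [LHS]mulE b2a1 linear0.
have hg : h * g = e by rewrite [LHS]mulE b2a2.
have gh : g * h = f by rewrite [LHS]mulE b1a1.
have e0 : e = 0.
  apply: (jacobson_idempotent _ ee); apply/pJ => i.
  have [//|pe] := eqVneq (p i e) 0.
  have [y [ye _]] := Ddiv i _ pe.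
  (* If e is nonzero in the division ring [D i], then f vanishes there by ef = 0; but e = ee = hfg
     vanishes with f. *)
  have pf : p i f = 0.
    by rewrite -[LHS]mul1r -ye -mulrA -rmorphM ef rmorph0 mulr0.
  by rewrite -ee -hg mulrA -(mulrA h) gh !rmorphM pf mulr0 mul0r.
have b10 : b1 (1 : R) = 0 by rewrite -[LHS]b1a1 -[a1 _]/e e0 linear0.
move=> x; rewrite -(b1a1 x).
have -> : a1 x = (a1 x : R) *: (1 : R^o) by rewrite [_ *: _]mulr1.
by rewrite linearZ -[b1 1]/(b1 (1 : R)) b10; exact: scaler0.
Qed.

End BasicRing.

Section ModuleFiniteTilting.
Context (k : comNzRingType) (k_art : artinian k).
Local Notation fg := finitely_generated.

Lemma mf_endo (R : pzRingType) (T : lmodType R) :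
  module_finite k R -> fg T -> module_finite k (Endo T).
Proof.
case=> phi [phi_central phi_fg] fgT.
exists (endo_morphism phi_central T); split.
  exact: endo_morphism_central.
exact: endo_morphism_fg.
Qed.

Lemma algebra_module_finite (A : algType k) :
  finitely_generated (A : lmodType k) -> module_finite k A.
Proof.
move=> fgA; exists (in_alg A); split=> [c r|]; first by rewrite mulr_algl mulr_algr.
have idL : linear (fun x : A => x : restrict (in_alg A) A^o).
  by move=> a x y; have /(congr1 (fun z => z + y)) := esym (mulr_algl a x).
by apply: (fg_surj (f := mk_linear idL)) fgA => y; exists y.
Qed.

Context (R : pzRingType) (Rfin : module_finite k R).
Let Rnoeth : noetherian R := mf_noetherian k_art Rfin.

Section Strong.
Context (T : lmodType R) (T_strong : strong_tilting T).

Lemma strong_nice : nice T T.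
Proof. by case: ((strong_tiltingE Rnoeth T).1 T_strong). Qed.

Lemma strong_coresolved : coresolved_by_add T.
Proof. by case: ((strong_tiltingE Rnoeth T).1 T_strong). Qed.

Lemma strong_perp M : fg M -> fin_pd M -> ext_perp T M.
Proof. by case: ((strong_tiltingE Rnoeth T).1 T_strong) => _ _; apply. Qed.

Lemma strong_fg : fg T.
Proof. by case: strong_nice. Qed.

Lemma strong_endo_finite : module_finite k (Endo T).
Proof. exact: mf_endo Rfin strong_fg. Qed.

Lemma strong_endo_noetherian : noetherian (Endo T).
Proof. exact (mf_noetherian k_art strong_endo_finite). Qed.

Let Enoeth := strong_endo_noetherian.

Lemma strong_Pfin_nice (M : lmodType R) : Pfin M <-> nice T M.
Proof.
split=> [/(PfinE Rnoeth)[fgM Mpd]|[fgM Mpd _]]; last exact/(PfinE Rnoeth).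
by split=> //; apply: strong_perp.
Qed.

Lemma strong_good M : Pfin M -> good (hom_pair T) M.
Proof.
by move=> /strong_Pfin_nice; apply: nice_good; [apply: Rnoeth|apply: Enoeth|
  apply: strong_nice|apply: strong_coresolved].
Qed.

Lemma strong_finite_retract V : strong_tilting V -> finite_retract T V.
Proof.
move=> V_strong; have [[PV _ _] VP] := V_strong.
have [fgV VT [[n [u uP]] _ _] rV] := strong_good PV.
have [V_inj _] := bij_inj_surj rV.
(* The coordinates of [i] generate Hom(V, T), so they separate the points of the reflexive module
   V. *)
pose i : {linear V -> {ffun 'I_n -> T}} :=
  mk_linear (ffun_pair_linear (fun j => u j : {linear V -> T})).
have i_inj : injective i.
  apply: linear_inj0 => x /ffunP x0; apply: V_inj; rewrite linear0.
  apply: LinHomP => v; rewrite [LHS](bidualE (hom_pair T)) /=.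
  have [c ->] := uP v; rewrite (app_sum (hom_pair T)) big1 // => j _.
  rewrite (dp_appZ (hom_pair T)) /=; have := x0 j; rewrite !ffunE => /= ->.
  exact: (linear0 (c j : {linear T -> T})).
have [C [c ic]] := cokernel_short_exact i_inj.
have fT : finite_retract T {ffun 'I_n -> T}.
  by apply/finite_retractP; exists n, idfun, idfun.
have [fgF Fpd _] := nice_finite_retract Rnoeth fT strong_nice.
have /(PfinE Rnoeth)[_ Vpd] := PV.
have [_ fgC] := short_exact_fg Rnoeth ic fgF.
have Cpd := fin_pd_cokernel Rnoeth ic fgF Vpd Fpd.
have [_ _ V_perp] := (strong_tiltingE Rnoeth V).1 V_strong.
(* V, being strong as well, is injective relative to this sequence; the extension of its identity
   splits [i]. *)
have [g gE] := ext_perp1 (V_perp C fgC Cpd) ic idfun.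
by apply/finite_retractP; exists n, i, g.
Qed.

Lemma strong_duality :
  induce_duality (HomTo T) (HomEndTo T)
    (fun M : lmodType R => Pfin M)
    (fun X : lmodType (Endo T) => Pfin X /\ perp (end_mod T) X).
Proof.
have -> : (fun M : lmodType R => Pfin M) = nice T.
  by apply/funext => M; apply/propext/strong_Pfin_nice.
have -> : (fun X : lmodType (Endo T) => Pfin X /\ perp (end_mod T) X) =
    nice (end_mod T).
  apply/funext => X; apply/propext; split=> [?|?]; exact/(niceE Enoeth).
apply: (tilting_duality Rnoeth Enoeth strong_nice); exact: strong_coresolved.
Qed.

Lemma strong_nice_end_mod : nice (end_mod T) (end_mod T).
Proof. exact: nice_end_mod Rnoeth Enoeth strong_nice strong_coresolved. Qed.

(** Over the endomorphism ring T is tilting in any case, so only the orthogonality of P^{<oo} to T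
    is left. *)
Lemma strong_end_modP :
  strong_tilting (end_mod T) <->
  forall X : lmodType (Endo T), Pfin X -> perp (end_mod T) X.
Proof.
rewrite (strong_tiltingE Enoeth); split=> [[_ _ TP] X PX|TP].
  have [fgX Xpd] := (PfinE Enoeth X).1 PX.
  by case: ((niceE Enoeth (end_mod T) X).1 (And3 fgX Xpd (TP X fgX Xpd))).
split; first exact: strong_nice_end_mod.
  exact: (coresolved_end_mod Rnoeth strong_nice).
move=> X fgX Xpd; have PX : Pfin X by apply/(PfinE Enoeth).
by case: ((niceE Enoeth (end_mod T) X).2 (conj PX (TP X PX))).
Qed.

(** Hom(-, T) carries a summand X + X of T to one of Hom(T, T), which is R because R is its own
    bidual. Hence Hom(X, T) = 0, and X, being reflexive, is zero. *)
Lemma strong_end_mod_basic :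
  basic_ring R -> strong_tilting (end_mod T) -> basic_module (end_mod T).
Proof.
move=> Rbasic /strong_end_modP TP X [nX _] /direct_summandP XXT; apply: nX => x.
pose dp' := dual_pair_sym (hom_pair T).
have goodT : good dp' (end_mod T).
  by apply: (nice_goodE Rnoeth Enoeth strong_nice); apply: strong_nice_end_mod.
have XT : finite_retract (end_mod T) X.
  apply: (finite_retract_retract _ (finite_retract_refl _)).
  exact: retract_trans (retract_prodl X X) XXT.
have [_ _ _ rX] := good_finite_retract Enoeth Rnoeth XT goodT.
have GX0 : zero_module (HomEndTo T X).
  apply: (basic_ring_square Rnoeth Rbasic).
  have [s [r rs]] := XXT.
  have RT : isomorphic R^o (HomEndTo T (end_mod T)).
    have [_ _ _ rR] := good_regular Rnoeth Enoeth strong_nice strong_coresolved.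
    apply: (@isomorphic_trans _ _ (HomEndTo T (HomTo T R^o))).
      by exists (bidual (hom_pair T) R^o).
    exact/isomorphic_dual/(cf_regular (hom_pair T)).
  apply: retract_trans (retract_iso (isomorphic_sym RT)).
  pose G := HomEndTo T.
  exists (copair_linear (cf_map G (fst_linear X X \o r : {linear _ -> _}))
                        (cf_map G (snd_linear X X \o r : {linear _ -> _}))).
  exists (pair_linear (cf_map G (s \o inl_linear X X : {linear _ -> _}))
                      (cf_map G (s \o inr_linear X X : {linear _ -> _}))).
  case=> u v; congr pair; apply: LinHomP => y /=; rewrite !rs /= linear0.
    by rewrite addr0.
  by rewrite add0r.
have [X_inj _] := bij_inj_surj rX; apply: X_inj; rewrite linear0.
by apply: LinHomP => u; rewrite (GX0 u) !linear0.
Qed.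

End Strong.

Lemma strong_basic_isomorphic (U V : lmodType R) :
    strong_tilting U -> strong_tilting V -> basic_module U -> basic_module V ->
  isomorphic U V.
Proof.
move=> U_strong V_strong Ub Vb.
by apply: (basic_add_isomorphic k_art Rfin) => //; try exact: strong_fg;
  apply: strong_finite_retract.
Qed.

Lemma strong_tilting_iso (U V : lmodType R) :
  isomorphic U V -> strong_tilting U -> strong_tilting V.
Proof.
move=> UV /(strong_tiltingE Rnoeth)[niceU [m [X [e [d [UX X0 e_inj eE dE]]]]] UP].
apply/(strong_tiltingE Rnoeth); split.
- apply: (nice_iso UV); apply: nice_retract niceU => //.
  exact/retract_iso/isomorphic_sym.
- exists m, X, e, d; split=> // j /UX/in_addP UXj.
  exact/in_addP/(finite_retract_base UV UXj).
by move=> M fgM Mpd; apply: (ext_perp_iso UV); apply: UP.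
Qed.

End ModuleFiniteTilting.

(** * Strong tilting modules over the endomorphism ring *)

Section Iterated.
Context (k : comNzRingType) (k_art : artinian k) (R : pzRingType).
Context (Rfin : module_finite k R) (T : lmodType R) (T_strong : strong_tilting T).
Local Notation E := (Endo T).
Local Notation fg := finitely_generated.
Let Efin : module_finite k E := strong_endo_finite k_art Rfin T_strong.
Let Enoeth : noetherian E := mf_noetherian k_art Efin.

Lemma iterated_strong (U : lmodType E) :
  strong_tilting U -> strong_tilting (end_mod U).
Proof.
move=> U_strong; apply/(strong_end_modP k_art Efin U_strong) => N PN.
have Snoeth := strong_endo_noetherian k_art Efin U_strong.
have [fgN [n Nn]] := (PfinE Snoeth N).1 PN.
suff NU : ext_perp (end_mod U) N.
  by case: ((niceE Snoeth (end_mod U) N).1 (And3 fgN (ex_intro _ n Nn) NU)).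
apply: (cogenerator_strong Enoeth Snoeth) Nn => //.
  exact: (strong_nice k_art Efin U_strong).
move=> X fgX X0.
have Rnoeth := mf_noetherian k_art Rfin.
apply: (hom_eq0_zero Rnoeth Enoeth _ _ fgX).
- exact: (strong_nice k_art Rfin T_strong).
- move=> M; exact: (strong_perp k_art Rfin T_strong).
(* A map X -> T followed by any T -> U is zero, since X has no nonzero map to U; as T is reflexive
   with respect to U, the maps T -> U separate its points. *)
have [fgT Tpd _] := strong_nice_end_mod k_art Rfin T_strong.
have PT : Pfin (end_mod T) by apply/(PfinE Enoeth).
have [_ _ _ rT] := strong_good k_art Efin U_strong PT.
have [T_inj _] := bij_inj_surj rT.
move=> u x; apply: T_inj; rewrite linear0; apply: LinHomP => v.
rewrite [LHS](bidualE (hom_pair U)) /=.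
exact: (X0 (v \o u : {linear X -> U}) x).
Qed.

Lemma iterated_duality (U : lmodType E) : strong_tilting U ->
  induce_duality (HomTo U) (HomEndTo U)
    (fun X : lmodType E => Pfin X) (fun N : lmodType (Endo U) => Pfin N).
Proof.
move=> U_strong.
have -> : (fun N : lmodType (Endo U) => Pfin N) =
    (fun N => Pfin N /\ perp (end_mod U) N).
  apply/funext => N; apply/propext; split=> [PN|[]//]; split=> //.
  by apply: (strong_end_modP k_art Efin U_strong).1 PN; apply: iterated_strong.
exact: (strong_duality k_art Efin U_strong).
Qed.

End Iterated.

Theorem corollary3p4 (k : comNzRingType) (L : algType k)
    (L_artin : artin_algebra L) (L_basic : basic_ring L)
    (L_cf : Pfin_contravariantly_finite L)
    (T : lmodType L) (T_basic : basic_module T) (T_strong : strong_tilting T)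
    (Lt_cf : Pfin_contravariantly_finite (Endo T))
    (Tt : lmodType (Endo T))
    (Tt_basic : basic_module Tt) (Tt_strong : strong_tilting Tt) :
  [/\ induce_duality (HomTo T) (HomEndTo T)
        (fun M : lmodType L => Pfin M)
        (fun X : lmodType (Endo T) => Pfin X /\ perp (end_mod T) X),
      (forall X : lmodType (Endo T), Pfin X /\ perp (end_mod T) X -> Pfin X),
      induce_duality (HomTo Tt) (HomEndTo Tt)
        (fun X : lmodType (Endo T) => Pfin X)
        (fun N : lmodType (Endo Tt) => Pfin N),
      ((forall X : lmodType (Endo T), Pfin X -> perp (end_mod T) X) <->
         two_sided_strong T)
    & (two_sided_strong T <-> isomorphic (end_mod T) Tt)].
Proof.
case: L_artin => k_art fgL; have Lfin := algebra_module_finite fgL.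
have Efin := strong_endo_finite k_art Lfin T_strong.
split.
- exact: (strong_duality k_art Lfin T_strong).
- by move=> X [].
- exact (iterated_duality k_art Lfin T_strong Tt_strong).
- rewrite -(strong_end_modP k_art Lfin T_strong).
  by split=> [|[]].
split=> [[_ ET_strong]|ETt].
  apply: (strong_basic_isomorphic k_art Efin) => //.
  exact: (strong_end_mod_basic k_art Lfin T_strong L_basic ET_strong).
split=> //; apply: (strong_tilting_iso k_art Efin _ Tt_strong).
exact: isomorphic_sym.
Qed.
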